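(* Let $f$ be a function of class $\mathcal D$ having negative spectrum and suppose that the topological pressure $P(t)$ has a zero $h>\Theta_f$. Then the hyperbolic dimension of $f$ equals $h$: $\operatorname{HypDim}(f)=h$.
   Context: Notation: $\mathbb D=\{|z|<1\}$, $\mathbb D^*=\{|z|>1\}$, $\mathcal H=\{\Re\xi>0\}$, $Q_T=\{0<\Re\xi<4T,|\Im\xi|<4T\}$. Class $\mathcal D$: either an entire function $f$ with $S(f)$ (closure of critical and finite asymptotic values) contained in $\mathbb D$ and finitely many components $\Omega_1,\dots,\Omega_N$ of $f^{-1}(\mathbb D^* )$ (tracts; $f=\exp\circ\tau_j$ on $\Omega_j$ with $\tau_j:\Omega_j\to\mathcal H$ conformal), or a model function $f=e^{\tau_j}$ on a finite disjoint union $\Omega=\bigcup\Omega_j$ of unbounded simply connected domains with conformal $\tau_j:\Omega_j\to\mathcal H$ whose inverses $\varphi_j$ satisfy $|\varphi_j(\xi_n)|\to\infty$ as $|\xi_n|\to\infty$; in both cases $\overline\Omega\cap\overline{\mathbb D}=\emptyset$ and for each $j$ there is $M$ with $|\varphi_j(\xi)|\le M|\varphi_j(\xi')|$ for $\xi,\xi'\in Q_T\setminus Q_{T/8}$, $T$ large. Spectrum: $\varphi_{j,T}(\xi)=\varphi_j(T\xi)/|\varphi_j(T)|$, $\beta_h(r,t)=\log\int_I|h'(r+iy)|^tdy/\log(1/r)$ with $I=[-2,-1]\cup[1,2]$, $\beta_{\infty,j}(t)=\limsup_{T\to\infty}\beta_{\varphi_{j,T}}(1/T,t)$, $b_{\infty,j}(t)=\beta_{\infty,j}(t)-t+1$,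 $\Theta_f=\max_j$(smallest positive zero of $b_{\infty,j}$), $b_\infty=\max_j b_{\infty,j}$; negative spectrum: $b_\infty(t)<0$ for $t>\Theta_f$. Pressure: $|f'(z)|_1=|f'(z)||z|/|f(z)|$, $\mathcal L_tg(w)=\sum_{z\in f^{-1}(w)}|f'(z)|_1^{-t}g(z)$, and for $t>\Theta_f$, $P(t)=\lim_{n\to\infty}\frac1n\log\mathcal L_t^n\mathbb 1(w)$, $w\in\mathcal J_f$ (this limit exists and is independent of $w$). Julia set: usual one for entire $f$; for a model $\mathcal J_f=\{z\in\mathbb D^*:f^n(z)\in\mathbb D^*\ \forall n\}$. $\operatorname{HypDim}(f)$ is the Hausdorff dimension of $\{z\in\mathcal J_f:\liminf_n|f^n(z)|<\infty\}$. *)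

(* Defs.v *)
(* The complex plane is R[i] (mathcomp-real-closed)
   over an arbitrary R : realType, equipped with its structure of normed
   module over itself, so that [derivable g z 1] / ['D_1 g z] is the complex
   derivative. *)
From HB Require Import structures.
From mathcomp Require Import all_boot all_order all_algebra.
From mathcomp Require Import all_classical all_reals all_analysis.
From mathcomp Require Import complex.
Import Order.TTheory GRing.Theory Num.Theory.
Import numFieldNormedType.Exports.

Set Implicit Arguments.
Unset Strict Implicit.
Unset Printing Implicit Defensive.

Local Open Scope classical_set_scope.
Local Open Scope ring_scope.

HB.instance Definition _ (R : rcfType) := GRing.ComAlgebra.copy R[i] (R[i])^o.
HB.instance Definition _ (R : rcfType) := Vector.copy R[i] (R[i])^o.
HB.instance Definition _ (R : rcfType) := NormedModule.copy R[i] (R[i])^o.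

Section Defs.
Variable R : realType.
Local Notation C := R[i].

Definition cabs (z : C) : R := Num.sqrt (complex.Re z ^+ 2 + complex.Im z ^+ 2).

Definition cexp (z : C) : C :=
  Complex (expR (complex.Re z) * cos (complex.Im z))
          (expR (complex.Re z) * sin (complex.Im z)).

Definition Dunit : set C := [set z | cabs z < 1].
Definition Dext : set C := [set z | 1 < cabs z].
Definition Hright : set C := [set xi | 0 < complex.Re xi].
Definition Qbox (T : R) : set C :=
  [set xi | 0 < complex.Re xi < 4 * T /\ `|complex.Im xi| < 4 * T].

Definition holo (U : set C) (g : C -> C) : Prop :=
  open U /\ forall z, U z -> derivable g z 1.

Definition unbounded_set (U : set C) : Prop :=
  forall M : R, exists2 z, U z & M < cabs z.

Definition critical_values (f : C -> C) : set C :=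
  [set f z | z in [set z | 'D_1 f z = 0]].
Definition asymptotic_values (f : C -> C) : set C :=
  [set a | exists gamma : R -> C, continuous gamma /\
      (cabs (gamma t) @[t --> +oo] --> +oo) /\
      (f (gamma t) @[t --> +oo] --> a)].
Definition sing_set (f : C -> C) : set C :=
  closure (critical_values f `|` asymptotic_values f).

(* Class D.  [entire = true]: f is an entire function of class D with tracts
   Om j; [entire = false]: f is a model function defined on \bigcup_j Om j.
   phi j is the inverse of the conformal map tau j : Om j -> H. *)
Definition classD (f : C -> C) (entire : bool) (N : nat)
  (Om : 'I_N -> set C) (tau phi : 'I_N -> C -> C) : Prop :=
  [/\ (forall j, open (Om j) /\ connected (Om j) /\ unbounded_set (Om j)),
      (forall i j, i != j -> Om i `&` Om j = set0),
      (forall j, holo (Om j) (tau j) /\ set_bij (Om j) Hright (tau j) /\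
         (forall xi, Hright xi -> Om j (phi j xi) /\ tau j (phi j xi) = xi)),
      (forall j z, Om j z -> f z = cexp (tau j z)) /\
      closure (\bigcup_j Om j) `&` closure Dunit = set0 &
      (forall j, exists M : R, exists T0 : R, forall T, T0 <= T ->
         forall xi xi', (Qbox T `\` Qbox (T / 8)) xi ->
                        (Qbox T `\` Qbox (T / 8)) xi' ->
           cabs (phi j xi) <= M * cabs (phi j xi')) /\
      (if entire then
         [/\ (forall z, derivable f z 1),
             sing_set f `<=` Dunit,
             (forall j, exists2 z, (f @^-1` Dext) z &
                 Om j = connected_component (f @^-1` Dext) z) &
             (forall z, (f @^-1` Dext) z -> exists j, Om j z)]
       else
         (forall j (xi : nat -> C), (forall n, Hright (xi n)) ->
            (cabs (xi n) @[n --> \oo] --> +oo) ->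
            (cabs (phi j (xi n)) @[n --> \oo] --> +oo)))].

Definition fdom (entire : bool) (N : nat) (Om : 'I_N -> set C) : set C :=
  if entire then setT else \bigcup_j Om j.

Definition loc_unif_cvg (U : set C) (g : nat -> C -> C) (G : C -> C) : Prop :=
  forall w, U w -> exists2 d : R, 0 < d &
    (forall x, cabs (x - w) < d -> U x) /\
    (forall e : R, 0 < e -> \forall k \near \oo,
        forall x, cabs (x - w) < d -> cabs (g k x - G x) < e).
Definition loc_unif_infty (U : set C) (g : nat -> C -> C) : Prop :=
  forall w, U w -> exists2 d : R, 0 < d &
    (forall x, cabs (x - w) < d -> U x) /\
    (forall M : R, \forall k \near \oo,
        forall x, cabs (x - w) < d -> M < cabs (g k x)).
(* normality in the sense of Montel (spherical metric, limit infinity allowed) *)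
Definition normal_family (U : set C) (F : nat -> C -> C) : Prop :=
  forall s : nat -> nat, exists s' : nat -> nat,
    {homo s' : n m / (n < m)%N} /\
    ((exists G, loc_unif_cvg U (fun k => F (s (s' k))) G) \/
     loc_unif_infty U (fun k => F (s (s' k)))).
Definition fatou (f : C -> C) : set C :=
  [set z | exists2 r : R, 0 < r &
     normal_family [set x | cabs (x - z) < r] (fun n => iter n f)].

Definition julia (f : C -> C) (entire : bool) (N : nat) (Om : 'I_N -> set C)
  : set C :=
  if entire then ~` fatou f
  else [set z | forall n, (\bigcup_j Om j) (iter n f z)].

Definition diamC (U : set C) : R := sup [set cabs (x - y) | x in U & y in U].
Definition hausdorff_pre (s d : R) (A : set C) : \bar R :=
  ereal_inf [set (\sum_(0 <= i <oo) ((diamC (U i)) `^ s)%:E)%E |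
     U in [set U : nat -> set C | A `<=` \bigcup_i U i /\
        (forall i x y, U i x -> U i y -> cabs (x - y) <= d)]].
Definition hausdorff_measure (s : R) (A : set C) : \bar R :=
  ereal_sup [set hausdorff_pre s d A | d in [set d : R | 0 < d]].
Definition hausdorff_dim (A : set C) : \bar R :=
  ereal_inf [set s%:E | s in [set s : R | 0 < s /\ hausdorff_measure s A = 0%E]].

Definition hyp_dim (f : C -> C) (entire : bool) (N : nat) (Om : 'I_N -> set C)
  : \bar R :=
  hausdorff_dim [set z | julia f entire Om z /\
     (limn_einf (fun n => (cabs (iter n f z))%:E) < +oo)%E].

Definition Iset : set R := `[-2, -1] `|` `[1, 2].
Definition phiT (g : C -> C) (T : R) (xi : C) : C :=
  g (Complex T 0 * xi) / Complex (cabs (g (Complex T 0))) 0.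
Definition beta_h (h : C -> C) (r t : R) : R :=
  ln (Rintegral lebesgue_measure Iset
        (fun y => cabs ('D_1 h (Complex r y)) `^ t)) / ln (1 / r).
Definition beta_inf (g : C -> C) (t : R) : \bar R :=
  limf_esup (fun T : R => (beta_h (phiT g T) (1 / T) t)%:E) (+oo : set_system R).
Definition b_inf (g : C -> C) (t : R) : \bar R :=
  (beta_inf g t - t%:E + 1)%E.
Definition first_zero (g : C -> C) : \bar R :=
  ereal_inf [set t%:E | t in [set t : R | 0 < t /\ b_inf g t = 0%E]].
Definition Theta (N : nat) (phi : 'I_N -> C -> C) : \bar R :=
  \big[Order.max/-oo%E]_(j < N) first_zero (phi j).
Definition b_inf_max (N : nat) (phi : 'I_N -> C -> C) (t : R) : \bar R :=
  \big[Order.max/-oo%E]_(j < N) b_inf (phi j) t.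
Definition negative_spectrum (N : nat) (phi : 'I_N -> C -> C) : Prop :=
  forall t : R, (Theta phi < t%:E)%E -> (b_inf_max phi t < 0)%E.

Definition abs1_deriv (f : C -> C) (z : C) : R :=
  cabs ('D_1 f z) * cabs z / cabs (f z).
Definition transfer (f : C -> C) (dom : set C) (t : R) (g : C -> \bar R)
  (w : C) : \bar R :=
  \esum_(z in [set z | dom z /\ f z = w]) ((abs1_deriv f z `^ (- t))%:E * g z)%E.
Definition transfer_iter (f : C -> C) (dom : set C) (t : R) (n : nat) : C -> \bar R :=
  iter n (transfer f dom t) (fun _ => 1%E).
Definition pressure_zero (f : C -> C) (entire : bool) (N : nat)
  (Om : 'I_N -> set C) (t : R) : Prop :=
  exists2 w, julia f entire Om w &
    (forall n, (0 < transfer_iter f (fdom entire Om) t n w < +oo)%E) /\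
    (ln (fine (transfer_iter f (fdom entire Om) t n w)) / n%:R
       @[n --> \oo] --> (0 : R)).

End Defs.

(* Main.v *)
(* Choose logarithms u_j of the inverses phi_j of the conformal maps tau_j.  The
   inverse branches of f become the maps xi |-> u_j (xi + 2 pi i k) of the right
   half-plane, and the n-th iterate of the transfer operator at exp(x) becomes
   the sum S_n of |g'(x)|^h over all compositions g of n such maps.  Koebe
   distortion and the Schwarz--Pick lemma show that these compositions have
   bounded distortion and contract exponentially, uniformly in g.

   Upper bound: the radial Julia set is covered, up to a countable union, by the
   images of a fixed box under all long compositions; as S_n grows
   subexponentially, the sum of the t-th powers of the diameters tends to 0 for
   every t > h.

   Lower bound: negative spectrum at an exponent p < h bounds the sum over k of
   |u_j'(x + 2 pi i k)|^p, so the one-step sums at exponent h tend to 0 as Re x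
   grows.  Hence infinitely often a fixed proportion of S_n comes from
   compositions landing in a bounded region.  For s < h a pigeonhole argument
   extracts from these a finite iterated function system whose limit set has
   positive s-dimensional measure and lies in the radial Julia set. *)

Require Import Defs.
From HB Require Import structures.
From mathcomp Require Import all_boot all_order all_algebra.
From mathcomp Require Import all_classical all_reals all_analysis.
From mathcomp Require Import measurable_realfun complex.
From mathcomp Require Import ring lra zify.
Import Order.TTheory GRing.Theory Num.Theory.
Import numFieldNormedType.Exports.
Local Open Scope classical_set_scope.
Local Open Scope ring_scope.

Set Implicit Arguments.
Unset Strict Implicit.
Unset Printing Implicit Defensive.

Local Open Scope complex_scope.

(** * Complex differentiability *)

Section Modulus.
Variable R : realType.
Local Notation C := R[i].
Implicit Types (z w : C).

(** Uniform contraction rests on one number. The closures of the tracts and of the unit disc are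
    disjoint, so the tracts lie in |z| >= exp a with a > 0, and every branch maps the half-plane
    into Re > a. As all compositions are univalent on the whole half-plane, Koebe's theorem applies
    at every point with constants (160, 15000) that are far from sharp but independent of the word.
    The translations by 2 pi i k make the alphabet infinite, so mass could escape to Re = +oo; the
    strict inequality Theta < h leaves room for an exponent in between, and the surplus becomes a
    rate of decay in Re x. No conformal measure is constructed: infinite sums are read through
    finite lists, and the measure of the limit set is positive because its covers induce covers of
    [0, 1). For an entire f the Julia set is defined by normality, which requires two more facts: a
    point whose orbit leaves the tracts is in the Fatou set, and the iterates are not normal at the
    points of the constructed limit set. *)

Lemma cabsE z : (cabs z)%:C = `|z|. Proof. by rewrite normc_def. Qed.
Lemma cabs_ge0 z : 0 <= cabs z. Proof. exact: sqrtr_ge0. Qed.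
Lemma cabsM z w : cabs (z * w) = cabs z * cabs w.
Proof. by apply: (@complexI R); rewrite rmorphM /= !cabsE normrM. Qed.
Lemma cabsD z w : cabs (z + w) <= cabs z + cabs w.
Proof. by rewrite -lecR rmorphD /= !cabsE; exact: ler_normD. Qed.
Lemma cabsN z : cabs (- z) = cabs z.
Proof. by apply: (@complexI R); rewrite !cabsE normrN. Qed.
Lemma cabsC z w : cabs (z - w) = cabs (w - z).
Proof. by rewrite -cabsN opprB. Qed.
Lemma cabs0 : cabs (0 : C) = 0.
Proof. by apply: (@complexI R); rewrite cabsE normr0. Qed.
Lemma cabs1 : cabs (1 : C) = 1.
Proof. by apply: (@complexI R); rewrite cabsE normr1. Qed.
Lemma cabs_eq0 z : (cabs z == 0) = (z == 0).
Proof. by rewrite -(inj_eq (@complexI R)) cabsE normr_eq0. Qed.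
Lemma cabs_gt0 z : (0 < cabs z) = (z != 0).
Proof. by rewrite lt0r cabs_eq0 cabs_ge0 andbT. Qed.
Lemma cabsV z : cabs z^-1 = (cabs z)^-1.
Proof. by apply: (@complexI R); rewrite fmorphV /= !cabsE normfV. Qed.
Lemma cabsX z n : cabs (z ^+ n) = cabs z ^+ n.
Proof. by apply: (@complexI R); rewrite rmorphXn /= !cabsE normrX. Qed.
Lemma cabs_real (r : R) : cabs r%:C = `|r|.
Proof. by rewrite /cabs /= expr0n /= addr0 sqrtr_sqr. Qed.
Lemma cabs_natr n : cabs (n%:R : C) = n%:R.
Proof. by rewrite -[n%:R](rmorph_nat (real_complex R)) cabs_real ger0_norm. Qed.
Lemma Re_le_cabs z : `|complex.Re z| <= cabs z.
Proof. by rewrite -sqrtr_sqr ler_wsqrtr// lerDl sqr_ge0. Qed.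
Lemma Im_le_cabs z : `|complex.Im z| <= cabs z.
Proof. by rewrite -sqrtr_sqr ler_wsqrtr// lerDr sqr_ge0. Qed.
Lemma cabs_le_ReIm z : cabs z <= `|complex.Re z| + `|complex.Im z|.
Proof.
case: z => a b /=; have -> : Complex a b = a%:C + Complex 0 1 * b%:C by simpc.
apply: le_trans (cabsD _ _) _; rewrite cabsM !cabs_real.
have -> : cabs (Complex 0 1 : C) = 1.
  by rewrite /cabs /= expr0n expr1n add0r sqrtr1.
by rewrite mul1r.
Qed.
Lemma cabsB_tri z w v : cabs (z - v) <= cabs (z - w) + cabs (w - v).
Proof. by apply: le_trans (cabsD _ _); rewrite addrA subrK. Qed.
Lemma cabs_lb z w : cabs z - cabs w <= cabs (z - w).
Proof. by rewrite lerBlDr; apply: le_trans (cabsD _ _); rewrite subrK. Qed.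
Lemma sqr_cabs z : (cabs z) ^+ 2 = complex.Re z ^+ 2 + complex.Im z ^+ 2.
Proof. by rewrite sqr_sqrtr // addr_ge0 // sqr_ge0. Qed.
Lemma ReD z w : complex.Re (z + w) = complex.Re z + complex.Re w.
Proof. by case: z w => a b [c d]. Qed.
Lemma ImD z w : complex.Im (z + w) = complex.Im z + complex.Im w.
Proof. by case: z w => a b [c d]. Qed.
Lemma ReN z : complex.Re (- z) = - complex.Re z.
Proof. by case: z. Qed.
Lemma ImN z : complex.Im (- z) = - complex.Im z.
Proof. by case: z. Qed.
Lemma ReM z w : complex.Re (z * w) =
  complex.Re z * complex.Re w - complex.Im z * complex.Im w.
Proof. by case: z w => a b [c d]. Qed.
Lemma ImM z w : complex.Im (z * w) =
  complex.Re z * complex.Im w + complex.Im z * complex.Re w.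
Proof. by case: z w => a b [c d]. Qed.

Lemma cabs_eq_limit z w : (forall e, 0 < e -> cabs (z - w) <= e) -> z = w.
Proof.
move=> H; apply/eqP; rewrite -subr_eq0 -cabs_eq0 eq_le cabs_ge0 andbT.
by rewrite leNgt; apply/negP => h; have := H (cabs (z - w) / 2); lra.
Qed.

(** Rotation by [c] turns a modulus into a real part, so that real one-variable theorems and linear
    sums can bound complex moduli. *)
Lemma unimodular_conj z : exists2 c : C, cabs c = 1 & c * z = (cabs z)%:C.
Proof.
have [->|z0] := eqVneq z 0; first by exists 1; rewrite ?cabs1 // mulr0 cabs0.
exists ((cabs z)%:C / z); last by rewrite divfK.
by rewrite cabsM cabs_real cabsV ger0_norm ?cabs_ge0 // divff // cabs_eq0.
Qed.

End Modulus.

(* Continuity and differentiability are stated once for maps X -> R[i] out of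
   a space X sitting in R[i] through [j]: [j = id] gives complex
   differentiability, [j = real_complex R] paths. *)
Section Derivative.
Variables (R : realType) (X : Type) (j : X -> R[i]).
Local Notation C := R[i].
Implicit Types (f g : X -> C) (x y : X).

Definition gcont f x := forall e : R, 0 < e -> exists2 r, 0 < r &
  forall y, cabs (j y - j x) < r -> cabs (f y - f x) < e.
Definition gder f x (d : C) := forall e : R, 0 < e -> exists2 r, 0 < r &
  forall y, cabs (j y - j x) < r ->
    cabs (f y - f x - d * (j y - j x)) <= e * cabs (j y - j x).

Lemma gcont_cst (c : C) x : gcont (fun=> c) x.
Proof. by move=> e e0; exists 1 => // y _; rewrite subrr cabs0. Qed.
Lemma gcont_id x : gcont j x.
Proof. by move=> e e0; exists e. Qed.
Lemma gcontD f g x : gcont f x -> gcont g x -> gcont (fun y => f y + g y) x.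
Proof.
move=> cf cg e e0; have e20 : 0 < e / 2 by lra.
have [r r0 hr] := cf _ e20; have [s s0 hs] := cg _ e20.
exists (Num.min r s); first by rewrite lt_min r0.
move=> y; rewrite lt_min => /andP[/hr h1 /hs h2].
have := cabsD (f y - f x) (g y - g x).
by rewrite addrACA -opprD; lra.
Qed.
Lemma gcontM f g x : gcont f x -> gcont g x -> gcont (fun y => f y * g y) x.
Proof.
move=> cf cg e e0.
set A := cabs (f x) + 1; set B := cabs (g x) + 1.
have A0 : 0 < A by have := cabs_ge0 (f x); rewrite /A; lra.
have B0 : 0 < B by have := cabs_ge0 (g x); rewrite /B; lra.
have [r r0 hr] := cf (Num.min 1 (e / (2 * B))) ltac:(by rewrite lt_min ltr01 divr_gt0 // mulr_gt0).
have [s s0 hs] := cg (Num.min 1 (e / (2 * A))) ltac:(by rewrite lt_min ltr01 divr_gt0 // mulr_gt0).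
exists (Num.min r s); first by rewrite lt_min r0.
move=> y; rewrite lt_min => /andP[/hr + /hs]; rewrite !lt_min => /andP[_ h1] /andP[h3 h2].
have -> : f y * g y - f x * g x = (f y - f x) * g y + f x * (g y - g x) by ring.
have := cabsD ((f y - f x) * g y) (f x * (g y - g x)); rewrite !cabsM.
have gB : cabs (g y) <= B.
  by have := cabsD (g y - g x) (g x); rewrite subrK /B; lra.
rewrite ltr_pdivlMr ?mulr_gt0 // in h1; rewrite ltr_pdivlMr ?mulr_gt0 // in h2.
have h4 : cabs (f y - f x) * cabs (g y) <= cabs (f y - f x) * B.
  by apply: ler_wpM2l => //; exact: cabs_ge0.
have h5 : cabs (f x) * cabs (g y - g x) <= A * cabs (g y - g x).
  by apply: ler_wpM2r; [exact: cabs_ge0|rewrite /A lerDl].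
lra.
Qed.
Lemma gcontN f x : gcont f x -> gcont (fun y => - f y) x.
Proof.
move=> cf e e0; have [r r0 hr] := cf _ e0; exists r => // y /hr.
by rewrite -opprD cabsN.
Qed.
Lemma gcontB f g x : gcont f x -> gcont g x -> gcont (fun y => f y - g y) x.
Proof. by move=> cf cg; apply: gcontD => //; exact: gcontN. Qed.
Lemma gcontV f x : f x != 0 -> gcont f x -> gcont (fun y => (f y)^-1) x.
Proof.
rewrite -cabs_gt0 => f0 cf e e0.
have [r r0 hr] := cf (Num.min (cabs (f x) / 2) (e * (cabs (f x) * cabs (f x)) / 2))
  ltac:(by rewrite lt_min !divr_gt0 // !mulr_gt0).
exists r => // y /hr; rewrite lt_min => /andP[h1 h2].
have fy : cabs (f x) / 2 < cabs (f y).
  by have := cabs_lb (f x) (f x - f y); rewrite subKr [cabs (f x - _)]cabsC; lra.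
have fy0 : 0 < cabs (f y) by lra.
have -> : (f y)^-1 - (f x)^-1 = (f x - f y) / (f x * f y).
  by field; rewrite -!cabs_gt0 f0 fy0.
rewrite cabsM cabsV cabsM cabsC ltr_pdivrMr ?mulr_gt0 //.
apply: (lt_trans h2); rewrite -mulrA ltr_pM2l // -mulrA ltr_pM2l //.
Qed.
Lemma gcont_ext f g x (r : R) : 0 < r ->
  (forall y, cabs (j y - j x) < r -> f y = g y) -> gcont f x -> gcont g x.
Proof.
move=> r0 fg cf e e0; have [s s0 hs] := cf _ e0.
exists (Num.min r s); first by rewrite lt_min r0.
move=> y; rewrite lt_min => /andP[h1 /hs]; rewrite !fg // subrr cabs0 //.
Qed.

(** Caratheodory's form of differentiability: a slope continuous at [x] and an exact identity
    instead of an error estimate. Product, chain and inverse rules become algebra of continuous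
    functions. *)
Lemma gderP f x d : gder f x d <->
  exists s, [/\ gcont s x, s x = d & forall y, f y - f x = s y * (j y - j x)].
Proof.
split=> [df|[s [cs sx hs]] e e0]; last first.
  have [r r0 hr] := cs _ e0; exists r => // y /hr h.
  by rewrite hs -sx -mulrBl cabsM ler_wpM2r ?cabs_ge0 // ltW.
exists (fun y => if (j y - j x == 0) then d else (f y - f x) / (j y - j x)); split.
- move=> e e0; have [r r0 hr] := df (e / 2) ltac:(lra); exists r => // y yr.
  rewrite subrr eqxx; case: ifPn => [_|n0]; first by rewrite subrr cabs0.
  have -> : (f y - f x) / (j y - j x) - d =
     (f y - f x - d * (j y - j x)) / (j y - j x) by field.
  rewrite cabsM cabsV ltr_pdivrMr ?cabs_gt0 //.
  by apply: (le_lt_trans (hr _ yr)); rewrite ltr_pM2r ?cabs_gt0 //; lra.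
- by rewrite subrr eqxx.
- move=> y; case: ifPn => [/eqP yx|n0]; last by rewrite divfK.
  rewrite yx mulr0; have [//|h] := eqVneq (f y - f x) 0.
  have [r r0 hr] := df 1 ltr01.
  have := hr y; rewrite yx cabs0 mulr0 subr0 => /(_ r0).
  by rewrite mulr0 le_eqVlt ltNge cabs_ge0 orbF cabs_eq0 => /eqP.
Qed.

Lemma gder_cont f x d : gder f x d -> gcont f x.
Proof.
move=> /gderP[s [cs sx hs]].
have h : gcont (fun y => f x + s y * (j y - j x)) x.
  apply: gcontD; first exact: gcont_cst.
  by apply: gcontM => //; apply: gcontB; [exact: gcont_id|exact: gcont_cst].
by apply: (gcont_ext ltr01 _ h) => y _; rewrite -hs addrC subrK.
Qed.
Lemma gder_cst (c : C) x : gder (fun=> c) x 0.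
Proof. by apply/gderP; exists (fun=> 0); split => //; [exact: gcont_cst|move=> y; rewrite subrr mul0r]. Qed.
Lemma gder_id x : gder j x 1.
Proof. by apply/gderP; exists (fun=> 1); split => //; [exact: gcont_cst|move=> y; rewrite mul1r]. Qed.
Lemma gderD f g x df dg : gder f x df -> gder g x dg ->
  gder (fun y => f y + g y) x (df + dg).
Proof.
move=> /gderP[s [cs sx hs]] /gderP[t [ct tx ht]]; apply/gderP.
exists (fun y => s y + t y); split; [exact: gcontD|by rewrite sx tx|].
by move=> y; rewrite mulrDl -hs -ht; ring.
Qed.
Lemma gderN f x d : gder f x d -> gder (fun y => - f y) x (- d).
Proof.
move=> /gderP[s [cs sx hs]]; apply/gderP.
exists (fun y => - s y); split; [exact: gcontN|by rewrite sx|].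
by move=> y; rewrite mulNr -hs; ring.
Qed.
Lemma gderB f g x df dg : gder f x df -> gder g x dg ->
  gder (fun y => f y - g y) x (df - dg).
Proof. by move=> hf hg; apply: gderD => //; exact: gderN. Qed.
Lemma gderM f g x df dg : gder f x df -> gder g x dg ->
  gder (fun y => f y * g y) x (df * g x + f x * dg).
Proof.
move=> hf hg; have cf := gder_cont hf; move: hf hg.
move=> /gderP[s [cs sx hs]] /gderP[t [ct tx ht]]; apply/gderP.
exists (fun y => s y * g x + f y * t y); split; last 1 first.
- by move=> y; rewrite mulrDl mulrAC -hs -mulrA -ht; ring.
- by apply: gcontD; apply: gcontM => //; exact: gcont_cst.
- by rewrite sx tx.
Qed.
Lemma gderZ (c : C) f x d : gder f x d -> gder (fun y => c * f y) x (c * d).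
Proof. by move=> h; have := gderM (gder_cst c x) h; rewrite mul0r add0r. Qed.
Lemma gderV f x d : f x != 0 -> gder f x d ->
  gder (fun y => (f y)^-1) x (- d / (f x) ^+ 2).
Proof.
move=> f0 hf; have cf := gder_cont hf; have [r r0 hr] := cf (cabs (f x)) ltac:(by rewrite cabs_gt0).
have nz y : cabs (j y - j x) < r -> f y != 0.
  by move=> /hr h; apply: contraTneq h => ->; rewrite sub0r cabsN ltxx.
move: hf => /gderP[s [cs sx hs]].
(* [gderP] wants an identity at every [y], also where [f] vanishes. There the value is replaced by
   one that makes the identity hold; near [x] the replacement does not occur. *)
have h : gder (fun y => if f y == 0 then (f x)^-1 + - s y / (f x * f x) * (j y - j x) else (f y)^-1) x (- d / f x ^+ 2).
  apply/gderP; exists (fun y => if f y == 0 then - s y / (f x * f x) else - s y / (f x * f y)); split.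
  - apply: (@gcont_ext (fun y => - s y / (f x * f y)) _ x r r0).
      by move=> y /nz /negbTE ->.
    apply: gcontM; first exact: gcontN.
    by apply: gcontV; [rewrite mulf_neq0|apply: gcontM => //; exact: gcont_cst].
  - by rewrite (negbTE f0) sx expr2.
  - move=> y; rewrite (negbTE f0); case: ifPn => [_|n0]; first by ring.
    have -> : - s y / (f x * f y) * (j y - j x) = - (s y * (j y - j x)) / (f x * f y) by ring.
    by rewrite -hs; field; rewrite n0 f0.
move=> e e0; have [r' r'0 h'] := h e e0.
exists (Num.min r r'); first by rewrite lt_min r0.
move=> y; rewrite lt_min => /andP[/nz n /h'].
by rewrite (negbTE f0) (negbTE n).
Qed.
Lemma gder_ext f g x d (r : R) : 0 < r ->
  (forall y, cabs (j y - j x) < r -> f y = g y) -> gder f x d -> gder g x d.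
Proof.
move=> r0 fg df e e0; have [s s0 hs] := df _ e0.
exists (Num.min r s); first by rewrite lt_min r0.
move=> y; rewrite lt_min => /andP[h1 /hs]; rewrite !fg // subrr cabs0 //.
Qed.
Lemma gder_uniq f x d d' :
  (forall r : R, 0 < r -> exists2 y, cabs (j y - j x) < r & j y != j x) ->
  gder f x d -> gder f x d' -> d = d'.
Proof.
move=> acc h h'; apply: cabs_eq_limit => e e0.
have [r r0 hr] := h (e / 2) ltac:(lra); have [r' r'0 hr'] := h' (e / 2) ltac:(lra).
have [y] := acc (Num.min r r') ltac:(by rewrite lt_min r0).
rewrite lt_min => /andP[/hr h1 /hr' h2]; rewrite -subr_eq0 -cabs_gt0 => y0.
rewrite -(ler_pM2r y0) -cabsM.
have -> : (d - d') * (j y - j x) = (f y - f x - d' * (j y - j x)) - (f y - f x - d * (j y - j x)) by ring.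
by apply: le_trans (cabsD _ _) _; rewrite cabsN; lra.
Qed.
End Derivative.

Notation ccont := (gcont id).
Notation cder := (gder id).
Notation pcont := (gcont (real_complex _)).
Notation pder := (gder (real_complex _)).

Section Composition.
Variables (R : realType) (X : Type) (j : X -> R[i]).
Local Notation C := R[i].
Lemma gcont_comp (f : C -> C) (g : X -> C) x :
  ccont f (g x) -> gcont j g x -> gcont j (fun y => f (g y)) x.
Proof.
move=> cf cg e e0; have [r r0 hr] := cf _ e0; have [s s0 hs] := cg _ r0.
by exists s => // y /hs /hr.
Qed.
Lemma gder_comp (f : C -> C) (g : X -> C) x d d' :
  cder f (g x) d' -> gder j g x d -> gder j (fun y => f (g y)) x (d' * d).
Proof.
move=> /gderP[s [cs sx hs]] hg; have cg := gder_cont hg; move: hg.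
move=> /gderP[t [ct tx ht]]; apply/gderP.
exists (fun y => s (g y) * t y); split.
- by apply: gcontM => //; exact: gcont_comp.
- by rewrite sx tx.
- by move=> y; rewrite hs ht mulrA.
Qed.
Lemma cder_uniq (f : C -> C) x d d' : cder f x d -> cder f x d' -> d = d'.
Proof.
apply: gder_uniq => r r0; set t : R := r / 2.
have E : x + t%:C - x = t%:C by ring.
have t0 : 0 < t by rewrite /t; lra.
exists (x + t%:C) => /=; first by rewrite E cabs_real ger0_norm /t; lra.
by rewrite -subr_eq0 E -cabs_gt0 cabs_real normr_gt0; lra.
Qed.
End Composition.

(** Generic in the field, so that it serves the real and the complex derivative alike. *)
Lemma is_derive_eps (K : numFieldType) (f : K -> K) (x d : K) :
  is_derive x 1 f d <-> forall e : K, 0 < e -> exists2 r : K, 0 < r &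
    forall y, `|y - x| < r -> `|f y - f x - d * (y - x)| <= e * `|y - x|.
Proof.
have E (h : K) : h != 0 -> forall y, y = h + x ->
  `|f y - f x - d * (y - x)| = `|d - h^-1 *: (f (h *: 1 + x) - f x)| * `|h|.
  move=> h0 y ->; rewrite -normrM addrK.
  have -> : h *: (1 : K) = h by rewrite /GRing.scale /= mulr1.
  rewrite -normrN; congr `|_|; rewrite /GRing.scale /=.
  by field.
split=> [[dF Fd] e e0|H].
- have H : (fun h => h^-1 *: (f (h *: 1 + x) - f x)) @ 0^' --> d by rewrite -Fd; exact: dF.
  move/cvgrPdist_le: H => /(_ e e0).
  rewrite /dnbhs near_withinE => /nbhs_normP [r /= r0 hr]; exists r => // y yr.
  have [->|yx] := eqVneq y x; first by rewrite !subrr mulr0 subrr normr0 mulr0.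
  have h0 : y - x != 0 by rewrite subr_eq0.
  rewrite (E (y - x) h0) ?subrK //; apply: ler_wpM2r => //.
  by apply: hr => //=; rewrite sub0r normrN.
- have C : (fun h => h^-1 *: (f (h *: 1 + x) - f x)) @ 0^' --> d.
    apply/cvgrPdist_le => e e0; have [r r0 hr] := H e e0.
    rewrite /dnbhs near_withinE; apply/nbhs_normP; exists r => //= h /=.
    rewrite ?sub0r normrN => hr1 h0.
    have := hr (h + x); rewrite (E h h0 (h + x) erefl) addrK => /(_ hr1).
    by rewrite ler_pM2r // normr_gt0.
  by split; [apply/cvg_ex; exists d|exact: cvg_lim C].
Qed.

Lemma nbhs_eps (K : numFieldType) (x : K) (P : set K) :
  nbhs x P <-> exists2 r : K, 0 < r & forall y, `|y - x| < r -> P y.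
Proof.
split=> [/nbhs_normP[r /= r0 hr]|[r r0 hr]].
  by exists r => // y h; apply: hr => /=; rewrite distrC.
by apply/nbhs_normP; exists r => //= y /=; rewrite distrC => /hr.
Qed.
Lemma continuous_eps (K : numFieldType) (f : K -> K) (x : K) :
  {for x, continuous f} <-> forall e : K, 0 < e -> exists2 r : K, 0 < r &
    forall y, `|y - x| < r -> `|f y - f x| < e.
Proof.
rewrite -/(continuous_at x f) /continuous_at.
split=> [H e e0|H].
  have /cvgrPdist_lt : f @ x --> f x := H.
  move=> /(_ e e0) /nbhs_eps[r r0 hr].
  by exists r => // y /hr; rewrite distrC.
suff : f @ x --> f x by [].
apply/(@cvgrPdist_lt _ _ _ (nbhs x)) => e e0; have [r r0 hr] := H e e0; apply/nbhs_eps; exists r => // y /hr.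
by rewrite distrC.
Qed.

Section Bridge.
Variable R : realType.
Local Notation C := R[i].

Lemma posC (e : C) : 0 < e -> e = (complex.Re e)%:C /\ 0 < complex.Re e.
Proof. by case: e => a b; rewrite ltcE /= => /andP[/eqP -> ->]. Qed.

Lemma cderP (g : C -> C) z d : cder g z d <-> is_derive z 1 g d.
Proof.
split=> [H|/is_derive_eps H e e0].
- apply/is_derive_eps => e /posC[-> e0]; have [r r0 hr] := H _ e0.
  exists r%:C; first by rewrite ltcR.
  by move=> y; rewrite -!cabsE -rmorphM /= ltcR lecR; exact: hr.
- have [r /posC[-> r0] hr] := H e%:C ltac:(by rewrite ltcR).
  exists (complex.Re r) => // y h; have := hr y.
  by rewrite -!cabsE -rmorphM /= ltcR lecR; apply.
Qed.
Lemma cder_derivable (g : C -> C) z : derivable g z 1 -> cder g z ('D_1 g z).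
Proof. by move=> h; apply/cderP; exact: DeriveDef. Qed.
Lemma cder_val (g : C -> C) z d : cder g z d -> 'D_1 g z = d.
Proof. by move=> /cderP[]. Qed.

Lemma rder_eps (F : R -> R) (t d : R) : is_derive t (1 : R) F d <->
  forall e, 0 < e -> exists2 r, 0 < r &
  forall s, `|s - t| < r -> `|F s - F t - d * (s - t)| <= e * `|s - t|.
Proof. exact: is_derive_eps. Qed.

Lemma cabs_rB (s t : R) : cabs (s%:C - t%:C) = `|s - t|.
Proof. by rewrite -rmorphB /= cabs_real. Qed.

Lemma pder_Re (P : R -> C) t d : pder P t d ->
  is_derive t (1 : R) (fun s => complex.Re (P s)) (complex.Re d).
Proof.
move=> H; apply/rder_eps => e e0; have [r r0 hr] := H _ e0; exists r => // s.
rewrite -(cabs_rB s t) => /hr h; apply: le_trans h; apply: le_trans (Re_le_cabs _).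
rewrite !(ReD, ReN) -rmorphB /= ReM /= mulr0 subr0 //.
Qed.
Lemma pder_Complex (F G : R -> R) t a b :
  is_derive t (1 : R) F a -> is_derive t (1 : R) G b ->
  pder (fun s => Complex (F s) (G s)) t (Complex a b).
Proof.
move=> /rder_eps hF /rder_eps hG e e0.
have [r r0 hr] := hF (e / 2) ltac:(lra); have [s s0 hs] := hG (e / 2) ltac:(lra).
exists (Num.min r s); first by rewrite lt_min r0.
move=> y; rewrite cabs_rB lt_min => /andP[/hr h1 /hs h2].
apply: le_trans (cabs_le_ReIm _) _.
by rewrite -rmorphB !(ReD, ReN, ImD, ImN, ReM, ImM) /= !mulr0 subr0 add0r; lra.
Qed.

Lemma nbhsP z (P : set C) : nbhs z P <->
  exists2 r : R, 0 < r & forall w, cabs (w - z) < r -> P w.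
Proof.
split=> [/nbhs_eps[r /posC[-> r0] hr]|[r r0 hr]].
  by exists (complex.Re r) => // y h; apply: hr; rewrite -cabsE ltcR.
by apply/nbhs_eps; exists r%:C; [rewrite ltcR|move=> y; rewrite -cabsE ltcR; exact: hr].
Qed.
Lemma openP (U : set C) : open U <->
  forall z, U z -> exists2 r : R, 0 < r & forall w, cabs (w - z) < r -> U w.
Proof.
split=> [oU z Uz|H]; first by apply/nbhsP; exact: open_nbhs_nbhs.
by rewrite openE => z /H Hz; apply/nbhsP.
Qed.

(** After rotation of [P 1 - P 0] onto the positive axis its modulus is the increment of a real
    function, to which the real mean value theorem applies. *)
Lemma path_mvt (P D : R -> C) (M : R) :
  (forall t : R, 0 <= t <= 1 -> pder P t (D t)) ->
  (forall t : R, 0 <= t <= 1 -> cabs (D t) <= M) ->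
  cabs (P 1 - P 0) <= M.
Proof.
move=> dP bD; have [c c1 hc] := unimodular_conj (P 1 - P 0).
have dF (x : R) : 0 <= x <= 1 -> is_derive x (1 : R) (fun s => complex.Re (c * P s)) (complex.Re (c * D x)).
  by move=> x01; apply: pder_Re; apply: gderZ; exact: dP.
have [||x] := @MVT R (fun s => complex.Re (c * P s)) (fun s => complex.Re (c * D s)) 0 1 ltr01.
- by move=> x; rewrite in_itv /= => /andP[x0 x1]; apply: dF; rewrite !ltW.
- by apply: derivable_within_continuous => x; rewrite in_itv /= => /dF[].
rewrite in_itv /= => /andP[x0 x1]; rewrite subr0 mulr1 => h.
have -> : cabs (P 1 - P 0) = complex.Re (c * D x).
  by rewrite -h -ReN -ReD -mulrN -mulrDr hc.
apply: le_trans (ler_norm _) _; apply: le_trans (Re_le_cabs _) _.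
by rewrite cabsM c1 mul1r; apply: bD; rewrite !ltW.
Qed.

(** The interval exceeds [0, 1] on both sides so that the derivatives at 0 and 1 are two-sided, as
    [pder] requires. *)
Lemma ftc1 (f : R -> R) : continuous f -> exists F : R -> R,
  forall x : R, -1 < x < 2 -> is_derive x (1 : R) F (f x).
Proof.
move=> cf.
exists (fun x => (\int[lebesgue_measure]_(t in `[(-1 : R), x]) f t)%R).
move=> x /andP[x1 x2].
have [|h1 h2] := @continuous_FTC1_closed R f (-1) x 2 x2 _ x1 (cf x).
  apply: continuous_compact_integrable; first exact: segment_compact.
  by apply: continuous_subspaceT => y; exact: cf.
by apply: DeriveDef; [exact: h1|rewrite -derive1E; exact: h2].
Qed.

Lemma path_primitive (D : R -> C) : (forall t, pcont D t) ->
  exists P : R -> C, forall t, 0 <= t <= 1 -> pder P t (D t).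
Proof.
move=> cD.
have cRe : continuous (fun t => complex.Re (D t)).
  move=> t; apply/continuous_eps => e e0; have [r r0 hr] := cD t _ e0.
  exists r => // s hs.
  rewrite -ReN -ReD; apply: le_lt_trans (Re_le_cabs _) _.
  by apply: hr; rewrite cabs_rB.
have cIm : continuous (fun t => complex.Im (D t)).
  move=> t; apply/continuous_eps => e e0; have [r r0 hr] := cD t _ e0.
  exists r => // s hs.
  rewrite -ImN -ImD; apply: le_lt_trans (Im_le_cabs _) _.
  by apply: hr; rewrite cabs_rB.
have [F hF] := ftc1 cRe; have [G hG] := ftc1 cIm.
exists (fun t => Complex (F t) (G t)) => t t01.
have -> : D t = Complex (complex.Re (D t)) (complex.Im (D t)) by case: (D t).
by apply: pder_Complex; [apply: hF|apply: hG]; lra.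
Qed.
End Bridge.

(** * Integrals along segments and Goursat's lemma *)

Section Segments.
Variable R : realType.
Local Notation C := R[i].
Implicit Types (q : C -> C) (a b c : C).

Definition seg_pt a b (t : R) : C := a + t%:C * (b - a).
(** The integral of [q] along the segment, as the increment of a primitive of the pulled-back
    integrand; reversal, subdivision and linearity are then read off primitives. *)
Definition is_seg q a b (v : C) := exists2 P : R -> C,
  (forall t : R, 0 <= t <= 1 -> pder P t (q (seg_pt a b t))) &
  v = (b - a) * (P 1 - P 0).
Definition seg q a b : C := xget 0 [set v | is_seg q a b v].

Lemma pder_inc_uniq (P Q D : R -> C) :
  (forall t : R, 0 <= t <= 1 -> pder P t (D t)) ->
  (forall t : R, 0 <= t <= 1 -> pder Q t (D t)) -> P 1 - P 0 = Q 1 - Q 0.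
Proof.
move=> hP hQ; apply: cabs_eq_limit => e e0.
have -> : P 1 - P 0 - (Q 1 - Q 0) = (P 1 - Q 1) - (P 0 - Q 0) by ring.
apply: (@path_mvt _ (fun t => P t - Q t) (fun=> 0)) => t ht.
  by have := gderB (hP t ht) (hQ t ht); rewrite subrr.
by rewrite cabs0 ltW.
Qed.
Lemma is_seg_uniq q a b v w : is_seg q a b v -> is_seg q a b w -> v = w.
Proof. by move=> [P hP ->] [Q hQ ->]; rewrite (pder_inc_uniq hP hQ). Qed.
Lemma segE q a b v : is_seg q a b v -> seg q a b = v.
Proof. by move=> h; apply: (@is_seg_uniq q a b) (h); exact: (@xgetPex _ 0 [set v | is_seg q a b v] (ex_intro _ v h)). Qed.

Lemma cabs_seg_pt a b t s :
  cabs (seg_pt a b t - seg_pt a b s) = `|t - s| * cabs (b - a).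
Proof.
rewrite /seg_pt; have -> : a + t%:C * (b - a) - (a + s%:C * (b - a)) = (t%:C - s%:C) * (b - a) by ring.
by rewrite cabsM cabs_rB.
Qed.
Lemma pder_id (t : R) : pder (fun s : R => s%:C) t 1.
Proof. exact: gder_id. Qed.
Lemma pder_seg a b t : pder (seg_pt a b) t (b - a).
Proof.
have := gderD (gder_cst (real_complex R) a t) (gderM (pder_id t) (gder_cst (real_complex R) (b - a) t)).
by rewrite mul1r mulr0 addr0 add0r.
Qed.

(** [path_primitive] asks for continuity on the whole line; this retraction onto [0, 1] supplies
    it. *)
Definition clamp (t : R) : R := if t <= 0 then 0 else if 1 <= t then 1 else t.
Lemma clamp01 t : 0 <= clamp t <= 1.
Proof. by rewrite /clamp; case: (leP t 0) => ?; [|case: (leP 1 t) => ?]; lra. Qed.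
Lemma clamp_id t : 0 <= t <= 1 -> clamp t = t.
Proof. by rewrite /clamp; case: (leP t 0) => ?; [|case: (leP 1 t) => ?] => ?; lra. Qed.
Lemma clamp_lip t s : `|clamp t - clamp s| <= `|t - s|.
Proof.
have H (x y : R) : x <= y -> `|clamp x - clamp y| <= y - x.
  by move=> xy; rewrite distrC ger0_norm /clamp; case: (leP x 0) => ?; case: (leP y 0) => ?; case: (leP 1 x) => ?; case: (leP 1 y) => ?; lra.
have [ts|st] := leP t s; first by rewrite distrC [X in _ <= X]distrC (le_trans _ (ler_norm _)) // distrC H.
by rewrite distrC (le_trans _ (ler_norm _)) // H // ltW.
Qed.

Lemma seg_ex q a b : (forall t : R, 0 <= t <= 1 -> ccont q (seg_pt a b t)) ->
  is_seg q a b (seg q a b).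
Proof.
move=> cq.
have [t|P hP] := @path_primitive R (fun t => q (seg_pt a b (clamp t))).
  move=> e e0; have [r r0 hr] := cq _ (clamp01 t) e e0.
  have B0 : 0 < cabs (b - a) + 1 by have := cabs_ge0 (b - a); lra.
  exists (r / (cabs (b - a) + 1)); first by rewrite divr_gt0.
  move=> s; rewrite cabs_rB ltr_pdivlMr // => hs; apply: hr => /=.
  rewrite cabs_seg_pt; apply: le_lt_trans hs; apply: ler_pM => //.
  - exact: cabs_ge0.
  - exact: clamp_lip.
  - by rewrite lerDl.
suff h : is_seg q a b ((b - a) * (P 1 - P 0)) by rewrite (segE h).
by exists P => // t ht; have := hP t ht; rewrite clamp_id.
Qed.

Lemma seg_bound q a b v M : is_seg q a b v ->
  (forall t : R, 0 <= t <= 1 -> cabs (q (seg_pt a b t)) <= M) ->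
  cabs v <= cabs (b - a) * M.
Proof.
move=> [P hP ->] hM; rewrite cabsM; apply: ler_wpM2l; first exact: cabs_ge0.
exact: (@path_mvt _ P _ M hP).
Qed.

Lemma pder_affine (P : R -> C) (al be t : R) d : pder P (al + be * t) d ->
  pder (fun s => P (al + be * s)) t (d * be%:C).
Proof.
move=> /gderP[s [cs sx hs]]; apply/gderP.
exists (fun y => s (al + be * y) * be%:C); split.
- apply: gcontM; last exact: gcont_cst.
  move=> e e0; have [r r0 hr] := cs e e0.
  have B0 : 0 < `|be| + 1 by have := normr_ge0 be; lra.
  exists (r / (`|be| + 1)); first by rewrite divr_gt0.
  move=> y; rewrite cabs_rB ltr_pdivlMr // => hy; apply: hr.
  rewrite cabs_rB.
  have -> : al + be * y - (al + be * t) = (y - t) * be by ring.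
  rewrite normrM; apply: le_lt_trans hy; apply: ler_wpM2l => //; lra.
- by rewrite sx.
- by move=> y; rewrite hs -!rmorphB -mulrA -rmorphM /=; congr (_ * _%:C); ring.
Qed.

Lemma is_seg_rev q a b v : is_seg q a b v -> is_seg q b a (- v).
Proof.
move=> [P hP ->]; exists (fun t => - P (1 + -1 * t)); last first.
  by rewrite mulr0 mulr1 addr0 subrr; ring.
move=> t ht; have := gderN (pder_affine (hP (1 + -1 * t) ltac:(lra))).
have -> : seg_pt a b (1 + -1 * t) = seg_pt b a t.
  by rewrite /seg_pt rmorphD rmorphM rmorphN rmorph1 /=; ring.
by rewrite rmorphN rmorph1 mulrN mulr1 opprK.
Qed.

Definition mid a b : C := (a + b) / 2%:R.

Lemma is_seg_half q a b v : is_seg q a b v -> exists v1 v2,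
  [/\ is_seg q a (mid a b) v1, is_seg q (mid a b) b v2 & v = v1 + v2].
Proof.
move=> [P hP ->].
have E2 : (2^-1 : R)%:C = 2%:R^-1 :> C by rewrite fmorphV rmorph_nat.
have n2 : (2%:R : C) != 0 by rewrite pnatr_eq0.
exists ((b - a) * (P 2^-1 - P 0)), ((b - a) * (P 1 - P 2^-1)); split; last by ring.
- exists (fun t => 2%:R * P (0 + 2^-1 * t)).
    move=> t ht; have := gderZ 2%:R (pder_affine (hP (0 + 2^-1 * t) ltac:(lra))).
    have -> : seg_pt a b (0 + 2^-1 * t) = seg_pt a (mid a b) t.
      by rewrite /seg_pt add0r rmorphM /= E2 /mid; field.
    by rewrite E2; congr pder; field.
  by rewrite mulr0 mulr1 !add0r /mid; field.
- exists (fun t => 2%:R * P (2^-1 + 2^-1 * t)).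
    move=> t ht; have := gderZ 2%:R (pder_affine (hP (2^-1 + 2^-1 * t) ltac:(lra))).
    have -> : seg_pt a b (2^-1 + 2^-1 * t) = seg_pt (mid a b) b t.
      by rewrite /seg_pt rmorphD rmorphM /= E2 /mid; field.
    by rewrite E2; congr pder; field.
  have -> : (2^-1 + 2^-1 * 1 : R) = 1 by field.
  by rewrite mulr0 addr0 /mid; field.
Qed.

(** Removes the exact integral of an affine function. In Goursat's argument these contributions
    cancel around the triangle. *)
Lemma is_seg_affine q a b v (al be : C) : is_seg q a b v ->
  is_seg (fun z => q z - (al + be * z)) a b
    (v - (al * (b - a) + be * (b ^+ 2 - a ^+ 2) / 2%:R)).
Proof.
move=> [P hP ->].
have n2 : (2%:R : C) != 0 by rewrite pnatr_eq0.
exists (fun t => P t - ((al + be * a) * t%:C + be * (b - a) / 2%:R * (t%:C * t%:C))); last first.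
  by rewrite !rmorph0 !rmorph1; field.
move=> t ht; apply: gderB; first exact: hP.
have := gderD (gderZ (al + be * a) (pder_id t)) (gderZ (be * (b - a) / 2%:R) (gderM (pder_id t) (pder_id t))).
by congr pder; rewrite /seg_pt; field.
Qed.
End Segments.

Section GeometricLimits.
Variable R : realType.
Local Notation C := R[i].

Lemma real_geometric_limit (x : nat -> R) (L k : R) : 0 <= k < 1 ->
  (forall n, `|x n.+1 - x n| <= L * k ^+ n) ->
  exists s, forall n, `|x n - s| <= L * k ^+ n / (1 - k).
Proof.
move=> /andP[k0 k1] H.
have L0 : 0 <= L by have := H 0%N; rewrite expr0 mulr1; apply: le_trans.
set b := fun n => L * k ^+ n / (1 - k).
have b0 n : 0 <= b n.
  by rewrite /b divr_ge0 ?mulr_ge0 ?exprn_ge0 //; lra.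
have bS n : b n - b n.+1 = L * k ^+ n.
  by rewrite /b exprS; field; lra.
have yS n : x n - b n <= x n.+1 - b n.+1.
  have := H n; rewrite -bS ler_norml => /andP[]; lra.
have zS n : x n.+1 + b n.+1 <= x n + b n.
  have := H n; rewrite -bS ler_norml => /andP[]; lra.
have yM n m : x n - b n <= x (n + m)%N - b (n + m)%N.
  by elim: m => [|m IH]; rewrite ?addn0 // addnS; apply: le_trans (yS _).
have zM n m : x (n + m)%N + b (n + m)%N <= x n + b n.
  by elim: m => [|m IH]; rewrite ?addn0 // addnS; apply: le_trans (zS _) _.
have yz n m : x n - b n <= x m + b m.
  have := yM n m; have := zM m n; rewrite addnC; have := b0 (n + m)%N; lra.
set S := [set x n - b n | n in [set: nat]].
have Sne : S !=set0 by exists (x 0%N - b 0%N); exists 0%N.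
have ub m : ubound S (x m + b m) by move=> _ [n _ <-]; exact: yz.
exists (sup S) => n.
have h1 : x n - b n <= sup S.
  by apply: ub_le_sup; [exists (x 0%N + b 0%N); exact: ub|exists n].
have h2 : sup S <= x n + b n by apply: ge_sup => //; exact: ub.
by rewrite ler_norml -/(b n); lra.
Qed.

Lemma geometric_limit (x : nat -> C) (L k : R) : 0 <= k < 1 ->
  (forall n, cabs (x n.+1 - x n) <= L * k ^+ n) ->
  exists s, forall n, cabs (x n - s) <= 2 * (L * k ^+ n / (1 - k)).
Proof.
move=> k01 H.
have [n|a ha] := @real_geometric_limit (fun n => complex.Re (x n)) L k k01.
  by apply: le_trans (H n); rewrite -ReN -ReD; exact: Re_le_cabs.
have [n|b hb] := @real_geometric_limit (fun n => complex.Im (x n)) L k k01.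
  by apply: le_trans (H n); rewrite -ImN -ImD; exact: Im_le_cabs.
exists (Complex a b) => n; apply: le_trans (cabs_le_ReIm _) _.
rewrite !(ReD, ImD, ReN, ImN) /=; have := ha n; have := hb n; lra.
Qed.

Lemma expr_lt_eps (k e : R) : 0 <= k < 1 -> 0 < e -> exists n, k ^+ n < e.
Proof.
move=> /andP[k0 k1] e0.
have : (GRing.exp k : nat -> R) @ \oo --> (0 : R) by apply: cvg_expr; rewrite ger0_norm.
move/cvgrPdist_lt => /(_ e e0) [N _ /(_ N (leqnn N))].
by rewrite /= sub0r normrN ger0_norm ?exprn_ge0 // => h; exists N.
Qed.
Lemma expr_lt_eps_all (k e : R) : 0 <= k < 1 -> 0 < e ->
  exists N, forall n, (N <= n)%N -> k ^+ n < e.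
Proof.
move=> k01 e0; have [N hN] := expr_lt_eps k01 e0; exists N => n /subnK <-.
have /andP[k0 k1] := k01.
rewrite exprD; apply: le_lt_trans hN; rewrite -[X in _ <= X]mul1r.
by apply: ler_wpM2r; rewrite ?exprn_ge0 // exprn_ile1 // ltW.
Qed.
End GeometricLimits.

Section Goursat.
Variable R : realType.
Local Notation C := R[i].
Implicit Types (q : C -> C) (a b c : C) (K : set C).

(** Convex and closed. Closedness replaces compactness: the nested triangles shrink geometrically,
    so their vertices converge by completeness. *)
Definition kconvex K :=
  (forall a b (t : R), K a -> K b -> 0 <= t <= 1 -> K (seg_pt a b t)) /\
  (forall p, (forall e : R, 0 < e -> exists2 x, K x & cabs (p - x) < e) -> K p).
Definition tri q a b c : C := seg q a b + seg q b c + seg q c a.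
Definition perim a b c : R := cabs (b - a) + cabs (c - b) + cabs (a - c).

Lemma seg_pt_mid a b : seg_pt a b 2^-1 = mid a b.
Proof.
rewrite /seg_pt /mid fmorphV rmorph_nat.
by field.
Qed.
Lemma kconvex_mid K a b : kconvex K -> K a -> K b -> K (mid a b).
Proof. by move=> [cK _] Ka Kb; rewrite -seg_pt_mid; apply: cK => //; lra. Qed.
Lemma kconvexI K K' : kconvex K -> kconvex K' -> kconvex (K `&` K').
Proof.
move=> [c1 l1] [c2 l2]; split=> [a b t [? ?] [? ?] ?|p hp].
  by split; [apply: c1|apply: c2].
by split; [apply: l1|apply: l2] => e /hp[x [? ?] ?]; exists x.
Qed.
Lemma kconvex_disc c (r : R) : kconvex [set z | cabs (z - c) <= r].
Proof.
split=> [a b t /= ha hb /andP[t0 t1]|p hp /=].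
  have -> : seg_pt a b t - c = (1 - t)%:C * (a - c) + t%:C * (b - c).
    by rewrite /seg_pt rmorphB rmorph1 /=; ring.
  apply: le_trans (cabsD _ _) _; rewrite !cabsM !cabs_real !ger0_norm ?subr_ge0 //.
  have h1 : (1 - t) * cabs (a - c) <= (1 - t) * r by apply: ler_wpM2l => //; lra.
  have h2 : t * cabs (b - c) <= t * r by apply: ler_wpM2l.
  lra.
apply/ler_addgt0Pr => e /hp[x /= xr px].
by have := cabsB_tri p x c; lra.
Qed.
Lemma kconvex_ge (x0 : R) : kconvex [set z : C | x0 <= complex.Re z].
Proof.
split=> [a b t /= ha hb /andP[t0 t1]|p hp /=].
  rewrite /seg_pt ReD ReM /= mul0r subr0 ReD ReN.
  have h1 : (1 - t) * x0 <= (1 - t) * complex.Re a by apply: ler_wpM2l => //; lra.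
  have h2 : t * x0 <= t * complex.Re b by apply: ler_wpM2l.
  lra.
apply/ler_addgt0Pr => e /hp[x /= xr px].
have := Re_le_cabs (x - p); rewrite cabsC ReD ReN => h.
have := ler_norm (complex.Re x - complex.Re p); lra.
Qed.

Lemma seg_half q a b : is_seg q a b (seg q a b) ->
  seg q a b = seg q a (mid a b) + seg q (mid a b) b.
Proof. by move=> /is_seg_half[v1 [v2 [/segE h1 /segE h2 h]]]; rewrite h h1 h2. Qed.
Lemma seg_rev q a b : is_seg q a b (seg q a b) -> seg q b a = - seg q a b.
Proof. by move=> /is_seg_rev /segE. Qed.

Lemma half2 (z : C) : cabs (z / 2%:R) = cabs z / 2.
Proof. by rewrite cabsM cabsV cabs_natr. Qed.

Lemma midC a b : mid a b = mid b a.
Proof. by rewrite /mid addrC. Qed.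
Lemma cabs_mid_l a b : cabs (mid a b - a) = cabs (b - a) / 2.
Proof. by rewrite -half2 /mid; congr cabs; field. Qed.
Lemma cabs_mid_mid a b c : cabs (mid a c - mid a b) = cabs (c - b) / 2.
Proof. by rewrite -half2 /mid; congr cabs; field. Qed.

Lemma tri_split q K a b c : kconvex K ->
  (forall x y, K x -> K y -> is_seg q x y (seg q x y)) -> K a -> K b -> K c ->
  tri q a b c = tri q a (mid a b) (mid c a) + tri q (mid a b) b (mid b c) +
    tri q (mid c a) (mid b c) c + tri q (mid a b) (mid b c) (mid c a).
Proof.
move=> cK S Ka Kb Kc; rewrite /tri.
have Kab := kconvex_mid cK Ka Kb; have Kbc := kconvex_mid cK Kb Kc.
have Kca := kconvex_mid cK Kc Ka.
rewrite (seg_half (S _ _ Ka Kb)) (seg_half (S _ _ Kb Kc)) (seg_half (S _ _ Kc Ka)).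
rewrite (seg_rev (S _ _ Kca Kab)) (seg_rev (S _ _ Kab Kbc)) (seg_rev (S _ _ Kbc Kca)).
by ring.
Qed.

Lemma tri_goursat q K a b c : kconvex K ->
  (forall z, K z -> exists d, cder q z d) -> K a -> K b -> K c -> tri q a b c = 0.
Proof.
move=> cK dq Ka Kb Kc.
have sK x y : K x -> K y -> is_seg q x y (seg q x y).
  move=> Kx Ky; apply: seg_ex => t t01.
  by have [d hd] := dq _ (cK.1 _ _ _ Kx Ky t01); exact: gder_cont hd.
apply: cabs_eq_limit => e e0; rewrite subr0.
set L := perim a b c.
have L0 : 0 <= L by rewrite /L /perim !addr_ge0 ?cabs_ge0.
suff H : forall e : R, 0 < e -> cabs (tri q a b c) <= e * L ^+ 2.
  have h0 : 0 < e / (L ^+ 2 + 1) by rewrite divr_gt0 // ltr_wpDl // sqr_ge0.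
  apply: le_trans (H _ h0) _; rewrite mulrAC -mulrA ler_piMr ?(ltW e0) //.
  by rewrite ler_pdivrMr ?mul1r ?lerDl // ltr_wpDl // sqr_ge0.
move=> {e0}e e0; rewrite leNgt; apply/negP => bad0.
pose T := (C * C * C)%type.
pose per (t : T) := perim t.1.1 t.1.2 t.2.
(* Under subdivision the threshold [e * per t ^+ 2] is divided by four while the integral is shared
   among four triangles, so one of them is bad again. *)
pose bad (t : T) := [/\ K t.1.1, K t.1.2, K t.2 & e * per t ^+ 2 < cabs (tri q t.1.1 t.1.2 t.2)].
have step (t : T) : exists t' : T, bad t ->
    [/\ bad t', per t' = per t / 2 & cabs (t'.1.1 - t.1.1) <= per t].
  have [[]|nb] := pselect (bad t); last by exists t.
  case: t => [[x y] z] /= Kx Ky Kz; rewrite /per /=; set l := perim x y z => hb.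
  have Kxy := kconvex_mid cK Kx Ky; have Kyz := kconvex_mid cK Ky Kz.
  have Kzx := kconvex_mid cK Kz Kx.
  have [p1 p2 p3] : [/\ 0 <= cabs (y - x), 0 <= cabs (z - y) & 0 <= cabs (x - z)].
    by split; exact: cabs_ge0.
  pose P (t' : T) := [/\ K t'.1.1, K t'.1.2, K t'.2, per t' = l / 2 & cabs (t'.1.1 - x) <= l].
  have [P1 P2 P3 P4] : [/\ P (x, mid x y, mid z x), P (mid x y, y, mid y z),
      P (mid z x, mid y z, z) & P (mid x y, mid y z, mid z x)].
    have e1 := cabs_mid_l x y; have e2 := cabs_mid_l y z; have e3 := cabs_mid_l z x.
    have e4 := cabs_mid_l y x; have e5 := cabs_mid_l z y; have e6 := cabs_mid_l x z.
    have e7 := cabs_mid_mid x y z; have e8 := cabs_mid_mid y z x; have e9 := cabs_mid_mid z x y.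
    rewrite [mid y x]midC in e4; rewrite [mid z y]midC in e5; rewrite [mid x z]midC in e6.
    rewrite [mid x z]midC in e7; rewrite [mid y x]midC in e8; rewrite [mid z y]midC in e9.
    split; rewrite /P /per /l /perim /=; split=> //; rewrite ?subrr ?cabs0 ?addr_ge0 //.
    - by rewrite e1 e7 [cabs (x - mid z x)]cabsC e6 [cabs (z - x)]cabsC; lra.
    - by rewrite [cabs (y - mid x y)]cabsC e4 e2 e8 [cabs (x - y)]cabsC; lra.
    - by rewrite e1; lra.
    - by rewrite e9 [cabs (z - mid y z)]cabsC e5 e3 [cabs (y - z)]cabsC; lra.
    - by rewrite e6 [cabs (z - x)]cabsC; lra.
    - rewrite [cabs (mid y z - mid x y)]cabsC e8 [cabs (mid z x - mid y z)]cabsC e9.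
      by rewrite [cabs (mid x y - mid z x)]cabsC e7; lra.
    - by rewrite e1; lra.
  apply: contrapT => /forallNP nb.
  have Q t' : P t' -> cabs (tri q t'.1.1 t'.1.2 t'.2) <= e * (l / 2) ^+ 2.
    move=> [k1 k2 k3 k4 k5]; rewrite leNgt; apply/negP => h; apply: (nb t') => _.
    by rewrite /bad; split=> //; split => //; rewrite k4.
  move: hb; rewrite (tri_split cK sK Kx Ky Kz).
  apply/negP; rewrite -leNgt.
  have := Q _ P1; have := Q _ P2; have := Q _ P3; have := Q _ P4 => /=.
  set t1 := tri _ _ _ _; set t2 := tri _ _ _ _; set t3 := tri _ _ _ _; set t4 := tri _ _ _ _.
  have := cabsD (t4 + t3 + t2) t1; have := cabsD (t4 + t3) t2; have := cabsD t4 t3.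
  have -> : (l / 2) ^+ 2 = l ^+ 2 / 4 by field.
  lra.
have [nx hnx] := choice step.
pose ts n := iter n nx (a, b, c).
have tb n : bad (ts n).
  by elim: n => [|n IH]; [split|rewrite /ts iterS; have [] := hnx _ IH].
have tp n : per (ts n) = L * 2^-1 ^+ n.
  elim: n => [|n IH]; first by rewrite expr0 mulr1.
  by rewrite /ts iterS; have [_ -> _] := hnx _ (tb n); rewrite -/(ts n) IH exprS; ring.
have k01 : (0 : R) <= (2^-1 : R) < 1 by apply/andP; split; lra.
have [n|p hp] := @geometric_limit R (fun n => (ts n).1.1) L 2^-1 k01.
  by rewrite /ts iterS; have [_ _ h] := hnx _ (tb n); rewrite -tp.
have hp' n : cabs ((ts n).1.1 - p) <= 4 * per (ts n).
  apply: le_trans (hp n) _; rewrite tp.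
  have -> : (1 - 2^-1 : R) = 2^-1 by lra.
  rewrite invrK; set u := L * _; have : u * 2 = 2 * u by ring.
  lra.
have small r : 0 < r -> exists n, per (ts n) < r.
  move=> r0; have [n hn] := expr_lt_eps k01 (divr_gt0 r0 (ltr_wpDl L0 ltr01)).
  exists n; rewrite tp; move: hn; rewrite ltr_pdivlMr; last by lra.
  have : 0 <= (2^-1 : R) ^+ n by rewrite exprn_ge0.
  by rewrite mulrDr mulr1 mulrC; lra.
have Kp : K p.
  apply: cK.2 => r r0; have [n hn] := small (r / 4) ltac:(lra).
  exists (ts n).1.1; first by have [] := tb n.
  by rewrite cabsC; have := hp' n; lra.
(* Points of the sides are within 6 * l of [p]: 4 * l to the vertex [x], l to the start of the side,
   l along it. *)
have [d hd] := dq _ Kp; have [r r0 hr] := hd (e / 6) ltac:(lra).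
have [n hn] := small (r / 6) ltac:(lra).
have [] := tb n; move: (hp' n) hn; rewrite /per.
case: (ts n) => [[x y] z] /=; set l := perim x y z => hxp hl Kx Ky Kz.
rewrite ltNge => /negP; apply.
have [p1 p2 p3] : [/\ 0 <= cabs (y - x), 0 <= cabs (z - y) & 0 <= cabs (x - z)].
  by split; exact: cabs_ge0.
have sb u v : K u -> K v -> cabs (u - x) <= l -> cabs (v - u) <= l ->
    cabs (seg q u v - (q p - d * p) * (v - u) - d * (v ^+ 2 - u ^+ 2) / 2%:R) <= cabs (v - u) * (e * l).
  move=> Ku Kv ux vu.
  have h := is_seg_affine (q p - d * p) d (sK _ _ Ku Kv).
  rewrite -addrA -opprD; apply: (seg_bound h) => t t01 /=.
  have hw : cabs (seg_pt u v t - p) <= 6 * l.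
    have := cabsB_tri (seg_pt u v t) u p; have := cabsB_tri u x p.
    have : cabs (seg_pt u v t - u) <= cabs (v - u).
      have -> : seg_pt u v t - u = t%:C * (v - u) by rewrite /seg_pt; ring.
      by rewrite cabsM cabs_real ger0_norm; [apply: ler_piMl; [exact: cabs_ge0|lra]|lra].
    lra.
  have := hr (seg_pt u v t) ltac:(rewrite /=; lra).
  have -> : q (seg_pt u v t) - q p - d * (seg_pt u v t - p) =
    q (seg_pt u v t) - (q p - d * p + d * seg_pt u v t) by ring.
  move=> h1; apply: le_trans h1 _.
  have -> : e * l = e / 6 * (6 * l) by field.
  by apply: ler_wpM2l => //; lra.
have -> : tri q x y z = (seg q x y - (q p - d * p) * (y - x) - d * (y ^+ 2 - x ^+ 2) / 2%:R)
  + (seg q y z - (q p - d * p) * (z - y) - d * (z ^+ 2 - y ^+ 2) / 2%:R)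
  + (seg q z x - (q p - d * p) * (x - z) - d * (x ^+ 2 - z ^+ 2) / 2%:R).
  by rewrite /tri; field.
apply: le_trans (cabsD _ _) _; rewrite /l /perim in sb *.
have := cabsD (seg q x y - (q p - d * p) * (y - x) - d * (y ^+ 2 - x ^+ 2) / 2%:R)
  (seg q y z - (q p - d * p) * (z - y) - d * (z ^+ 2 - y ^+ 2) / 2%:R).
have := sb _ _ Kx Ky ltac:(rewrite subrr cabs0; lra) ltac:(lra).
have := sb _ _ Ky Kz ltac:(lra) ltac:(lra).
have := sb _ _ Kz Kx ltac:(rewrite cabsC; lra) ltac:(lra).
nra.
Qed.
End Goursat.

(** * Holomorphic functions *)

Section Primitives.
Variable R : realType.
Local Notation C := R[i].
Implicit Types (q : C -> C) (a b c z w p : C) (U K : set C).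

Definition eopen U := forall z, U z ->
  exists2 r : R, 0 < r & forall w, cabs (w - z) < r -> U w.
(** Triangles with vertices in [U] lie in a closed convex part of [U], the setting of [tri_goursat].
    Discs, half-planes and their intersections qualify. *)
Definition hull_dom U := eopen U /\ forall x y z, U x -> U y -> U z ->
  exists K, [/\ kconvex K, K `<=` U & [/\ K x, K y & K z]].
Definition disc c (r : R) : set C := [set z | cabs (z - c) < r].
Definition hol U (f : C -> C) := forall z, U z -> exists d, cder f z d.

Lemma eopen_disc c r : eopen (disc c r).
Proof.
move=> z; rewrite /disc /= => hz; exists (r - cabs (z - c)); first by rewrite subr_gt0.
by move=> w hw; have := cabsB_tri w z c; lra.
Qed.
Lemma hull_disc c r : hull_dom (disc c r).
Proof.
split; first exact: eopen_disc.
move=> x y z; rewrite /disc /= => hx hy hz.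
set m := Num.max (Num.max (cabs (x - c)) (cabs (y - c))) (cabs (z - c)).
exists [set w | cabs (w - c) <= m]; split.
- exact: kconvex_disc.
- by move=> w /= h; apply: le_lt_trans h _; rewrite !gt_max hx hy hz.
- by split=> /=; rewrite !le_max lexx ?orbT.
Qed.
Lemma eopen_Hright : eopen (@Hright R).
Proof.
move=> z hz; exists (complex.Re z) => // w hw.
have := le_lt_trans (Re_le_cabs _) hw; rewrite ReD ReN ltr_norml /Hright /=; lra.
Qed.
Lemma hull_Hright : hull_dom (@Hright R).
Proof.
split; first exact: eopen_Hright.
move=> x y z; rewrite /Hright /= => hx hy hz.
set m := Num.min (Num.min (complex.Re x) (complex.Re y)) (complex.Re z).
exists [set w | m <= complex.Re w]; split.
- exact: kconvex_ge.
- by move=> w /= h; apply: lt_le_trans h; rewrite !lt_min hx hy hz.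
- by split=> /=; rewrite !ge_min lexx ?orbT.
Qed.
Lemma hull_seg U a b t : hull_dom U -> U a -> U b -> 0 <= t <= 1 -> U (seg_pt a b t).
Proof.
move=> [_ H] Ua Ub t01; have [K [cK KU [Ka Kb _]]] := H _ _ _ Ua Ub Ub.
by apply: KU; apply: cK.1.
Qed.
Lemma hol_sub U V f : V `<=` U -> hol U f -> hol V f.
Proof. by move=> VU h z /VU /h. Qed.
Lemma hol_cont U f z : hol U f -> U z -> ccont f z.
Proof. by move=> h /h [d hd]; exact: gder_cont hd. Qed.

(* Near a point [z <> p] the triangle [p z w] is exhausted by halving towards
   [p]; the pieces removed stay away from [p], where Goursat applies. *)
Lemma tri_shrink q U p z w : hull_dom U -> (forall z, U z -> ccont q z) ->
  (forall z, U z -> z != p -> exists d, cder q z d) -> U p -> U z -> U w ->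
  z != p -> cabs (w - z) <= cabs (z - p) / 4 ->
  tri q p z w = tri q p (mid p z) (mid p w).
Proof.
move=> hU cq dq Up Uz Uw zp wz.
have [K0 [cK0 KU [Kp Kz Kw]]] := hU.2 _ _ _ Up Uz Uw.
have zp0 : 0 < cabs (z - p) by rewrite cabs_gt0 subr_eq0.
have sK x y : K0 x -> K0 y -> is_seg q x y (seg q x y).
  by move=> Kx Ky; apply: seg_ex => t t01; apply: cq; apply: KU; apply: cK0.1.
have Kmz := kconvex_mid cK0 Kp Kz; have Kmw := kconvex_mid cK0 Kp Kw.
set K1 := K0 `&` [set x | cabs (x - z) <= cabs (z - p) * (3 / 4)].
have cK1 : kconvex K1 by apply: kconvexI => //; exact: kconvex_disc.
have dK1 x : K1 x -> exists d, cder q x d.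
  move=> [/KU Ux /= xz]; apply: dq => //; apply: contraTneq xz => ->.
  by rewrite -ltNge [cabs (p - z)]cabsC; lra.
have e1 : cabs (mid p z - z) = cabs (z - p) / 2 by rewrite midC cabs_mid_l cabsC.
have e2 : cabs (mid p w - mid p z) = cabs (w - z) / 2 by exact: cabs_mid_mid.
have K1z : K1 z by split => //=; rewrite subrr cabs0; lra.
have K1w : K1 w by split => //=; lra.
have K1mz : K1 (mid p z) by split => //=; rewrite e1; lra.
have K1mw : K1 (mid p w).
  by split => //=; have := cabsB_tri (mid p w) (mid p z) z; rewrite e1 e2; lra.
have t1 := tri_goursat cK1 dK1 K1mz K1z K1w.
have t2 := tri_goursat cK1 dK1 K1mz K1w K1mw.
rewrite /tri in t1 t2 *.
rewrite (seg_half (sK _ _ Kp Kz)) (seg_half (sK _ _ Kw Kp)) [mid w p]midC.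
have r1 := seg_rev (sK _ _ Kmz Kw); have r2 := seg_rev (sK _ _ Kmz Kmw).
rewrite r2 in t2; rewrite r1 in t1.
rewrite -[RHS]addr0 -t1 -[RHS]addr0 -t2; ring.
Qed.

(** Halving moves the triangle towards [p] without changing the integral, and near [p] continuity
    bounds the integrand, so the integral is at most a constant times the size. *)
Lemma tri_exceptional q U p z w : hull_dom U -> (forall z, U z -> ccont q z) ->
  (forall z, U z -> z != p -> exists d, cder q z d) -> U p -> U z -> U w ->
  z != p -> cabs (w - z) <= cabs (z - p) / 4 -> tri q p z w = 0.
Proof.
move=> hU cq dq Up Uz Uw zp wz.
have [e e0 he] := cq _ Up 1 ltr01.
set M := cabs (q p) + 1.
have sU x y : U x -> U y -> is_seg q x y (seg q x y).
  by move=> Kx Ky; apply: seg_ex => t t01; apply: cq; exact: hull_seg.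
have M0 : 0 < M by rewrite /M ltr_wpDl ?cabs_ge0.
have sm r x y : r <= e -> U x -> U y -> cabs (x - p) < r -> cabs (y - p) < r ->
    cabs (seg q x y) <= 2 * r * M.
  move=> re Ux Uy xp yp; have h := seg_bound (M := M) (sU _ _ Ux Uy).
  apply: le_trans (h _) _.
    move=> t t01; have : cabs (seg_pt x y t - p) < e.
      apply: lt_le_trans re; exact: (hull_seg (hull_disc p r)).
    by move=> /he; have := cabs_lb (q (seg_pt x y t)) (q p); rewrite /M; lra.
  apply: ler_wpM2r; first exact: ltW.
  by have := cabsB_tri y p x; rewrite [cabs (p - x)]cabsC; lra.
have H n : exists z' w', [/\ U z', U w', z' != p, cabs (w' - z') <= cabs (z' - p) / 4 &
   [/\ cabs (z' - p) = cabs (z - p) / 2 ^+ n, cabs (w' - p) = cabs (w - p) / 2 ^+ n &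
     tri q p z w = tri q p z' w']].
  elim: n => [|n [z' [w' [h1 h2 h3 h4 [h5 h6 h7]]]]].
    by exists z, w; split=> //; rewrite expr0 !divr1.
  have n2 : (2%:R : C) != 0 by rewrite pnatr_eq0.
  have E (x : C) : mid p x - p = (x - p) / 2%:R by rewrite /mid; field.
  have Um x : U x -> U (mid p x).
    by move=> Ux; rewrite -seg_pt_mid; apply: hull_seg => //; apply/andP; split; lra.
  exists (mid p z'), (mid p w'); split.
  - exact: Um.
  - exact: Um.
  - by rewrite -subr_eq0 E mulf_neq0 ?invr_neq0 // subr_eq0.
  - by rewrite cabs_mid_mid cabs_mid_l; lra.
  - rewrite !cabs_mid_l h5 h6 exprS h7; split; try by field; rewrite expf_neq0.
    exact: (tri_shrink hU).
apply: cabs_eq_limit => d d0; rewrite subr0.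
set L := cabs (z - p) + cabs (w - p) + 1.
have L0 : 0 < L by rewrite /L ltr_wpDl // addr_ge0 ?cabs_ge0.
(* Three sides, each contributing at most 2 * r * M. *)
set r := Num.min e (d / (6 * M)).
have r0 : 0 < r by rewrite lt_min e0 divr_gt0 // mulr_gt0.
have k01 : (0 : R) <= (2^-1 : R) < 1 by apply/andP; split; lra.
have [n hn] := expr_lt_eps k01 (divr_gt0 r0 L0).
have [z' [w' [Uz' Uw' _ _ [e1 e2 ->]]]] := H n.
move: hn; rewrite ltr_pdivlMr // exprVn mulrC => hn.
have i0 : 0 < (2 ^+ n : R)^-1 by rewrite invr_gt0 exprn_gt0.
have z'r : cabs (z' - p) < r.
  rewrite e1; apply: le_lt_trans hn; apply: ler_wpM2r; first exact: ltW.
  by rewrite /L; have := cabs_ge0 (w - p); lra.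
have w'r : cabs (w' - p) < r.
  rewrite e2; apply: le_lt_trans hn; apply: ler_wpM2r; first exact: ltW.
  by rewrite /L; have := cabs_ge0 (z - p); lra.
have p'r : cabs (p - p) < r by rewrite subrr cabs0.
have re : r <= e by rewrite ge_min lexx.
have rd : r * (6 * M) <= d.
  by rewrite -ler_pdivlMr ?mulr_gt0 // ge_min lexx orbT.
have := sm r p z' re Up Uz' p'r z'r; have := sm r z' w' re Uz' Uw' z'r w'r.
have := sm r w' p re Uw' Up w'r p'r.
have := cabsD (seg q p z' + seg q z' w') (seg q w' p); have := cabsD (seg q p z') (seg q z' w').
rewrite /tri; lra.
Qed.

(** At [p] only continuity is asked because difference quotients centred at [p] are to be
    integrated. The primitive is based at [p], so that every triangle involved has [p] as a
    vertex. *)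
Lemma primitive_ex q U p : hull_dom U -> (forall z, U z -> ccont q z) ->
  (forall z, U z -> z != p -> exists d, cder q z d) -> U p ->
  exists Q, forall z, U z -> cder Q z (q z).
Proof.
move=> hU cq dq Up; exists (seg q p) => z Uz e e0.
have sU x y : U x -> U y -> is_seg q x y (seg q x y).
  by move=> Kx Ky; apply: seg_ex => t t01; apply: cq; exact: hull_seg.
have [r1 r10 hr1] := hU.1 _ Uz.
have [r2 r20 hr2] := cq _ Uz e e0.
have [r3 r30 hr3] : exists2 r3 : R, 0 < r3 & forall w, cabs (w - z) < r3 -> U w ->
    seg q p w - seg q p z = seg q z w.
  have [->|zp] := eqVneq z p.
    exists 1 => // w _ Uw; have -> : seg q p p = 0; last by rewrite subr0.
    by have := seg_bound (M := cabs (q p)) (sU _ _ Up Up); rewrite subrr cabs0 mul0r => h;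
      apply/eqP; rewrite -cabs_eq0 eq_le cabs_ge0 andbT; apply: h => t _;
      rewrite /seg_pt subrr mulr0 addr0.
  exists (cabs (z - p) / 4); first by rewrite divr_gt0 // cabs_gt0 subr_eq0.
  move=> w wz Uw; have := tri_exceptional hU cq dq Up Uz Uw zp (ltW wz).
  rewrite /tri (seg_rev (sU _ _ Up Uw)) => /eqP; rewrite subr_eq0 => /eqP <-.
  by ring.
exists (Num.min (Num.min r1 r2) r3); first by rewrite !lt_min r10 r20.
move=> w; rewrite !lt_min => /andP[/andP[w1 w2] w3] /=.
have Uw := hr1 _ w1; rewrite hr3 //.
have h := is_seg_affine (q z) 0 (sU _ _ Uz Uw).
have -> : seg q z w - q z * (w - z) = seg q z w - (q z * (w - z) + 0 * (w ^+ 2 - z ^+ 2) / 2%:R).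
  by rewrite mul0r mul0r addr0.
rewrite [e * _]mulrC; apply: (seg_bound h) => t /andP[t0 t1] /=; rewrite mul0r addr0; apply/ltW/hr2.
apply: le_lt_trans w2; rewrite /= /seg_pt addrAC subrr add0r cabsM cabs_real ger0_norm //.
by apply: ler_piMl => //; exact: cabs_ge0.
Qed.

Lemma deriv0_const U f : hull_dom U -> (forall z, U z -> cder f z 0) ->
  forall z w, U z -> U w -> f z = f w.
Proof.
move=> hU df z w Uz Uw; apply: cabs_eq_limit => e e0.
have := @path_mvt R (fun t => f (seg_pt w z t)) (fun=> 0) e.
have -> : seg_pt w z 1 = z by rewrite /seg_pt rmorph1; ring.
have -> : seg_pt w z 0 = w by rewrite /seg_pt rmorph0; ring.
apply=> t t01; last by rewrite cabs0 ltW.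
by have := gder_comp (df _ (hull_seg hU Uw Uz t01)) (pder_seg w z t); rewrite mul0r.
Qed.

Lemma mean_value_ineq U f (M : R) z w : hull_dom U ->
  (forall x, U x -> exists2 d, cder f x d & cabs d <= M) -> U z -> U w ->
  cabs (f z - f w) <= M * cabs (z - w).
Proof.
move=> hU df Uz Uw.
pose D x := 'D_1 f x.
have := @path_mvt R (fun t => f (seg_pt w z t)) (fun t => D (seg_pt w z t) * (z - w)) (M * cabs (z - w)).
have -> : seg_pt w z 1 = z by rewrite /seg_pt rmorph1; ring.
have -> : seg_pt w z 0 = w by rewrite /seg_pt rmorph0; ring.
apply=> t t01; have [d hd dM] := df _ (hull_seg hU Uw Uz t01).
  by rewrite /D (cder_val hd); exact: gder_comp hd (pder_seg w z t).
by rewrite /D (cder_val hd) cabsM ler_wpM2r // cabs_ge0.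
Qed.
End Primitives.

(** * The complex exponential *)

Section Exponential.
Variable R : realType.
Local Notation C := R[i].
Implicit Types (z w : C).

Lemma cexpD z w : cexp (z + w) = cexp z * cexp w.
Proof.
case: z w => a b [c d]; rewrite /cexp /= expRD cosD sinD.
by apply/eqP; rewrite eq_complex /=; apply/andP; split; apply/eqP; ring.
Qed.
Lemma cexp0 : cexp 0 = 1 :> C.
Proof. by rewrite /cexp /= expR0 cos0 sin0 mulr1 mulr0. Qed.
Lemma cabs_cexp z : cabs (cexp z) = expR (complex.Re z).
Proof.
rewrite /cexp /cabs /= !exprMn -mulrDr cos2Dsin2 mulr1 sqrtr_sqr ger0_norm // expR_ge0.
Qed.
Lemma cexp_neq0 z : cexp z != 0.
Proof. by rewrite -cabs_gt0 cabs_cexp expR_gt0. Qed.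
Lemma cexpN z : cexp (- z) = (cexp z)^-1.
Proof.
apply: (mulfI (cexp_neq0 z)); rewrite -cexpD subrr cexp0 mulfV //.
exact: cexp_neq0.
Qed.

Lemma cder_cexp0 : cder (@cexp R) 0 1.
Proof.
move=> e e0; set d := Num.min 1 (e / 8).
have d0 : 0 < d by rewrite lt_min ltr01 divr_gt0.
have [d1 de] : d <= 1 /\ d <= e / 8 by rewrite !ge_min !lexx orbT.
clearbody d.
have [r1 r10 h1] : exists2 r : R, 0 < r & forall s : R, `|s| < r -> `|expR s - 1 - s| <= d * `|s|.
  have /rder_eps/(_ d d0) [r r0 hr] := is_derive_expR (0 : R).
  by exists r => // s; have := hr s; rewrite expR0 !subr0 mul1r.
have [r2 r20 h2] : exists2 r : R, 0 < r & forall s : R, `|s| < r -> `|sin s - s| <= d * `|s|.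
  have /rder_eps/(_ d d0) [r r0 hr] := is_derive_sin (0 : R).
  by exists r => // s; have := hr s; rewrite cos0 sin0 !subr0 mul1r.
have [r3 r30 h3] : exists2 r : R, 0 < r & forall s : R, `|s| < r -> `|cos s - 1| <= d * `|s|.
  have /rder_eps/(_ d d0) [r r0 hr] := is_derive_cos (0 : R).
  by exists r => // s; have := hr s; rewrite cos0 sin0 !(oppr0, mul0r, addr0); apply.
exists (Num.min (Num.min r1 r2) (Num.min r3 d)).
  by rewrite !lt_min r10 r20 r30 d0.
move=> w /=; rewrite subr0 !lt_min => /andP[/andP[w1 w2] /andP[w3 w4]].
case: w w1 w2 w3 w4 => a b; set h := Complex a b => w1 w2 w3 w4.
have ra := Re_le_cabs h; have rb := Im_le_cabs h; rewrite /= in ra rb.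
set E : C := Complex (cos b) (sin b).
have E1 : cabs E = 1 by rewrite /cabs /= cos2Dsin2 sqrtr1.
have -> : cexp h - cexp 0 - 1 * h = (expR a - 1 - a)%:C * E +
   (1 + a)%:C * (E - 1 - Complex 0 b) + a%:C * Complex 0 b.
  rewrite cexp0 mul1r /cexp /h /E /=.
  by apply/eqP; rewrite eq_complex /=; apply/andP; split; apply/eqP; ring.
apply: le_trans (cabsD _ _) _.
have := cabsD ((expR a - 1 - a)%:C * E) ((1 + a)%:C * (E - 1 - Complex 0 b)).
rewrite !cabsM E1 mulr1 !cabs_real.
have b1 : cabs (Complex 0 b : C) = `|b|.
  by rewrite /cabs /= expr0n /= add0r sqrtr_sqr.
have e1 := h1 a ltac:(lra).
have e2 : cabs (E - 1 - Complex 0 b) <= 2 * (d * `|b|).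
  apply: le_trans (cabs_le_ReIm _) _; rewrite /E /= subr0 subr0.
  by have := h2 b ltac:(lra); have := h3 b ltac:(lra); lra.
rewrite b1; have a1 : `|1 + a| <= 2 by have := ler_normD 1 a; rewrite normr1; lra.
have p1 := normr_ge0 a; have p2 := normr_ge0 b; have p3 := cabs_ge0 h.
have m1 : d * `|a| <= e / 8 * cabs h by apply: ler_pM => //; lra.
have m2 : d * `|b| <= e / 8 * cabs h by apply: ler_pM => //; lra.
have m3 : `|a| * `|b| <= e / 8 * cabs h by apply: ler_pM => //; lra.
have m4 : `|1 + a| * cabs (E - 1 - Complex 0 b) <= 2 * (2 * (d * `|b|)).
  by apply: ler_pM => //; exact: cabs_ge0.
by have := mulr_ge0 (ltW e0) p3; lra.
Qed.
Lemma cder_cexp z : cder (@cexp R) z (cexp z).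
Proof.
have h : cder (fun w : C => w - z) z 1.
  by have := gderB (gder_id id z) (gder_cst id z z); rewrite subr0.
have h0 : cder (@cexp R) (z - z) 1 by rewrite subrr; exact: cder_cexp0.
have := gderZ (cexp z) (@gder_comp R C id (@cexp R) (fun w => w - z) z _ _ h0 h); rewrite !mulr1.
by apply: gder_ext ltr01 _ => w _; rewrite -cexpD addrC subrK.
Qed.

Lemma gder_cexp (X : Type) (j : X -> C) (g : X -> C) x d : gder j g x d ->
  gder j (fun y => cexp (g y)) x (cexp (g x) * d).
Proof. exact: (@gder_comp R X j (@cexp R) g x d _ (cder_cexp _)). Qed.

Definition iC : C := Complex 0 1.
Lemma cabs_iC : cabs iC = 1.
Proof. by rewrite /cabs /= expr0n expr1n add0r sqrtr1. Qed.
Definition tpi : C := (2 * pi)%:C * iC.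
Lemma cabs_tpi : cabs tpi = 2 * pi.
Proof. by rewrite cabsM cabs_iC mulr1 cabs_real ger0_norm // mulr_ge0 // pi_ge0. Qed.
Lemma tpi_neq0 : tpi != 0.
Proof. by rewrite -cabs_gt0 cabs_tpi mulr_gt0 // pi_gt0. Qed.
Lemma cexp_tpi : cexp tpi = 1.
Proof.
rewrite /cexp /tpi !(ReM, ImM) /= !mul0r !mulr0 !mulr1 subr0 addr0 expR0.
have := cosD2pi (0 : R); have := sinD2pi (0 : R).
rewrite !add0r cos0 sin0 -[pi *+ 2]mulr_natl => -> ->.
by rewrite !mul1r.
Qed.

Lemma cexp_surj w : w != 0 -> exists2 z, cexp z = w & `|complex.Im z| <= pi.
Proof.
rewrite -cabs_gt0 => w0; set r := cabs w.
set x := complex.Re w / r; set y := complex.Im w / r.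
have xy : x ^+ 2 + y ^+ 2 = 1.
  rewrite /x /y !expr_div_n -mulrDl -sqr_cabs divff // expf_neq0 // gt_eqF //.
have x1 : -1 <= x <= 1.
  by rewrite -ler_norml /x normrM normfV [`|r|]gtr0_norm // ler_pdivrMr // mul1r Re_le_cabs.
set t := acos x; have ct : cos t = x by apply: acosK; rewrite in_itv.
have st : sin t = `|y|.
  by rewrite sin_acos // -sqrtr_sqr; congr Num.sqrt; lra.
have t0 := acos_ge0 x1; have tp := acos_lepi x1.
have [s hs [cs ss]] : exists2 s : R, `|s| <= pi & cos s = x /\ sin s = y.
  have [y0|y0] := leP 0 y.
    by exists t; rewrite ?ger0_norm // ct st ger0_norm.
  by exists (- t); rewrite ?normrN ?ger0_norm // cosN sinN ct st ltr0_norm // opprK.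
exists (Complex (ln r) s) => //.
rewrite /cexp /= lnK ?posrE // cs ss /x /y !mulrA ![r * _]mulrC !mulfK ?gt_eqF //.
by case: (w).
Qed.
Lemma cexp_int_tpi (k : int) : cexp (k%:~R * tpi) = 1.
Proof.
have H (n : nat) : cexp (n%:R * tpi) = 1.
  by elim: n => [|n IH]; rewrite ?mul0r ?cexp0 // -natr1 mulrDl mul1r cexpD IH cexp_tpi mulr1.
case: k => n; first exact: H.
by rewrite NegzE mulrNz mulNr cexpN H invr1.
Qed.
Lemma Im_int_tpi (k : int) : complex.Im (k%:~R * tpi) = k%:~R * (2 * pi).
Proof.
have -> : (k%:~R : C) = (k%:~R : R)%:C by rewrite rmorph_int.
by rewrite /tpi !(ReM, ImM) /=; ring.
Qed.
Lemma Re_int_tpi (k : int) : complex.Re (k%:~R * tpi) = 0.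
Proof.
have -> : (k%:~R : C) = (k%:~R : R)%:C by rewrite rmorph_int.
by rewrite /tpi !(ReM, ImM) /=; ring.
Qed.
Lemma floor_reduce (t : R) : exists k : int, - pi <= t - k%:~R * (2 * pi) < pi.
Proof.
have p0 := pi_gt0 R; have p2 : 0 < 2 * pi :> R by rewrite mulr_gt0.
exists (Num.floor ((t + pi) / (2 * pi))).
have /andP[] := floor_itv ((t + pi) / (2 * pi)).
rewrite intrD mulr1z; set k : R := _%:~R; rewrite ler_pdivlMr // ltr_pdivrMr // mulrDl mul1r.
by move=> h1 h2; apply/andP; split; lra.
Qed.
Lemma cexp_inj_period z w : cexp z = cexp w -> exists k : int, z = w + k%:~R * tpi.
Proof.
move=> h; have [k hk] := floor_reduce (complex.Im (z - w)); exists k.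
set d := z - w - k%:~R * tpi.
have hd : cexp d = 1 by rewrite /d !cexpD !cexpN h mulfV ?cexp_neq0 // cexp_int_tpi invr1 mulr1.
have Rd : complex.Re d = 0.
  have := cabs_cexp d; rewrite hd cabs1 => e1.
  by apply: (@expR_inj R); rewrite expR0.
have Id : complex.Im d = complex.Im (z - w) - k%:~R * (2 * pi) by rewrite /d ImD ImN Im_int_tpi.
have ct : cos (complex.Im d) = 1.
  by have := congr1 (@complex.Re R) hd; rewrite /cexp /= Rd expR0 mul1r.
have p0 := pi_gt0 R.
have d0 : `|complex.Im d| = 0.
  apply: cos_inj; rewrite ?in_itv /= ?normr_ge0 ?lexx ?pi_ge0 //=.
    by rewrite Id ler_norml; lra.
  by rewrite cos0; case: (leP 0 (complex.Im d)) => [/ger0_norm ->|/ltr0_norm ->]; rewrite ?cosN.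
have D0 : d = 0.
  by move: Rd d0; case: (d) => a b /= -> /eqP; rewrite normr_eq0 => /eqP ->.
have -> : z = w + (d + k%:~R * tpi) by rewrite /d; ring.
by rewrite D0 add0r.
Qed.
End Exponential.

(** * Cauchy's integral formula and its consequences *)

Section CauchyFormula.
Variable R : realType.
Local Notation C := R[i].
Implicit Types (F q : C -> C) (U : set C) (W D : R -> C).

Definition is_pint D (v : C) := exists2 P : R -> C,
  (forall t : R, 0 <= t <= 1 -> pder P t (D t)) & v = P 1 - P 0.
Definition pint D : C := xget 0 [set v | is_pint D v].
Lemma is_pint_uniq D v w : is_pint D v -> is_pint D w -> v = w.
Proof. by move=> [P hP ->] [Q hQ ->]; exact: pder_inc_uniq hP hQ. Qed.
Lemma pintE D v : is_pint D v -> pint D = v.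
Proof.
by move=> h; apply: (@is_pint_uniq D) (h); exact: (@xgetPex _ 0 [set v | is_pint D v] (ex_intro _ v h)).
Qed.
Lemma pint_ex D : (forall t, pcont D t) -> is_pint D (pint D).
Proof.
move=> /path_primitive [P hP]; suff h : is_pint D (P 1 - P 0) by rewrite (pintE h).
by exists P.
Qed.
Lemma is_pintD D E v w : is_pint D v -> is_pint E w -> is_pint (fun t => D t + E t) (v + w).
Proof.
move=> [P hP ->] [Q hQ ->]; exists (fun t => P t + Q t); last by ring.
by move=> t ht; apply: gderD; [apply: hP|apply: hQ].
Qed.
Lemma is_pintZ (c : C) D v : is_pint D v -> is_pint (fun t => c * D t) (c * v).
Proof.
move=> [P hP ->]; exists (fun t => c * P t); last by ring.
by move=> t ht; apply: gderZ; apply: hP.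
Qed.
Lemma is_pint_ext D E v : (forall t : R, 0 <= t <= 1 -> D t = E t) -> is_pint D v -> is_pint E v.
Proof. by move=> h [P hP ->]; exists P => // t ht; rewrite -h //; exact: hP. Qed.
Lemma is_pint_bound D v (M : R) : is_pint D v ->
  (forall t : R, 0 <= t <= 1 -> cabs (D t) <= M) -> cabs v <= M.
Proof. by move=> [P hP ->]; exact: path_mvt hP. Qed.

Lemma path_bounded D : (forall t, pcont D t) ->
  exists2 M : R, 0 < M & forall t : R, 0 <= t <= 1 -> cabs (D t) <= M.
Proof.
move=> cD.
have [|c _ hc] := @EVT_max R (fun t => cabs (D t)) 0 1 ler01.
  apply: continuous_subspaceT => t; apply/continuous_eps => e e0.
  have [r r0 hr] := cD t e e0; exists r => // s; rewrite -cabs_rB => /hr.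
  apply: le_lt_trans; rewrite ler_norml; have := cabs_lb (D s) (D t).
  by have := cabs_lb (D t) (D s); rewrite [cabs (D t - _)]cabsC; lra.
exists (cabs (D c) + 1) => [|t t01]; first by rewrite ltr_wpDl ?cabs_ge0.
by have := hc t; rewrite in_itv /= => /(_ t01); lra.
Qed.

(** Differentiation under the integral sign, through an explicit second-order remainder of the
    kernel. Exponents 1 and 2 yield F' and the differentiability of F'. *)
Lemma kernel_der W (g : R -> C) (z : C) (dl : R) n : (0 < n <= 2)%N ->
  (forall t, pcont W t) -> (forall t, pcont g t) -> 0 < dl ->
  (forall t, dl <= cabs (g t - z)) ->
  cder (fun w => pint (fun t => W t / (g t - w) ^+ n)) z
       (n%:R * pint (fun t => W t / (g t - z) ^+ n.+1)).
Proof.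
move=> n12 cW cg d0 hd e e0.
have [M M0 hM] := path_bounded cW.
have far w t : cabs (w - z) < dl / 2 -> dl / 2 <= cabs (g t - w).
  by move=> h; have := cabsB_tri (g t) w z; have := hd t; lra.
have ex w m : cabs (w - z) < dl / 2 ->
    is_pint (fun t => W t / (g t - w) ^+ m) (pint (fun t => W t / (g t - w) ^+ m)).
  move=> h; apply: pint_ex => t; apply: gcontM => //.
  have c1 : pcont (fun t => g t - w) t by apply: gcontB => //; exact: gcont_cst.
  have n0 : g t - w != 0 by rewrite -cabs_gt0; apply: lt_le_trans (far w t h); lra.
  apply: gcontV; first exact: expf_neq0.
  elim: m => [|m IH]; first exact: gcont_cst.
  by apply: gcont_ext ltr01 _ (gcontM c1 IH) => y _; rewrite exprS.
have [B B0 hB] : exists2 B : R, 0 < B & forall w (a : C), cabs (w - z) < dl / 2 ->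
    dl <= cabs a -> dl / 2 <= cabs (a - (w - z)) ->
    cabs ((a - (w - z)) ^- n - a ^- n - n%:R * (w - z) * a ^- n.+1) <= B * cabs (w - z) ^+ 2.
  have i0 : 0 < dl^-1 by rewrite invr_gt0.
  have key w (a : C) : cabs (w - z) < dl / 2 -> dl <= cabs a -> dl / 2 <= cabs (a - (w - z)) ->
      [/\ a != 0, a - (w - z) != 0, cabs a^-1 <= dl^-1 & cabs (a - (w - z))^-1 <= 2 * dl^-1].
    move=> h1 h2 h3; have a0 : 0 < cabs a by lra.
    have b0 : 0 < cabs (a - (w - z)) by lra.
    rewrite -!cabs_gt0 a0 b0 !cabsV; split=> //; first by rewrite lef_pV2.
    have -> : 2 * dl^-1 = (dl / 2)^-1 by field; rewrite gt_eqF.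
    by rewrite lef_pV2 // posrE; lra.
  case: n n12 => [//|[|[|//]]] _.
    exists (2 * dl^-1 * dl^-1 ^+ 2); first by rewrite !mulr_gt0 ?exprn_gt0.
    move=> w a h1 h2 h3; have [a0 b0 ia ib] := key w a h1 h2 h3.
    have -> : (a - (w - z)) ^- 1 - a ^- 1 - 1%:R * (w - z) * a ^- 2 =
       (a - (w - z))^-1 * a^-1 ^+ 2 * (w - z) ^+ 2 by field; rewrite a0 b0.
    rewrite 2!cabsM !cabsX; apply: ler_wpM2r; first by rewrite exprn_ge0 // cabs_ge0.
    by apply: ler_pM; rewrite ?exprn_ge0 ?cabs_ge0 // lerXn2r // nnegrE ?cabs_ge0 // ltW.
  exists ((2 * dl^-1) ^+ 2 * dl^-1 ^+ 2 * 4); first by rewrite !mulr_gt0 ?exprn_gt0 ?mulr_gt0.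
  move=> w a h1 h2 h3; have [a0 b0 ia ib] := key w a h1 h2 h3.
  have -> : (a - (w - z)) ^- 2 - a ^- 2 - 2%:R * (w - z) * a ^- 3 =
     (a - (w - z))^-1 ^+ 2 * a^-1 ^+ 2 * (3%:R - 2%:R * (w - z) * a^-1) * (w - z) ^+ 2.
    by field; rewrite a0 b0.
  rewrite 3!cabsM !cabsX; apply: ler_wpM2r; first by rewrite exprn_ge0 // cabs_ge0.
  apply: ler_pM; rewrite ?mulr_ge0 ?exprn_ge0 ?cabs_ge0 //.
    by apply: ler_pM; rewrite ?exprn_ge0 ?cabs_ge0 // lerXn2r // nnegrE ?cabs_ge0 ?mulr_ge0 // ltW.
  apply: le_trans (cabsD _ _) _; rewrite cabsN !cabsM !cabs_natr.
  suff : cabs (w - z) * cabs a^-1 <= 1 / 2 by lra.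
  apply: (@le_trans _ _ (dl / 2 * dl^-1)); first by apply: ler_pM; rewrite ?cabs_ge0 // ltW.
  by rewrite mulrAC divff ?gt_eqF.
exists (Num.min (dl / 2) (e / (M * B))); first by rewrite lt_min !divr_gt0 // mulr_gt0.
move=> w /=; rewrite lt_min => /andP[w1 w2].
have z1 : cabs (z - z) < dl / 2 by rewrite subrr cabs0; lra.
have := is_pintD (ex w n w1) (is_pintD (is_pintZ (-1) (ex z n z1)) (is_pintZ (- (n%:R * (w - z))) (ex z n.+1 z1))).
set P1 := pint _; set P2 := pint _; set P3 := pint _ => h.
have -> : P1 - P2 - n%:R * P3 * (w - z) = P1 + (-1 * P2 + - (n%:R * (w - z)) * P3) by ring.
apply: is_pint_bound h _ => t t01.
have -> : W t / (g t - w) ^+ n + (-1 * (W t / (g t - z) ^+ n) + - (n%:R * (w - z)) * (W t / (g t - z) ^+ n.+1)) =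
  W t * ((g t - z - (w - z)) ^- n - (g t - z) ^- n - n%:R * (w - z) * (g t - z) ^- n.+1).
  have -> : g t - z - (w - z) = g t - w by ring.
  by ring.
rewrite cabsM; have := hB w (g t - z) w1 (hd t).
have E1 : g t - z - (w - z) = g t - w by ring.
rewrite {1}E1 => /(_ (far w t w1)) hb.
apply: (@le_trans _ _ (M * (B * cabs (w - z) ^+ 2))).
  by apply: ler_pM; rewrite ?cabs_ge0 //; exact: hM.
rewrite mulrA expr2 mulrA ler_wpM2r ?cabs_ge0 //.
by move: w2; rewrite ltr_pdivlMr ?mulr_gt0 // => /ltW; rewrite mulrC.
Qed.

Definition circ (c : C) (r : R) (t : R) : C := c + r%:C * cexp (tpi R * t%:C).
Lemma pder_circ c r t : pder (circ c r) t (tpi R * (circ c r t - c)).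
Proof.
have h := gder_cexp (gderZ (tpi R) (pder_id t)).
have := gderD (gder_cst (real_complex R) c t) (gderZ r%:C h).
have -> : 0 + r%:C * (cexp (tpi R * t%:C) * (tpi R * 1)) = tpi R * (circ c r t - c).
  by rewrite /circ; ring.
by [].
Qed.
Lemma circ01 c r : circ c r 1 = circ c r 0.
Proof. by rewrite /circ rmorph1 rmorph0 mulr1 mulr0 cexp_tpi cexp0. Qed.
Lemma cabs_circ c r t : 0 <= r -> cabs (circ c r t - c) = r.
Proof.
move=> r0; rewrite /circ addrAC subrr add0r cabsM cabs_real ger0_norm // cabs_cexp.
by rewrite /tpi !(ReM, ImM) /= !(mul0r, mulr0, subr0, addr0, mul1r, subrr) expR0 mulr1.
Qed.
End CauchyFormula.

Section HolomorphicFunctions.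
Variable R : realType.
Local Notation C := R[i].
Implicit Types (F q : C -> C) (U : set C) (c z : C).

Lemma slope_punctured F U p : eopen U -> hol U F -> U p -> exists s,
  [/\ (forall w, F w - F p = s w * (w - p)), cder F p (s p),
      (forall w, U w -> ccont s w) &
      (forall w, U w -> w != p -> exists d, cder s w d)].
Proof.
move=> oU hF Up; have [d hd] := hF _ Up; have /gderP[s [cs sp hs]] := hd.
have off w : U w -> w != p -> exists d, cder s w d.
  move=> Uw wp; have [e he] := hF _ Uw; have wp0 : w - p != 0 by rewrite subr_eq0.
  have h1 := gderB he (gder_cst id (F p) w).
  have h2 := gderV (f := fun y => y - p) wp0 (gderB (gder_id id w) (gder_cst id p w)).
  have := gderM h1 h2; set D := _ + _ => h3; exists D.
  have wp1 : 0 < cabs (w - p) by rewrite cabs_gt0.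
  apply: gder_ext wp1 _ h3 => y /= yw.
  have yp : y - p != 0.
    by rewrite subr_eq0; apply: contraTneq yw => ->; rewrite cabsC ltxx.
  by rewrite hs mulfK.
exists s; split => //; first by rewrite sp.
move=> w Uw; have [->//|/(off _ Uw)[e he]] := eqVneq w p; exact: gder_cont he.
Qed.

(** The integral [J] of the bare kernel has derivative 0, because the squared kernel has an explicit
    primitive, and it equals 2 pi i at the centre. What remains of the integrand is the slope of [F]
    at [z], which has a primitive. *)
Lemma cauchy_formula F c (r0 r : R) z : hol (disc c r0) F -> 0 < r < r0 ->
  cabs (z - c) < r ->
  is_pint (fun t => F (circ c r t) * (tpi R * (circ c r t - c)) / (circ c r t - z))
    (tpi R * F z).
Proof.
move=> hF /andP[rp rr0] zr.
have gc t : pcont (circ c r) t := gder_cont (pder_circ c r t).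
have gD t : disc c r0 (circ c r t) by rewrite /disc /= cabs_circ // ltW.
have far w t : cabs (w - c) < r -> r - cabs (w - c) <= cabs (circ c r t - w).
  by move=> h; have := cabsB_tri (circ c r t) w c; rewrite cabs_circ ?(ltW rp) //; lra.
have nz w t : cabs (w - c) < r -> circ c r t - w != 0.
  by move=> h; rewrite -cabs_gt0; apply: lt_le_trans (far w t h); lra.
set W := fun t => tpi R * (circ c r t - c).
have cW t : pcont W t.
  by apply: gcontM; [exact: gcont_cst|apply: gcontB => //; exact: gcont_cst].
set J := fun w => pint (fun t => W t / (circ c r t - w) ^+ 1).
have exJ w n : cabs (w - c) < r -> is_pint (fun t => W t / (circ c r t - w) ^+ n) (pint (fun t => W t / (circ c r t - w) ^+ n)).
  move=> h; apply: pint_ex => t; apply: gcontM => //.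
  apply: gcontV; first by rewrite expf_neq0 // nz.
  have c1 : pcont (fun t => circ c r t - w) t by apply: gcontB => //; exact: gcont_cst.
  elim: n => [|m IH]; first exact: gcont_cst.
  by apply: gcont_ext ltr01 _ (gcontM c1 IH) => y _; rewrite exprS.
have dJ w : disc c r w -> cder J w 0.
  rewrite /disc /= => h; have dl : 0 < r - cabs (w - c) by rewrite subr_gt0.
  have := @kernel_der R W (circ c r) w _ 1 isT cW gc dl (far w ^~ h).
  suff -> : pint (fun t => W t / (circ c r t - w) ^+ 2) = 0 by rewrite mulr0.
  apply: pintE; exists (fun t => - (circ c r t - w)^-1); last by rewrite circ01 subrr.
  move=> t _; have := gderN (gderV (f := fun t => circ c r t - w) (nz w t h) (gderB (pder_circ c r t) (gder_cst _ w t))).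
  by rewrite subr0 mulNr opprK.
have cc : cabs (c - c) < r by rewrite subrr cabs0.
have J0 : J c = tpi R.
  apply: pintE; exists (fun t : R => tpi R * t%:C); last by rewrite rmorph1 rmorph0; ring.
  move=> t _; have := gderZ (tpi R) (pder_id t).
  by rewrite /W expr1 -mulrA divff ?nz // mulr1.
have Jz : J z = tpi R.
  by rewrite -J0; apply: (deriv0_const (hull_disc c r) dJ); rewrite /disc /=.
have zD : disc c r0 z by exact: lt_trans zr rr0.
have [s [hs _ cs ds]] := slope_punctured (eopen_disc (r := r0)) hF zD.
have [Q hQ] := primitive_ex (hull_disc c r0) cs ds zD.
have p1 : is_pint (fun t => s (circ c r t) * W t) 0.
  exists (fun t => Q (circ c r t)); last by rewrite circ01 subrr.
  by move=> t _; exact: gder_comp (hQ _ (gD t)) (pder_circ c r t).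
have := is_pintD p1 (is_pintZ (F z) (exJ z 1 zr)); rewrite -/(J z) Jz add0r mulrC.
apply: is_pint_ext => t _; rewrite expr1 -/(W t).
have := hs (circ c r t); have := nz z t zr.
set g := circ c r t => n0 /eqP; rewrite subr_eq => /eqP ->.
by field.
Qed.

Lemma hol_deriv_disc F c (r0 r : R) : hol (disc c r0) F -> 0 < r < r0 ->
  exists G, (forall z, disc c r z -> cder F z (G z)) /\ hol (disc c r) G.
Proof.
move=> hF r01; have /andP[rp rr0] := r01.
have gc t : pcont (circ c r) t := gder_cont (pder_circ c r t).
have gD t : disc c r0 (circ c r t) by rewrite /disc /= cabs_circ // ltW.
have far w t : cabs (w - c) < r -> r - cabs (w - c) <= cabs (circ c r t - w).
  by move=> h; have := cabsB_tri (circ c r t) w c; rewrite cabs_circ ?(ltW rp) //; lra.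
set W := fun t => F (circ c r t) * (tpi R * (circ c r t - c)).
have cW t : pcont W t.
  apply: gcontM; first exact: gcont_comp (hol_cont hF (gD t)) (gc t).
  by apply: gcontM; [exact: gcont_cst|apply: gcontB => //; exact: gcont_cst].
set Phi := fun n w => pint (fun t => W t / (circ c r t - w) ^+ n).
have dPhi n w : (0 < n <= 2)%N -> disc c r w -> cder (Phi n) w (n%:R * Phi n.+1 w).
  rewrite /disc /= => h hw; have dl : 0 < r - cabs (w - c) by rewrite subr_gt0.
  exact: kernel_der h cW gc dl (far w ^~ hw).
have FE z : disc c r z -> (tpi R)^-1 * Phi 1 z = F z.
  move=> zr; apply: (mulfI (tpi_neq0 R)); rewrite mulrA divff ?tpi_neq0 // mul1r.
  by apply: pintE; apply: is_pint_ext (cauchy_formula hF r01 zr) => t _; rewrite expr1.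
exists (fun z => (tpi R)^-1 * Phi 2 z); split=> z zr; last first.
  by eexists; exact: (gderZ (tpi R)^-1 (dPhi 2 z isT zr)).
have := gderZ (tpi R)^-1 (dPhi 1 z isT zr); rewrite mul1r => h.
have [e e0 he] := eopen_disc zr.
by apply: gder_ext e0 _ h => w /he /FE.
Qed.

Lemma hol_deriv U F : eopen U -> hol U F -> hol U (fun z => 'D_1 F z).
Proof.
move=> oU hF z Uz; have [r r0 hr] := oU _ Uz.
have r2 : 0 < r / 2 < r by apply/andP; split; lra.
have [G [dG hG]] := hol_deriv_disc (hol_sub hr hF) r2.
have zz : disc z (r / 2) z by rewrite /disc /= subrr cabs0; lra.
have [d hd] := hG _ zz; exists d.
have r20 : 0 < r / 2 by lra.
by apply: gder_ext r20 _ hd => w /dG /cder_val.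
Qed.
Lemma hol_cder U F z : hol U F -> U z -> cder F z ('D_1 F z).
Proof. by move=> hF Uz; have [d hd] := hF _ Uz; rewrite (cder_val hd). Qed.

(** Morera's argument: a primitive exists despite [p], so [q] is the derivative of a holomorphic
    function. *)
Lemma hol_removable U q p : eopen U -> (forall z, U z -> ccont q z) ->
  (forall z, U z -> z != p -> exists d, cder q z d) -> hol U q.
Proof.
move=> oU cq dq z Uz; have [zp|/(dq _ Uz)//] := eqVneq z p; rewrite -{p}zp in dq.
have [r r0 hr] := oU _ Uz; have zz : disc z r z by rewrite /disc /= subrr cabs0.
have [Q hQ] := primitive_ex (hull_disc z r) (fun w hw => cq w (hr w hw))
  (fun w hw => dq w (hr w hw)) zz.
have hQ' : hol (disc z r) Q by move=> w /hQ; exists (q w).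
have [d hd] := hol_deriv (eopen_disc (r := r)) hQ' zz; exists d.
by apply: gder_ext r0 _ hd => w /hQ /cder_val.
Qed.

Lemma slope_hol F U p : eopen U -> hol U F -> U p -> exists s,
  [/\ hol U s, s p = 'D_1 F p & forall w, F w = F p + s w * (w - p)].
Proof.
move=> oU hF Up; have [s [hs dF cs ds]] := slope_punctured oU hF Up.
exists s; split; last by move=> w; rewrite -hs addrC subrK.
  exact: hol_removable oU cs ds.
by rewrite (cder_val dF).
Qed.

Lemma holX U F n : hol U F -> hol U (fun z => F z ^+ n).
Proof.
move=> hF; elim: n => [|n IH] z Uz; first by exists 0; exact: gder_cst.
have [d hd] := hF _ Uz; have [e he] := IH _ Uz.
by eexists; apply: gder_ext ltr01 _ (gderM hd he) => y _; rewrite exprS.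
Qed.

(* The Cauchy formula gives the bound up to a constant factor; applying it to
   all powers of [F] removes the factor. *)
Lemma max_principle F c (r0 r M : R) z : hol (disc c r0) F -> 0 < r < r0 ->
  (forall w, cabs (w - c) = r -> cabs (F w) <= M) -> cabs (z - c) < r ->
  cabs (F z) <= M.
Proof.
move=> hF r01 hM zr; have /andP[rp rr0] := r01.
have M0 : 0 <= M.
  by apply: le_trans (hM (circ c r 0) _); rewrite ?cabs_ge0 // cabs_circ // ltW.
set K := r / (r - cabs (z - c)).
have K0 : 0 < K by rewrite divr_gt0 // subr_gt0.
have H n : cabs (F z) ^+ n <= K * M ^+ n.
  have h := cauchy_formula (holX n hF) r01 zr.
  have := is_pint_bound (M := M ^+ n * (2 * pi * r) / (r - cabs (z - c))) h.
  rewrite cabsM cabs_tpi cabsX => hb.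
  have p2 : 0 < 2 * pi :> R by rewrite mulr_gt0 // pi_gt0.
  rewrite -(ler_pM2l p2); apply: le_trans (hb _) _; last first.
    by rewrite /K le_eqVlt; apply/orP; left; apply/eqP; ring.
  move=> t _; rewrite cabsM cabsV 2!cabsM cabsX cabs_tpi cabs_circ ?(ltW rp) //.
  have d1 : r - cabs (z - c) <= cabs (circ c r t - z).
    by have := cabsB_tri (circ c r t) z c; rewrite cabs_circ ?(ltW rp) //; lra.
  have d0 : 0 < r - cabs (z - c) by rewrite subr_gt0.
  apply: ler_pM.
  - by rewrite !mulr_ge0 ?exprn_ge0 ?cabs_ge0 ?pi_ge0 // ltW.
  - by rewrite invr_ge0 cabs_ge0.
  - apply: ler_wpM2r; first by rewrite mulr_ge0 // ltW.
    by rewrite lerXn2r // ?nnegrE ?cabs_ge0 // hM // cabs_circ // ltW.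
  - by rewrite lef_pV2 // posrE; apply: lt_le_trans d1.
rewrite leNgt; apply/negP => h.
have F0 : 0 < cabs (F z) by apply: le_lt_trans h.
have k01 : 0 <= M / cabs (F z) < 1.
  by rewrite divr_ge0 ?cabs_ge0 //= ltr_pdivrMr // mul1r.
have [n hn] := expr_lt_eps k01 (e := K^-1) ltac:(by rewrite invr_gt0).
have := H n; rewrite leNgt => /negP; apply.
by move: hn; rewrite expr_div_n ltr_pdivrMr ?exprn_gt0 // mulrC ltr_pdivlMr // mulrC.
Qed.

Lemma schwarz F c (r M : R) : 0 < r -> hol (disc c r) F -> F c = 0 ->
  (forall w, disc c r w -> cabs (F w) <= M) ->
  cabs ('D_1 F c) <= M / r /\ forall z, disc c r z -> cabs (F z) <= M / r * cabs (z - c).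
Proof.
move=> r0 hF Fc hM; have cc : disc c r c by rewrite /disc /= subrr cabs0.
have [s [hs sc sF]] := slope_hol (eopen_disc (r := r)) hF cc.
have M0 : 0 <= M by apply: le_trans (hM _ cc); exact: cabs_ge0.
suff H z : disc c r z -> cabs (s z) <= M / r.
  split=> [|z zr]; first by rewrite -sc; exact: H.
  by rewrite sF Fc add0r cabsM ler_wpM2r ?cabs_ge0 // H.
rewrite /disc /= => zr; rewrite ler_pdivlMr //; apply/ler_addgt0Pr => e e0.
set B := cabs (s z) + 1; have B0 : 0 < B by rewrite /B ltr_wpDl ?cabs_ge0.
have eB : 0 < e / B by rewrite divr_gt0.
(* Working on the circle of radius [r'] costs [cabs (s z) * (r - r')], which this choice keeps below
   [e]. *)
have [r' /andP[r'1 r'2] r'3] : exists2 r' : R, cabs (z - c) < r' < r & r - r' < e / B.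
  have [h|h] := leP (r - cabs (z - c)) (e / B / 2).
    by exists ((r + cabs (z - c)) / 2); [apply/andP; split|]; lra.
  by exists (r - e / B / 2); [apply/andP; split|]; lra.
have r'p : 0 < r' by apply: le_lt_trans r'1; exact: cabs_ge0.
have h : cabs (s z) <= M / r'.
  apply: (max_principle hs _ _ r'1); first by rewrite r'p.
  move=> w wr'; rewrite ler_pdivlMr // -wr' -cabsM.
  have -> : s w * (w - c) = F w by rewrite sF Fc add0r.
  by apply: hM; rewrite /disc /= wr'.
have : cabs (s z) * r' <= M by rewrite -ler_pdivlMr.
have : cabs (s z) * (r - r') <= B * (e / B).
  by apply: ler_pM; rewrite ?cabs_ge0 ?/B ?lerDl //; lra.
by rewrite mulrCA divff ?gt_eqF // mulr1; lra.
Qed.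

Lemma cauchy_estimate F c (r M : R) : 0 < r -> hol (disc c r) F ->
  (forall w, disc c r w -> cabs (F w) <= M) -> cabs ('D_1 F c) <= 2 * M / r.
Proof.
move=> r0 hF hM; have cc : disc c r c by rewrite /disc /= subrr cabs0.
have d1 := hol_cder hF cc.
have d2 := gderB d1 (gder_cst id (F c) c); rewrite subr0 in d2.
have h : hol (disc c r) (fun z => F z - F c).
  by move=> z /hF[d hd]; eexists; exact: gderB hd (gder_cst id (F c) z).
have [|w wr|+ _] := @schwarz (fun z => F z - F c) c r (2 * M) r0 h.
- by rewrite subrr.
- by apply: le_trans (cabsD _ _) _; rewrite cabsN; have := hM _ wr; have := hM _ cc; lra.
- by rewrite (cder_val d2).
Qed.

Lemma hol_log U G : hull_dom U -> hol U G -> (forall z, U z -> G z != 0) ->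
  exists l, forall z, U z -> G z = cexp (l z) /\ cder l z ('D_1 G z / G z).
Proof.
move=> hU hG nG.
have [[p Up]|/forallNP nU] := pselect (exists p, U p); last first.
  by exists (fun=> 0) => z /nU.
have hq : hol U (fun z => 'D_1 G z / G z).
  move=> z Uz; have [d hd] := hol_deriv hU.1 hG Uz; have [e he] := hG _ Uz.
  by eexists; apply: gderM hd (gderV (nG _ Uz) he).
have [l hl] := primitive_ex hU (fun z Uz => hol_cont hq Uz) (fun z Uz _ => hq z Uz) Up.
have [k kE _] := cexp_surj (nG _ Up).
exists (fun z => l z + (k - l p)) => z Uz; split; last first.
  by have := gderD (hl _ Uz) (gder_cst id (k - l p) z); rewrite addr0.
have d0 w : U w -> cder (fun w => G w * cexp (- l w)) w 0.
  move=> Uw; have := gderM (hol_cder hG Uw) (gder_cexp (gderN (hl _ Uw))).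
  congr gder; have := nG _ Uw; by move=> ?; field.
have := deriv0_const hU d0 Uz Up.
rewrite !cexpN => /(congr1 (fun x => x * cexp (l z))).
rewrite divfK ?cexp_neq0 // => ->.
by rewrite addrC addrAC !cexpD cexpN kE; ring.
Qed.
End HolomorphicFunctions.

Section HolCalculus.
Variable R : realType.
Local Notation C := R[i].
Implicit Types (f g : C -> C) (U V : set C) (c : C).
Lemma hol_cst U c : hol U (fun=> c).
Proof. by move=> z _; exists 0; exact: gder_cst. Qed.
Lemma hol_id U : hol U id.
Proof. by move=> z _; exists 1; exact: gder_id. Qed.
Lemma holD U f g : hol U f -> hol U g -> hol U (fun z => f z + g z).
Proof.
by move=> hf hg z Uz; have [d hd] := hf _ Uz; have [e he] := hg _ Uz; exists (d + e); exact: gderD.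
Qed.
Lemma holN U f : hol U f -> hol U (fun z => - f z).
Proof. by move=> hf z Uz; have [d hd] := hf _ Uz; exists (- d); exact: gderN. Qed.
Lemma holB U f g : hol U f -> hol U g -> hol U (fun z => f z - g z).
Proof. by move=> hf hg; apply: holD => //; exact: holN. Qed.
Lemma holM U f g : hol U f -> hol U g -> hol U (fun z => f z * g z).
Proof.
by move=> hf hg z Uz; have [d hd] := hf _ Uz; have [e he] := hg _ Uz; eexists; exact: gderM hd he.
Qed.
Lemma holZ U c f : hol U f -> hol U (fun z => c * f z).
Proof. by apply: holM; exact: hol_cst. Qed.
Lemma holV U f : (forall z, U z -> f z != 0) -> hol U f -> hol U (fun z => (f z)^-1).
Proof. by move=> nf hf z Uz; have [d hd] := hf _ Uz; exists (- d / f z ^+ 2); exact: gderV (nf _ Uz) hd. Qed.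
Lemma hol_comp U V f g : hol V f -> hol U g -> (forall z, U z -> V (g z)) ->
  hol U (fun z => f (g z)).
Proof.
move=> hf hg UV z Uz; have [d hd] := hg _ Uz; have [e he] := hf _ (UV _ Uz).
by exists (e * d); exact: (@gder_comp R C id f g z _ _ he hd).
Qed.
Lemma hol_cexp U f : hol U f -> hol U (fun z => cexp (f z)).
Proof. by move=> hf z Uz; have [d hd] := hf _ Uz; exists (cexp (f z) * d); exact: gder_cexp. Qed.
End HolCalculus.

(** * Open mapping and inverses of univalent functions *)

Section OpenMapping.
Variable R : realType.
Local Notation C := R[i].
Implicit Types (F g : C -> C) (U : set C) (a c z w y : C).

Lemma circ_param c (r : R) w : 0 < r -> cabs (w - c) = r ->
  exists2 t : R, 0 <= t <= 1 & w = circ c r t.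
Proof.
move=> r0 wr; have p0 := pi_gt0 R; have p2 : 0 < 2 * pi :> R by rewrite mulr_gt0.
have nr : r%:C != 0 :> C by rewrite -cabs_gt0 cabs_real normr_gt0 gt_eqF.
have n0 : (w - c) / r%:C != 0.
  by rewrite -cabs_gt0 cabsM cabsV cabs_real wr ger0_norm ?(ltW r0) // divff ?gt_eqF.
have [x xE xp] := cexp_surj n0.
have Rx : complex.Re x = 0.
  have := cabs_cexp x; rewrite xE cabsM cabsV cabs_real wr ger0_norm ?(ltW r0) // divff ?gt_eqF //.
  by move=> e1; apply: (@expR_inj R); rewrite expR0.
have E (t : R) : t * (2 * pi) = complex.Im x -> w = circ c r t.
  move=> ht; rewrite /circ; have -> : tpi R * t%:C = x.
    apply/eqP; rewrite eq_complex; apply/andP; split; apply/eqP.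
      by rewrite /tpi !(ReM, ImM) /= Rx; ring.
    by rewrite /tpi !(ReM, ImM) /= -ht; ring.
  by rewrite xE; field.
have [x0|x0] := leP 0 (complex.Im x).
  exists (complex.Im x / (2 * pi)); last by apply: E; rewrite divfK // gt_eqF.
  rewrite divr_ge0 ?(ltW p2) //= ler_pdivrMr // mul1r.
  by have := ler_norm (complex.Im x); lra.
exists (complex.Im x / (2 * pi) + 1).
  have h : -1 <= complex.Im x / (2 * pi) <= 0.
    rewrite ler_pdivlMr // ler_pdivrMr //; move: xp; rewrite ler_norml; lra.
  by apply/andP; split; lra.
rewrite (E (complex.Im x / (2 * pi))) ?divfK ?gt_eqF // /circ.
set X : R := _ / _; have -> : (X + 1)%:C = X%:C + 1 by rewrite rmorphD rmorph1.
by rewrite mulrDr mulr1 cexpD cexp_tpi mulr1.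
Qed.

Lemma circle_bounded q c (r : R) : 0 < r ->
  (forall w, cabs (w - c) = r -> ccont q w) ->
  exists2 M : R, 0 < M & forall w, cabs (w - c) = r -> cabs (q w) <= M.
Proof.
move=> r0 cq; have [t|M M0 hM] := @path_bounded R (fun t => q (circ c r t)).
  by apply: gcont_comp (gder_cont (pder_circ c r t)); apply: cq; rewrite cabs_circ // ltW.
by exists M => // w /(circ_param r0)[t t01 ->]; exact: hM.
Qed.

(** If [y] were omitted, the reciprocal of [F - y] would exceed at [c] its bound 2 / m on the
    circle, against the maximum principle. *)
Lemma min_modulus F c (r0 r m : R) y : hol (disc c r0) F -> 0 < r < r0 ->
  (forall w, cabs (w - c) = r -> m <= cabs (F w - F c)) ->
  cabs (y - F c) < m / 2 -> exists2 z, disc c r0 z & F z = y.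
Proof.
move=> hF r01 hm hy; apply: contrapT => /forall2NP nF.
have nz z : disc c r0 z -> F z - y != 0.
  by move=> zr; rewrite subr_eq0; apply/eqP => E; case: (nF z).
have hG : hol (disc c r0) (fun z => (F z - y)^-1).
  by apply: holV nz _; apply: holB => //; exact: hol_cst.
have /andP[rp rr0] := r01.
have cc : cabs (c - c) < r by rewrite subrr cabs0.
have m0 : 0 < m by have := cabs_ge0 (y - F c); lra.
have mE : 2 / m = (m / 2)^-1 by rewrite invf_div.
have h0 : 0 < cabs (F c - y).
  by rewrite cabs_gt0 nz // /disc /=; apply: lt_trans rr0.
have : cabs (F c - y)^-1 <= 2 / m.
  apply: (max_principle hG r01 _ cc) => w wr; rewrite cabsV mE.
  have := hm _ wr; have := cabsB_tri (F w) y (F c) => h1 h2.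
  by rewrite lef_pV2 ?posrE; lra.
by rewrite cabsV mE lef_pV2 ?posrE ?divr_gt0 // cabsC leNgt hy.
Qed.

Definition inj_on U F := forall z w, U z -> U w -> F z = F w -> z = w.

(** Injectivity keeps [F - F a] away from 0 on the circle of radius rho / 2; a bound for its
    reciprocal there feeds [min_modulus]. *)
Lemma open_mapping U F a (rho : R) : eopen U -> hol U F -> inj_on U F -> U a ->
  0 < rho -> disc a rho `<=` U ->
  exists2 m : R, 0 < m & forall y, cabs (y - F a) < m -> exists2 z, disc a rho z & F z = y.
Proof.
move=> oU hF iF Ua r0 hr.
have r2 : 0 < rho / 2 by lra.
have cU w : cabs (w - a) = rho / 2 -> U w by move=> h; apply: hr; rewrite /disc /= h; lra.
have nz w : cabs (w - a) = rho / 2 -> F w - F a != 0.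
  move=> h; rewrite subr_eq0; apply/eqP => /(iF _ _ (cU _ h) Ua) E.
  by move: h; rewrite E subrr cabs0; lra.
have [w h|M M0 hM] := @circle_bounded (fun w => (F w - F a)^-1) a (rho / 2) r2.
  apply: gcontV; first exact: nz.
  by apply: gcontB; [exact: hol_cont hF (cU _ h)|exact: gcont_cst].
exists (M^-1 / 2); first by rewrite divr_gt0 // invr_gt0.
move=> y hy; apply: (@min_modulus F a rho (rho / 2) M^-1 y (hol_sub hr hF)) => //.
  by apply/andP; split; lra.
move=> w h; have := hM _ h; rewrite cabsV => h1.
by rewrite -[leRHS]invrK lef_pV2 ?posrE ?invr_gt0 ?cabs_gt0 ?nz.
Qed.

(** If zeros accumulate at [c], every power of [w - c] divides [G], and the maximum principle for
    the quotients forces [G] to vanish. *)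
Lemma isolated_zeros G c (r : R) : 0 < r -> hol (disc c r) G ->
  (exists2 e : R, 0 < e & forall w, w != c -> cabs (w - c) < e -> G w != 0) \/
  (forall w, disc c r w -> G w = 0).
Proof.
move=> r0 hG; have cc : disc c r c by rewrite /disc /= subrr cabs0.
have [iso|niso] := pselect (exists2 e : R, 0 < e & forall w, w != c -> cabs (w - c) < e -> G w != 0).
  by left.
right.
have div n : exists2 s, hol (disc c r) s & forall w, G w = s w * (w - c) ^+ n.
  elim: n => [|n [s hs sG]]; first by exists G => // w; rewrite expr0 mulr1.
  have [sc|sc] := eqVneq (s c) 0; last first.
    exfalso; apply: niso; rewrite -cabs_gt0 in sc.
    have [e e0 he] := hol_cont hs cc sc; exists e => // w wc /he h.
    rewrite sG mulf_neq0 ?expf_neq0 ?subr_eq0 // -cabs_gt0.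
    by have := cabs_lb (s c) (s w); rewrite cabsC; lra.
  have [t [ht _ ts]] := slope_hol (eopen_disc (r := r)) hs cc.
  by exists t => // w; rewrite sG ts sc add0r exprS mulrA.
move=> w wr; apply: cabs_eq_limit => e e0; rewrite subr0.
set r1 := (cabs (w - c) + r) / 2.
have [w1 w2] : cabs (w - c) < r1 /\ r1 < r by rewrite /disc /= in wr; rewrite /r1; split; lra.
have r10 : 0 < r1 by apply: le_lt_trans w1; exact: cabs_ge0.
have [z hz|M M0 hM] := @circle_bounded G c r1 r10.
  by apply: hol_cont hG _; rewrite /disc /= hz.
have k01 : 0 <= cabs (w - c) / r1 < 1.
  by rewrite divr_ge0 ?cabs_ge0 ?(ltW r10) //= ltr_pdivrMr // mul1r.
have [n hn] := expr_lt_eps k01 (e := e / M) ltac:(by rewrite divr_gt0).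
have [s hs sG] := div n.
have := @max_principle _ s c r r1 (M / r1 ^+ n) w hs _ _ w1.
rewrite r10 w2 => /(_ isT) h.
have {}h : cabs (s w) <= M / r1 ^+ n.
  apply: h => z hz; rewrite ler_pdivlMr ?exprn_gt0 // -hz -cabsX -cabsM -sG; exact: hM.
rewrite sG cabsM cabsX; apply: (@le_trans _ _ (M / r1 ^+ n * cabs (w - c) ^+ n)).
  by apply: ler_wpM2r; rewrite ?exprn_ge0 ?cabs_ge0.
by rewrite mulrAC -mulrA -expr_div_n mulrC -ler_pdivlMr // ltW.
Qed.

Lemma inverse_cder F g z d : cder F z d -> d != 0 -> g (F z) = z -> ccont g (F z) ->
  (exists2 e : R, 0 < e & forall y, cabs (y - F z) < e -> F (g y) = y) ->
  cder g (F z) d^-1.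
Proof.
move=> /gderP[s [cs sz hs]] d0 gz cg [e e0 he] eps eps0.
have c1 : ccont (fun y => (s (g y))^-1) (F z).
  apply: gcontV; first by rewrite gz sz.
  by apply: gcont_comp => //; rewrite gz.
have c2 : ccont (fun y => s (g y)) (F z) by apply: gcont_comp => //; rewrite gz.
have [r r0 hr] := c1 _ eps0.
have [r' r'0 hr'] := c2 (cabs d) ltac:(by rewrite cabs_gt0).
exists (Num.min (Num.min r r') e); first by rewrite !lt_min r0 r'0.
move=> y; rewrite !lt_min => /andP[/andP[y1 y2] y3].
have sn : s (g y) != 0.
  have := hr' _ y2; rewrite /= gz sz; apply: contraTneq => ->.
  by rewrite sub0r cabsN ltxx.
have -> : g y - g (F z) - d^-1 * (id y - id (F z)) = ((s (g y))^-1 - (s (g (F z)))^-1) * (y - F z).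
  rewrite gz sz /=; have := hs (g y); rewrite he //= => E.
  by rewrite [in RHS]mulrBl [in RHS]E mulrA mulVf // mul1r E.
by rewrite cabsM ler_wpM2r ?cabs_ge0 // ltW // hr.
Qed.

Section Univalent.
Variables (U : set C) (F : C -> C).
Hypotheses (oU : eopen U) (hF : hol U F) (iF : inj_on U F).

Lemma inverse_cont g z : U z ->
  (forall y, (F @` U) y -> U (g y) /\ F (g y) = y) -> ccont g (F z).
Proof.
move=> Uz hg e e0; have [r r0 hr] := oU Uz.
have s0 : 0 < Num.min r e by rewrite lt_min r0.
have hs : disc z (Num.min r e) `<=` U.
  by move=> w; rewrite /disc /= lt_min => /andP[/hr].
have [m m0 hm] := open_mapping oU hF iF Uz s0 hs.
exists m => // y /hm[w ws <-].
have gF v : U v -> g (F v) = v.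
  by move=> Uv; have [|h1 h2] := hg (F v); [exists v|apply: iF].
rewrite !gF //; last exact: hs.
by move: ws; rewrite /disc /= lt_min => /andP[].
Qed.

Lemma image_eopen : eopen (F @` U).
Proof.
move=> _ [z Uz <-]; have [r r0 hr] := oU Uz.
have [m m0 hm] := open_mapping oU hF iF Uz r0 hr.
by exists m => // y /hm[w wr <-]; exists w => //; exact: hr.
Qed.

Lemma right_inverse_ex : exists g, forall y, (F @` U) y -> U (g y) /\ F (g y) = y.
Proof.
have H y : exists z, (F @` U) y -> U z /\ F z = y.
  have [[z Uz zy]|n] := pselect ((F @` U) y); first by exists z.
  by exists 0.
by have [g hg] := choice H; exists g.
Qed.

(* If [F'] vanished at [a], the inverse would be holomorphic off [F a] and
   continuous there, hence holomorphic, contradicting the chain rule. *)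
Lemma univalent_deriv_neq0 a : U a -> 'D_1 F a != 0.
Proof.
move=> Ua; apply/eqP => da0; have [r r0 hr] := oU Ua.
have [g hg] := right_inverse_ex.
have hG := hol_sub hr (hol_deriv oU hF).
have gF v : U v -> g (F v) = v.
  by move=> Uv; have [|h1 h2] := hg (F v); [exists v|apply: iF].
have [[e e0 he]|z0] := isolated_zeros r0 hG; last first.
  have dF w : disc a r w -> cder F w 0.
    by move=> wr; rewrite -(z0 _ wr); exact: hol_cder hF (hr _ wr).
  have w1 : disc a r (a + (r / 2)%:C).
    by rewrite /disc /= addrAC subrr add0r cabs_real ger0_norm; lra.
  have a1 : disc a r a by rewrite /disc /= subrr cabs0.
  have /(iF (hr _ w1) (hr _ a1)) := deriv0_const (hull_disc a r) dF w1 a1.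
  move=> /(congr1 (fun u => cabs (u - a))).
  by rewrite subrr cabs0 addrAC subrr add0r cabs_real gtr0_norm; lra.
have s0 : 0 < Num.min r e by rewrite lt_min r0.
have hs : disc a (Num.min r e) `<=` U.
  by move=> w; rewrite /disc /= lt_min => /andP[/hr].
have [m m0 hm] := open_mapping oU hF iF Ua s0 hs.
have near w : U w -> exists2 e : R, 0 < e & forall y, cabs (y - F w) < e -> F (g y) = y.
  move=> Uw; have [|k k0 hk] := @image_eopen (F w); first by exists w.
  by exists k => // y /hk /hg[].
have hgm : hol (disc (F a) m) g.
  apply: (@hol_removable R _ g (F a) (eopen_disc (r := m))).
    move=> y /hm [w ws <-]; apply: inverse_cont => //; exact: hs.
  move=> _ /hm [w ws <-] wa; exists ('D_1 F w)^-1.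
  have Uw := hs _ ws.
  apply: inverse_cder; rewrite ?gF //; last 2 first.
  - exact: inverse_cont.
  - exact: near.
  - exact: (hol_cder hF Uw).
  - move: ws; rewrite /disc /= lt_min => /andP[_ we]; apply: he => //.
    by apply: contraNneq wa => ->.
have fa : disc (F a) m (F a) by rewrite /disc /= subrr cabs0.
have [d hd] := hgm _ fa.
have h1 := gder_comp hd (hol_cder hF Ua).
have h2 : cder id a (d * 'D_1 F a).
  by apply: gder_ext r0 _ h1 => w /hr /gF.
have := cder_uniq h2 (gder_id id a); rewrite da0 mulr0 => /esym /eqP.
by rewrite oner_eq0.
Qed.

Lemma inverse_hol g z : (forall y, (F @` U) y -> U (g y) /\ F (g y) = y) -> U z ->
  cder g (F z) ('D_1 F z)^-1.
Proof.
move=> hg Uz; apply: inverse_cder.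
- exact: (hol_cder hF Uz).
- exact: univalent_deriv_neq0.
- by have [|h1 h2] := hg (F z); [exists z|apply: iF].
- exact: inverse_cont.
- have [|k k0 hk] := @image_eopen (F z); first by exists z.
  by exists k => // y /hk /hg[].
Qed.
End Univalent.
End OpenMapping.

(** * Koebe's theorem *)

Section Koebe.
Variable R : realType.
Local Notation C := R[i].
Implicit Types (F g : C -> C) (U : set C) (a c z w y : C).

Lemma real_ivt_sign (f : R -> R) : (forall t, 0 <= t <= 1 ->
    forall e, 0 < e -> exists2 r, 0 < r & forall s, 0 <= s <= 1 -> `|s - t| < r -> `|f s - f t| < e) ->
  0 < f 0 -> f 1 < 0 -> exists2 t, 0 <= t <= 1 & f t = 0.
Proof.
move=> cf f0 f1; pose h t := f (clamp t).
have ch : continuous h.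
  move=> t; apply/continuous_eps => e e0; have [r r0 hr] := cf _ (clamp01 t) e e0.
  exists r => // s st; apply: hr (clamp01 s) _.
  by apply: le_lt_trans st; exact: clamp_lip.
have h0 : h 0 = f 0 by rewrite /h clamp_id // lexx ler01.
have h1 : h 1 = f 1 by rewrite /h clamp_id // lexx ler01.
have [||t t01 ht] := @IVT R h 0 1 0 ler01.
- by apply: continuous_subspaceT => t; exact: ch.
- by rewrite h0 h1 ge_min le_max (ltW f1) (ltW f0) orbT.
by exists (clamp t) => //; exact: clamp01.
Qed.

(* With [w] an omitted value at nearly minimal distance from [F a], the square
   root of [(w - F z) / (w - F a)] stays away from [-1]: its negative would be
   a second square root over the disc covered by [F].  So [b = 1 / (sqrt + 1)]
   is bounded, and [F] is a rational function of [b]. *)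
Lemma koebe_aux F a (r : R) w : 0 < r -> hol (disc a r) F -> inj_on (disc a r) F ->
  (forall z, disc a r z -> F z != w) ->
  (forall y, cabs (y - F a) < cabs (w - F a) / 2 -> (F @` disc a r) y) ->
  exists b : C -> C, [/\ hol (disc a r) b, b a = 2%:R^-1,
    forall z, disc a r z -> b z != 0 /\ F z = w - (w - F a) * ((b z)^-1 - 1) ^+ 2 &
    forall z, disc a r z -> cabs (b z) <= 5].
Proof.
move=> r0 hF iF nw cov; set om := w - F a.
have aD : disc a r a by rewrite /disc /= subrr cabs0.
have om0 : om != 0 by rewrite subr_eq0 eq_sym nw.
have omp : 0 < cabs om by rewrite cabs_gt0.
have hG : hol (disc a r) (fun z => (w - F z) * om^-1).
  by apply: holM; [apply: holB => //; exact: hol_cst|exact: hol_cst].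
have nG z : disc a r z -> (w - F z) * om^-1 != 0.
  by move=> zr; rewrite mulf_neq0 ?invr_neq0 // subr_eq0 eq_sym nw.
have [l hl] := hol_log (hull_disc a r) hG nG.
have n2 : (2%:R : C) != 0 by rewrite pnatr_eq0.
pose s z := cexp ((l z - l a) / 2%:R).
have hs : hol (disc a r) s.
  apply: hol_cexp; apply: holM; last exact: hol_cst.
  apply: holB; last exact: hol_cst.
  by move=> z /hl[_ h]; eexists; exact: h.
have sE z : disc a r z -> s z ^+ 2 = (w - F z) / om.
  move=> zr; rewrite expr2 -cexpD -mulr2n -[_ *+ 2]mulr_natr divfK //.
  by rewrite cexpD cexpN -(hl _ zr).1 -(hl _ aD).1 -/om divff // invr1 mulr1.
have sa : s a = 1 by rewrite /s subrr mul0r cexp0.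
have [g hg] := right_inverse_ex (disc a r) F.
have gF z : disc a r z -> g (F z) = z.
  by move=> zr; have [|h1 h2] := hg (F z); [exists z|apply: iF].
(* If [s z] were near -1, [F z] would be so close to [F a] that [F] covers the segment between them.
   Along it [s] composed with the inverse of [F] runs from 1 to near -1, so its real part vanishes
   somewhere, although its square stays within 1/2 of 1. The value 1/5 is small enough for
   (1/5)(11/5) < 1/2. *)
have far z : disc a r z -> 5^-1 <= cabs (s z + 1).
  move=> zr; rewrite leNgt; apply/negP => hz.
  have Gz : cabs (s z ^+ 2 - 1) < 2^-1.
    have -> : s z ^+ 2 - 1 = (s z + 1) * (s z + 1 - 2%:R) by ring.
    rewrite cabsM; have h1 : cabs (s z + 1 - 2%:R) <= 11 / 5.
      by apply: le_trans (cabsD _ _) _; rewrite cabsN cabs_natr; lra.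
    have h2 : cabs (s z + 1) * cabs (s z + 1 - 2%:R) <= 5^-1 * (11 / 5).
      by apply: ler_pM; rewrite ?cabs_ge0 // ltW.
    lra.
  have Fz : cabs (F z - F a) < cabs om / 2.
    have -> : F z - F a = om * (1 - s z ^+ 2) by rewrite sE // /om; field.
    by rewrite cabsM [cabs (1 - _)]cabsC ltr_pM2l.
  have B t : 0 <= t <= 1 -> cabs (seg_pt (F a) (F z) t - F a) < cabs om / 2.
    move=> /andP[t0 t1]; have -> : seg_pt (F a) (F z) t - F a = t%:C * (F z - F a).
      by rewrite /seg_pt; ring.
    rewrite cabsM cabs_real ger0_norm //; apply: le_lt_trans Fz.
    by apply: ler_piMl => //; exact: cabs_ge0.
  pose f t := complex.Re (s (g (seg_pt (F a) (F z) t))).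
  have [|||t t01] := @real_ivt_sign f.
  - move=> t t01 e e0; have Vt := cov _ (B t t01); have [gt1 gt2] := hg _ Vt.
    have cg : ccont (fun y => s (g y)) (seg_pt (F a) (F z) t).
      apply: gcont_comp; first exact: (hol_cont hs).
      rewrite -gt2; exact: (inverse_cont (eopen_disc (r := r)) hF iF gt1 hg).
    have cp : pcont (fun t => s (g (seg_pt (F a) (F z) t))) t.
      exact: (@gcont_comp R R (real_complex R) (fun y => s (g y)) (seg_pt (F a) (F z)) t cg (gder_cont (pder_seg _ _ t))).
    have [k k0 hk] := cp e e0; exists k => // u _ ut; rewrite /f -ReN -ReD.
    by apply: le_lt_trans (Re_le_cabs _) _; apply: hk; rewrite cabs_rB.
  - by rewrite /f /seg_pt rmorph0 mul0r addr0 gF // sa /= ltr01.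
  - have -> : f 1 = complex.Re (s z).
      by rewrite /f /seg_pt rmorph1 mul1r addrC subrK gF.
    have := Re_le_cabs (s z + 1); rewrite ReD /= ler_norml; lra.
  have [gt1 gt2] := hg _ (cov _ (B t t01)); rewrite /f; set u := g _ in gt1 gt2 * => ft.
  have := sE _ gt1; rewrite gt2 => e1.
  have R1 : complex.Re (s u ^+ 2) <= 0.
    by rewrite expr2 ReM ft mul0r sub0r oppr_le0 -expr2 sqr_ge0.
  have R2 : cabs (s u ^+ 2 - 1) < 2^-1.
    rewrite e1; have -> : (w - seg_pt (F a) (F z) t) / om - 1 = - (seg_pt (F a) (F z) t - F a) / om.
      by rewrite /om; field.
    rewrite cabsM cabsN cabsV ltr_pdivrMr // mulrC; exact: B.
  have R3 : complex.Re (1 : C) = 1 by [].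
  have := Re_le_cabs (s u ^+ 2 - 1); rewrite ReD ReN R3 ler_norml; lra.
have n1 z : disc a r z -> s z + 1 != 0.
  by move=> /far h; rewrite -cabs_gt0; lra.
exists (fun z => (s z + 1)^-1); split.
- by apply: holV => //; apply: holD => //; exact: hol_cst.
- by rewrite sa.
- move=> z zr; split; first by rewrite invr_neq0 // n1.
  by rewrite invrK addrK sE // mulrC divfK //; ring.
- move=> z /far h; rewrite cabsV -[leRHS]invrK lef_pV2 // posrE //; lra.
Qed.

(** At [a], where b = 1/2, the derivatives of F = w - om (1/b - 1)^2 involve only b' and b''.
    Cauchy's estimates with |b| <= 5 give 80 = 8 * 10 and 7040 = 64 * 100 + 8 * 80. The middle
    inequality is Schwarz's lemma for the inverse of [F] on the covered disc. *)
Lemma koebe_estimates F a (r : R) w : 0 < r -> hol (disc a r) F -> inj_on (disc a r) F ->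
  (forall z, disc a r z -> F z != w) ->
  (forall y, cabs (y - F a) < cabs (w - F a) / 2 -> (F @` disc a r) y) ->
  [/\ r * cabs ('D_1 F a) <= 80 * cabs (w - F a),
      cabs (w - F a) <= 2 * r * cabs ('D_1 F a) &
      r ^+ 2 * cabs ('D_1 (fun z => 'D_1 F z) a) <= 7040 * cabs (w - F a)].
Proof.
move=> r0 hF iF nw cov; have oD := eopen_disc (c := a) (r := r).
have aD : disc a r a by rewrite /disc /= subrr cabs0.
have [b [hb ba bF b5]] := koebe_aux r0 hF iF nw cov.
set om := w - F a in bF *.
have omp : 0 < cabs om by rewrite cabs_gt0 subr_eq0 eq_sym nw.
have n2 : (2%:R : C) != 0 by rewrite pnatr_eq0.
have dF z : disc a r z -> 'D_1 F z = 2%:R * om * ((b z)^-1 ^+ 3 - (b z)^-1 ^+ 2) * 'D_1 b z.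
  move=> zr; apply: cder_val; have [e e0 he] := oD _ zr.
  have [bz _] := bF _ zr.
  have h1 := gderB (gderV bz (hol_cder hb zr)) (gder_cst id 1 z).
  have h2 := gderB (gder_cst id w z) (gderZ om (gderM h1 h1)).
  apply: (gder_ext e0 (f := fun z => w - om * (((b z)^-1 - 1) * ((b z)^-1 - 1)))).
    by move=> y /he /bF[_ ->]; rewrite expr2.
  have -> : 2%:R * om * ((b z)^-1 ^+ 3 - (b z)^-1 ^+ 2) * 'D_1 b z =
    0 - om * ((- 'D_1 b z / b z ^+ 2 - 0) * ((b z)^-1 - 1) + ((b z)^-1 - 1) * (- 'D_1 b z / b z ^+ 2 - 0)).
    by field.
  exact: h2.
have hb' := hol_deriv oD hb.
have b0 : b a != 0 by have [] := bF _ aD.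
have ddF : 'D_1 (fun z => 'D_1 F z) a = - 64%:R * om * 'D_1 b a ^+ 2 + 8%:R * om * 'D_1 (fun z => 'D_1 b z) a.
  apply: cder_val.
  have h1 := gderV b0 (hol_cder hb aD).
  have h2 := gderM h1 h1; have h3 := gderM h2 h1.
  have h4 := gderM (gderZ (2%:R * om) (gderB h3 h2)) (hol_cder hb' aD).
  apply: (gder_ext r0 (f := fun z => 2%:R * om * ((b z)^-1 * (b z)^-1 * (b z)^-1 - (b z)^-1 * (b z)^-1) * 'D_1 b z)).
    by move=> y yr; rewrite dF //; congr (_ * _ * _); ring.
  have ib : (b a)^-1 = 2%:R by rewrite ba invrK.
  move: h4; rewrite -exprVn ib; move: ('D_1 b a) ('D_1 _ a) => x x'.
  by congr gder; ring.
have e1 : cabs ('D_1 b a) <= 10 / r.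
  by have := cauchy_estimate r0 hb b5; rewrite (_ : 2 * 5 = 10 :> R) //; lra.
have e2 : cabs ('D_1 (fun z => 'D_1 b z) a) <= 80 / r ^+ 2.
  have r2 : 0 < r / 2 by lra.
  have sub z : disc a (r / 2) z -> disc z (r / 2) `<=` disc a r.
    by rewrite /disc /= => h y /= hy; have := cabsB_tri y z a; lra.
  have b'z z : disc a (r / 2) z -> cabs ('D_1 b z) <= 20 / r.
    move=> zr; apply: le_trans (cauchy_estimate r2 (hol_sub (sub _ zr) hb) _) _.
      by move=> y /(sub _ zr) /b5; apply.
    by rewrite le_eqVlt; apply/orP; left; apply/eqP; field; rewrite gt_eqF.
  have aa : disc a (r / 2) a by rewrite /disc /= subrr cabs0.
  apply: le_trans (cauchy_estimate r2 (hol_sub (sub _ aa) hb') b'z) _.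
  by rewrite le_eqVlt; apply/orP; left; apply/eqP; field; rewrite gt_eqF.
split.
- rewrite dF // ba (_ : _ * _ * _ = 8%:R * om * 'D_1 b a); last by field.
  rewrite !cabsM cabs_natr.
  have h : cabs ('D_1 b a) * r <= 10 by rewrite -ler_pdivlMr.
  have := @ler_wpM2l R (cabs om) (cabs_ge0 om) _ _ h.
  clear e1 e2 h ddF dF; rewrite -/om; move: (cabs om) (cabs ('D_1 b a)) => x y.
  by lra.
- clear dF ddF e1 e2; have [g hg] := right_inverse_ex (disc a r) F.
  have c2 : 0 < cabs om / 2 by lra.
  have ga : g (F a) = a by have [|h1 h2] := hg (F a); [exists a|apply: iF].
  have dg y : (F @` disc a r) y -> cder g y ('D_1 F (g y))^-1.
    move=> [z zr <-]; have [|h1 h2] := hg (F z); first by exists z.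
    rewrite (iF _ _ h1 zr h2); exact: (inverse_hol oD hF iF hg zr).
  have hgD : hol (disc (F a) (cabs om / 2)) (fun y => g y - a).
    by move=> y /cov /dg h; eexists; exact: gderB h (gder_cst id a y).
  have [||+ _] := @schwarz R (fun y => g y - a) (F a) (cabs om / 2) r c2 hgD.
  - by rewrite ga subrr.
  - by move=> y /cov /hg[h _]; exact: ltW.
  have h := gderB (dg (F a) (ex_intro2 _ _ a aD erefl)) (gder_cst id a (F a)).
  rewrite (cder_val h) subr0 ga cabsV.
  have d0 : 0 < cabs ('D_1 F a) by rewrite cabs_gt0 (univalent_deriv_neq0 oD hF iF).
  rewrite invf_ple ?posrE ?divr_gt0 // invf_div ler_pdivrMr //.
  by lra.
- rewrite ddF; apply: (@le_trans _ _ (r ^+ 2 * (64 * cabs om * (10 / r) ^+ 2 + 8 * cabs om * (80 / r ^+ 2)))); last first.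
    by rewrite le_eqVlt; apply/orP; left; apply/eqP; field; rewrite gt_eqF.
  apply: ler_wpM2l; first exact: sqr_ge0.
  apply: le_trans (cabsD _ _) _; apply: lerD.
    rewrite [cabs (_ * _ ^+ 2)]cabsM cabsX [cabs (_ * om)]cabsM cabsN cabs_natr.
    apply: ler_wpM2l; first by rewrite mulr_ge0 // ltW.
    by rewrite lerXn2r // ?nnegrE ?cabs_ge0 // divr_ge0 // ltW.
  rewrite cabsM [cabs (_ * om)]cabsM cabs_natr.
  by apply: ler_wpM2l => //; rewrite mulr_ge0 // ltW.
Qed.

Lemma koebe_arith (r x y k : R) : 0 < r -> 0 <= x -> k <= 2 * r * x ->
  r ^+ 2 * y <= 7040 * k -> r * y <= 15000 * x.
Proof.
move=> r0 x0 h2 h3; have h : r * (r * y) <= r * (15000 * x).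
  by have rx := mulr_ge0 (ltW r0) x0; rewrite expr2 in h3; lra.
by rewrite ler_pM2l in h.
Qed.

(** The supremum [dl] of the radii of discs about [F a] inside the image is comparable with r |F'
    a|. An omitted value at distance below (3/2) dl has half its distance below [dl] and so fits
    [koebe_estimates]; [w0] keeps [dl] finite. The constants 80 * 3/2 and 2 * 7040 are rounded
    up. *)
Theorem koebe F a (r : R) w0 : 0 < r -> hol (disc a r) F -> inj_on (disc a r) F ->
  (forall z, disc a r z -> F z != w0) ->
  [/\ disc (F a) (r * cabs ('D_1 F a) / 160) `<=` F @` disc a r,
      r * cabs ('D_1 F a) <= 160 * cabs (w0 - F a) &
      r * cabs ('D_1 (fun z => 'D_1 F z) a) <= 15000 * cabs ('D_1 F a)].
Proof.
move=> r0 hF iF nw; have oD := eopen_disc (c := a) (r := r).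
have aD : disc a r a by rewrite /disc /= subrr cabs0.
set S := [set d : R | 0 < d /\ disc (F a) d `<=` F @` disc a r].
have [m m0 hm] := open_mapping oD hF iF aD r0 (@subset_refl _ _).
have Sm : S m by split => // y /hm[z zr zy]; exists z.
have ubS : ubound S (cabs (w0 - F a)).
  move=> d [d0 hd]; rewrite leNgt; apply/negP => h.
  by have [z zr /eqP] := hd w0 h; apply/negP; exact: nw.
have hsup : has_sup S by split; [exists m|exists (cabs (w0 - F a))].
set dl := sup S.
have dl0 : 0 < dl by apply: lt_le_trans m0 _; apply: ub_le_sup => //; exists (cabs (w0 - F a)).
have cov y : cabs (y - F a) < dl -> (F @` disc a r) y.
  move=> h; have e0 : 0 < dl - cabs (y - F a) by rewrite subr_gt0.
  have [d [d0 hd] hd2] := sup_adherent e0 hsup.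
  by apply: hd; rewrite /disc /=; rewrite -/dl in hd2; lra.
have [w nwD wdl] : exists2 w, ~ (F @` disc a r) w & cabs (w - F a) < dl * (3 / 2).
  apply: contrapT => /forall2NP H.
  have : S (dl * (3 / 2)).
    split; first by lra.
    by move=> y hy; have [/contrapT//|] := H y.
  by move=> /(ub_le_sup (ex_intro _ _ ubS)); rewrite -/dl; lra.
have dw : dl <= cabs (w - F a).
  by rewrite leNgt; apply/negP => /cov.
have [|y hy|h1 h2 h3] := @koebe_estimates F a r w r0 hF iF.
- by move=> z zr; apply/eqP => E; apply: nwD; exists z.
- by apply: cov; lra.
have dw0 : dl <= cabs (w0 - F a).
  by rewrite leNgt; apply/negP => /cov [z zr] /eqP; apply/negP; exact: nw.
have d0 := cabs_ge0 ('D_1 F a).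
split.
- clear h3; move=> y hy; apply: cov; move: hy; rewrite /disc /=.
  by move: ('D_1 F a) h1 h2 d0 => x h1 h2 d0; lra.
- clear h3; move: ('D_1 F a) h1 h2 d0 => x h1 h2 d0; lra.
- exact: (koebe_arith r0 d0 h2 h3).
Qed.
End Koebe.

(** * Univalent maps of the right half-plane *)

Section HalfPlane.
Variable R : realType.
Local Notation C := R[i].
Local Notation H := (@Hright R).
Implicit Types (F g u : C -> C) (x y z w : C).

Lemma hull_halfplane (b : R) : hull_dom [set z : C | b < complex.Re z].
Proof.
split.
  move=> z /= hz; exists (complex.Re z - b); first by rewrite subr_gt0.
  move=> w hw; have := le_lt_trans (Re_le_cabs _) hw; rewrite ReD ReN ltr_norml; lra.
move=> x y z /= hx hy hz.
set m := Num.min (Num.min (complex.Re x) (complex.Re y)) (complex.Re z).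
exists [set w | m <= complex.Re w]; split.
- exact: kconvex_ge.
- by move=> w /= h; apply: lt_le_trans h; rewrite !lt_min hx hy hz.
- by split=> /=; rewrite !ge_min lexx ?orbT.
Qed.

Lemma disc_sub_H x (s : R) : s <= complex.Re x -> disc x s `<=` H.
Proof.
move=> sx w; rewrite /disc /Hright /= => hw.
by have := le_lt_trans (Re_le_cabs _) hw; rewrite ReD ReN ltr_norml; lra.
Qed.

Lemma inj_on_sub (U V : set C) F : V `<=` U -> inj_on U F -> inj_on V F.
Proof. by move=> VU iF z w /VU Uz /VU Uw; exact: iF. Qed.

(** Injectivity on the whole half-plane supplies the omitted value that [koebe] asks for. *)
Lemma omit_outside x (s : R) F : 0 < s -> s <= complex.Re x -> inj_on H F ->
  forall z, disc x s z -> F z != F (x + s%:C).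
Proof.
move=> s0 sx iF z zs; apply/eqP => E.
have Hz := disc_sub_H sx zs.
have Hw : H (x + s%:C) by rewrite /Hright /= ReD /=; lra.
have := iF _ _ Hz Hw E => zE; move: zs; rewrite /disc /= zE.
by rewrite addrAC subrr add0r cabs_real gtr0_norm // ltxx.
Qed.

Lemma univalent_cover F x (s : R) : hol H F -> inj_on H F -> 0 < s -> s <= complex.Re x ->
  disc (F x) (s * cabs ('D_1 F x) / 160) `<=` F @` disc x s.
Proof.
move=> hF iF s0 sx; have sub := disc_sub_H sx.
by have [] := koebe s0 (hol_sub sub hF) (inj_on_sub sub iF) (omit_outside s0 sx iF).
Qed.

(** The disc covered by Koebe consists of values taken inside [disc x s], so by injectivity no point
    outside can map into it. *)
Lemma univalent_sep F x y (s : R) : hol H F -> inj_on H F -> 0 < s -> s <= complex.Re x ->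
  H y -> s <= cabs (y - x) -> s * cabs ('D_1 F x) / 160 <= cabs (F y - F x).
Proof.
move=> hF iF s0 sx Hy sy; rewrite leNgt; apply/negP => h.
have [z zs zy] := univalent_cover hF iF s0 sx h.
have := iF _ _ (disc_sub_H sx zs) Hy zy => E; move: zs; rewrite /disc /= E; lra.
Qed.

Lemma half_plane_second_deriv F x : hol H F -> inj_on H F -> H x ->
  complex.Re x * cabs ('D_1 (fun z => 'D_1 F z) x) <= 15000 * cabs ('D_1 F x).
Proof.
move=> hF iF x0; have sub := disc_sub_H (lexx (complex.Re x)).
by have [] := koebe x0 (hol_sub sub hF) (inj_on_sub sub iF) (omit_outside x0 (lexx _) iF).
Qed.

(** Koebe bounds the derivative of log F' by 15000 / b on Re > b; integration along the segment
    gives the exponential. *)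
Lemma distortion F (b : R) x y : hol H F -> inj_on H F -> 0 < b ->
  b < complex.Re x -> b < complex.Re y ->
  cabs ('D_1 F x) <= expR (15000 / b * cabs (x - y)) * cabs ('D_1 F y).
Proof.
move=> hF iF b0 bx by_.
have nF z : H z -> 'D_1 F z != 0 by exact: (univalent_deriv_neq0 (@eopen_Hright R) hF iF).
have hF' := hol_deriv (@eopen_Hright R) hF.
have [l hl] := hol_log (hull_Hright R) hF' nF.
have bH z : b < complex.Re z -> H z by rewrite /Hright /=; lra.
have ml z : [set z | b < complex.Re z] z -> exists2 d, cder l z d & cabs d <= 15000 / b.
  move=> /= bz; have Hz := bH _ bz; eexists; first exact: (hl _ Hz).2.
  have h := half_plane_second_deriv hF iF Hz.
  rewrite cabsM cabsV ler_pdivrMr ?cabs_gt0 ?nF //.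
  rewrite mulrAC ler_pdivlMr // mulrC; apply: le_trans h.
  by apply: ler_wpM2r; [exact: cabs_ge0|exact: ltW].
have := mean_value_ineq (z := x) (w := y) (hull_halfplane b) ml bx by_.
rewrite (hl _ (bH _ bx)).1 (hl _ (bH _ by_)).1 !cabs_cexp -expRD ler_expR => h.
have := le_trans (Re_le_cabs _) h; rewrite ReD ReN ler_norml => /andP[_].
by rewrite lerBlDr.
Qed.

Lemma deriv_log_bound F x : hol H F -> inj_on H F -> (forall z, H z -> F z != 0) -> H x ->
  complex.Re x * cabs ('D_1 F x) <= 160 * cabs (F x).
Proof.
move=> hF iF nF x0; have sub := disc_sub_H (lexx (complex.Re x)).
have [_] := koebe (w0 := 0) x0 (hol_sub sub hF) (inj_on_sub sub iF) (fun z zs => nF z (sub z zs)).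
by rewrite sub0r cabsN.
Qed.

Lemma Re_div_gt0 z w : w != 0 ->
  0 < complex.Re z * complex.Re w + complex.Im z * complex.Im w -> 0 < complex.Re (z / w).
Proof.
move=> w0; have := divfK w0 z; move: (z / w) => q <-.
rewrite ReM ImM => h.
have : 0 < complex.Re q * cabs w ^+ 2.
  by rewrite sqr_cabs; move: h; congr (0 < _); ring.
by rewrite pmulr_lgt0 // exprn_gt0 // cabs_gt0.
Qed.

(* Schwarz's lemma between the discs obtained from the two half-planes by
   Cayley transforms centred at [x] and [u x]. *)
Lemma schwarz_pick u x : hol H u -> (forall z, H z -> H (u z)) -> H x ->
  complex.Re x * cabs ('D_1 u x) <= complex.Re (u x).
Proof.
move=> hu uH Hx; have Hw := uH _ Hx.
set xb : C := Complex (complex.Re x) (- complex.Im x).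
set wb : C := Complex (complex.Re (u x)) (- complex.Im (u x)).
pose m z := (x + xb * z) / (1 - z).
have n1 z : disc (0 : C) 1 z -> 1 - z != 0.
  by rewrite /disc /= subr0 subr_eq0 => h; apply: contraTneq h => <-; rewrite cabs1 ltxx.
have mH z : disc (0 : C) 1 z -> H (m z).
  move=> hz; apply: Re_div_gt0; first exact: n1.
  have : cabs z ^+ 2 < 1 by rewrite expr_lt1 ?cabs_ge0 //; move: hz; rewrite /disc /= subr0.
  rewrite sqr_cabs /xb !(ReD, ReM, ImD, ImM, ReN, ImN) /= => h.
  move: Hx; rewrite /Hright /=; set A := complex.Re x; set B := complex.Im x => A0.
  set p := complex.Re z in h *; set q := complex.Im z in h *.
  have -> : (A + (A * p - - B * q)) * (1 - p) + (B + (A * q + - B * p)) * (0 - q) = A * (1 - (p ^+ 2 + q ^+ 2)) by ring.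
  by rewrite mulr_gt0 // subr_gt0.
have nT w : H w -> w + wb != 0.
  move=> hw; rewrite -cabs_gt0; apply: lt_le_trans (Re_le_cabs _).
  by move: Hw hw; rewrite /Hright /= ReD /= => h1 h2; rewrite gtr0_norm; lra.
pose T w := (w - u x) / (w + wb).
have hm : hol (disc 0 1) m.
  apply: holM; first by apply: holD; [exact: hol_cst|apply: holZ; exact: hol_id].
  by apply: holV n1 _; apply: holB; [exact: hol_cst|exact: hol_id].
have hT : hol H T.
  apply: holM; first by apply: holB; [exact: hol_id|exact: hol_cst].
  by apply: holV nT _; apply: holD; [exact: hol_id|exact: hol_cst].
have h0 : disc (0 : C) 1 0 by rewrite /disc /= subrr cabs0.
have m0 : m 0 = x by rewrite /m mulr0 addr0 subr0 divr1.
have hum : hol (disc 0 1) (fun z => u (m z)) by apply: hol_comp hu hm mH.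
have hTum : hol (disc 0 1) (fun z => T (u (m z))).
  by apply: (hol_comp hT hum) => z /mH /uH.
have T0 : T (u (m 0)) = 0 by rewrite m0 /T subrr mul0r.
have bT z : disc (0 : C) 1 z -> cabs (T (u (m z))) <= 1.
  move=> /mH /uH; set w := u (m z) => hw.
  rewrite /T cabsM cabsV ler_pdivrMr ?cabs_gt0 ?nT // mul1r.
  rewrite -(ler_sqr (x := cabs _)) ?nnegrE ?cabs_ge0 // !sqr_cabs !(ReD, ImD, ReN, ImN) /=.
  by move: hw Hw; rewrite /Hright /=; nra.
have [+ _] := schwarz ltr01 hTum T0 bT.
have wwb : u x + wb = (2 * complex.Re (u x))%:C.
  by apply/eqP; rewrite eq_complex; apply/andP; split; apply/eqP; rewrite /wb !(ReD, ImD) /=; ring.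
have xxb : x + xb = (2 * complex.Re x)%:C.
  by apply/eqP; rewrite eq_complex; apply/andP; split; apply/eqP; rewrite /xb !(ReD, ImD) /=; ring.
have dm : cder m 0 (x + xb).
  have a1 := gderD (gder_cst id x 0) (gderZ xb (gder_id id 0)).
  have a2 := gderB (gder_cst id (1 : C) (0 : C)) (gder_id id (0 : C)).
  have n0 : (1 : C) - 0 != 0 by exact: n1.
  have := gderM a1 (@gderV R C id (fun z => 1 - z) 0 _ n0 a2).
  by congr gder; rewrite subr0 expr1n !divr1; ring.
have dT : cder T (u x) (u x + wb)^-1.
  have a1 := gderB (gder_id id (u x)) (gder_cst id (u x) (u x)).
  have a2 := gderD (gder_id id (u x)) (gder_cst id wb (u x)).
  have := gderM a1 (@gderV R C id (fun w => w + wb) (u x) _ (nT _ Hw) a2).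
  by congr gder; rewrite /= subrr mul0r addr0 subr0 mul1r.
have dum : cder (fun z => u (m z)) 0 ('D_1 u x * (x + xb)).
  apply: (@gder_comp R C id u m 0) => //; rewrite m0; exact: (hol_cder hu Hx).
have dTum : cder (fun z => T (u (m z))) 0 ((u x + wb)^-1 * ('D_1 u x * (x + xb))).
  by apply: (@gder_comp R C id T (fun z => u (m z)) 0) => //; rewrite m0.
rewrite (cder_val dTum) divr1 wwb xxb 2!cabsM cabsV !cabs_real.
move: Hx Hw; rewrite /Hright /= => Hx Hw.
rewrite !gtr0_norm ?mulr_gt0 // mulrC ler_pdivrMr ?mulr_gt0 // mul1r.
by move: (cabs ('D_1 u x)) => k; lra.
Qed.
End HalfPlane.

(** * Logarithmic coordinates *)

(* In logarithmic coordinates the inverse branches of [f] on the exterior disc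
   are the maps [xi |-> u j (xi + 2 pi i k)], where [u j] is a logarithm of the
   inverse [phi j] of [tau j]; all their compositions are defined on the whole
   right half-plane. *)
Section LogarithmicBranches.
Variables (R : realType) (N : nat) (u : 'I_N -> R[i] -> R[i]) (a : R).
Local Notation C := R[i].
Local Notation H := (@Hright R).
(** The last clause packs disjointness of the tracts and injectivity of the inverse maps into one
    condition on exponentials; [a] records that the tracts stay away from the unit disc. *)
Definition log_branches := [/\ 0 < a, forall j, hol H (u j),
  (forall j x, H x -> a < complex.Re (u j x)) &
  forall j j' x x', H x -> H x' -> cexp (u j x) = cexp (u j' x') -> j = j' /\ x = x'].
Definition letter := ('I_N * int)%type.
Implicit Types (i : letter) (s : seq letter) (x y : C).

Definition shift (k : int) x : C := x + k%:~R * tpi R.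
Definition gm i x := u i.1 (shift i.2 x).
Definition dgm i x := 'D_1 (u i.1) (shift i.2 x).
(** The head of the word is applied first: it is the innermost branch, and the forward orbit of
    [cexp (wmap s x)] undoes the letters from the last one back. *)
Fixpoint wmap s x := if s is i :: t then wmap t (gm i x) else x.
Fixpoint wder s x := if s is i :: t then wder t (gm i x) * dgm i x else 1.

Lemma Re_shift k x : complex.Re (shift k x) = complex.Re x.
Proof. by rewrite /shift ReD Re_int_tpi addr0. Qed.
Lemma cexp_shift k x : cexp (shift k x) = cexp x.
Proof. by rewrite /shift cexpD cexp_int_tpi mulr1. Qed.
Lemma shift_H k x : H x -> H (shift k x).
Proof. by rewrite /Hright /= Re_shift. Qed.
Lemma cder_shift k x : cder (shift k) x 1.
Proof. by have := gderD (gder_id id x) (gder_cst id (k%:~R * tpi R) x); rewrite addr0. Qed.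
Lemma wmap_rcons s i x : wmap (rcons s i) x = gm i (wmap s x).
Proof. by elim: s x => //= j s IH x; rewrite IH. Qed.
Lemma wder_rcons s i x : wder (rcons s i) x = dgm i (wmap s x) * wder s x.
Proof. by elim: s x => [|j s IH] x /=; rewrite ?mulr1 ?mul1r // IH mulrA. Qed.
Lemma wder_cat s t x : wder (s ++ t) x = wder t (wmap s x) * wder s x.
Proof. by elim: s x => [|j s IH] x /=; rewrite ?mulr1 // IH mulrA. Qed.

Hypothesis hyp : log_branches.
Let a0 : 0 < a. Proof. by case: hyp. Qed.
Let hu j : hol H (u j). Proof. by case: hyp => _ h _ _; exact: h. Qed.
Let ua j x : H x -> a < complex.Re (u j x). Proof. by case: hyp => _ _ h _; exact: h. Qed.
Let uE j j' x x' : H x -> H x' -> cexp (u j x) = cexp (u j' x') -> j = j' /\ x = x'.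
Proof. by case: hyp => _ _ _ h; exact: h. Qed.

(* [160 / (160 + a)] balances the two bounds on [Re x * |g' x|]: Koebe's [160],
   and Schwarz--Pick's [Re (g x) - a]. *)
Definition kap : R := 160 / (160 + a).
Lemma kap01 : 0 < kap < 1.
Proof.
have h := a0; have d0 : 0 < 160 + a by lra.
by apply/andP; split; [apply: divr_gt0; lra|rewrite ltr_pdivrMr //; lra].
Qed.

Lemma gm_gt i x : H x -> a < complex.Re (gm i x).
Proof. by move=> Hx; apply: ua; exact: shift_H. Qed.
Lemma gm_H i x : H x -> H (gm i x).
Proof. by move=> /(gm_gt i); exact: lt_trans. Qed.
Lemma inj_u j : inj_on H (u j).
Proof. by move=> x y Hx Hy E; have [] := uE Hx Hy (congr1 (@cexp R) E). Qed.
Lemma cder_gm i x : H x -> cder (gm i) x (dgm i x).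
Proof.
move=> Hx; have := @gder_comp R C id (u i.1) (shift i.2) x 1 _ (hol_cder (hu i.1) (shift_H i.2 Hx)) (cder_shift i.2 x).
by rewrite mulr1.
Qed.
Lemma dgm_neq0 i x : H x -> dgm i x != 0.
Proof.
by move=> Hx; exact: (univalent_deriv_neq0 (@eopen_Hright R) (hu i.1) (@inj_u i.1) (shift_H i.2 Hx)).
Qed.
Lemma dgm_log i x : H x -> complex.Re x * cabs (dgm i x) <= 160.
Proof.
move=> Hx; have Hs := shift_H i.2 Hx.
have h1 : hol H (fun z => cexp (u i.1 z)) by apply: hol_cexp.
have h2 : inj_on H (fun z => cexp (u i.1 z)) by move=> y z Hy Hz /(uE Hy Hz)[].
have := deriv_log_bound h1 h2 (fun z _ => cexp_neq0 (u i.1 z)) Hs.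
rewrite (cder_val (gder_cexp (hol_cder (hu i.1) Hs))) cabsM Re_shift mulrCA mulrC.
by rewrite ler_pM2r // cabs_gt0 cexp_neq0.
Qed.
Lemma dgm_pick i x : H x -> complex.Re x * cabs (dgm i x) <= complex.Re (gm i x) - a.
Proof.
move=> Hx; have Hs := shift_H i.2 Hx.
have dv z : H z -> cder (fun z => u i.1 z - a%:C) z ('D_1 (u i.1) z).
  by move=> Hz; have := gderB (hol_cder (hu i.1) Hz) (gder_cst id a%:C z); rewrite subr0.
have h1 : hol H (fun z => u i.1 z - a%:C) by move=> z /dv; exists ('D_1 (u i.1) z).
have h2 z : H z -> H (u i.1 z - a%:C).
  by move=> /(ua i.1); rewrite /Hright /= ReD ReN /= subr_gt0.
have := schwarz_pick h1 h2 Hs.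
by rewrite (cder_val (dv _ Hs)) Re_shift ReD ReN.
Qed.
Lemma dgm_contr i x : H x -> complex.Re x * cabs (dgm i x) <= kap * complex.Re (gm i x).
Proof.
move=> Hx; have h1 := dgm_log i Hx; have h2 := dgm_pick i Hx; have h3 := gm_gt i Hx.
have h := a0; have d0 : 0 < 160 + a by lra.
move: h1 h2 h3; move: (complex.Re x * cabs (dgm i x)) (complex.Re (gm i x)) => X Y h1 h2 h3.
have -> : kap * Y = 160 * Y / (160 + a) by rewrite /kap; ring.
rewrite ler_pdivlMr //.
have [Y1|Y1] := leP (160 + a) Y.
  have : X * (160 + a) <= 160 * (160 + a) by apply: ler_wpM2r => //; exact: ltW.
  by lra.
have : X * (160 + a) <= (Y - a) * (160 + a) by apply: ler_wpM2r => //; exact: ltW.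
have : a * Y <= a * (160 + a) by apply: ler_wpM2l => //; exact: ltW.
lra.
Qed.

Lemma wmap_H s x : H x -> H (wmap s x).
Proof. by elim: s x => //= i s IH x Hx; apply: IH; exact: gm_H. Qed.
Lemma wmap_gt s x : s != [::] -> H x -> a < complex.Re (wmap s x).
Proof.
case/lastP: s => // s i _ Hx; rewrite wmap_rcons; apply: gm_gt; exact: wmap_H.
Qed.
Lemma cder_wmap s x : H x -> cder (wmap s) x (wder s x).
Proof.
elim: s x => [|i s IH] x Hx; first exact: gder_id.
exact: (@gder_comp R C id (wmap s) (gm i) x _ _ (IH _ (gm_H i Hx)) (cder_gm i Hx)).
Qed.
Lemma hol_wmap s : hol H (wmap s).
Proof. by move=> x /(cder_wmap s); exists (wder s x). Qed.
Lemma wder_neq0 s x : H x -> wder s x != 0.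
Proof.
elim: s x => [|i s IH] x Hx /=; first exact: oner_neq0.
by rewrite mulf_neq0 ?dgm_neq0 // IH //; exact: gm_H.
Qed.
Lemma wder_gt0 s x : H x -> 0 < cabs (wder s x).
Proof. by move=> Hx; rewrite cabs_gt0 wder_neq0. Qed.
Lemma gm_inj i : inj_on H (gm i).
Proof. by move=> x y Hx Hy /(inj_u (shift_H _ Hx) (shift_H _ Hy)) /addIr. Qed.
Lemma wmap_inj s : inj_on H (wmap s).
Proof.
elim: s => //= i s IH x y Hx Hy /(IH _ _ (gm_H i Hx) (gm_H i Hy)).
exact: gm_inj.
Qed.
(** Re x |g' x| / Re (g x) is the derivative in the hyperbolic metric of the half-plane: it is
    multiplicative under composition, and each letter contributes at most [kap]. *)
Lemma wder_contr s x : H x -> complex.Re x * cabs (wder s x) <= kap ^+ size s * complex.Re (wmap s x).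
Proof.
move=> Hx; elim/last_ind: s => [|s i IH]; first by rewrite /= cabs1 mulr1 mul1r.
have Hy := wmap_H s Hx; rewrite wder_rcons wmap_rcons size_rcons cabsM.
have h1 := dgm_contr i Hy; have /andP[k0 k1] := kap01.
have y0 : 0 < complex.Re (wmap s x) by exact: Hy.
rewrite -(ler_pM2l y0); apply: (@le_trans _ _ (kap ^+ size s * complex.Re (wmap s x) * (kap * complex.Re (gm i (wmap s x))))).
  have -> : complex.Re (wmap s x) * (complex.Re x * (cabs (dgm i (wmap s x)) * cabs (wder s x))) =
     (complex.Re x * cabs (wder s x)) * (complex.Re (wmap s x) * cabs (dgm i (wmap s x))) by ring.
  by apply: ler_pM => //; rewrite mulr_ge0 ?cabs_ge0 // ltW.
by rewrite exprS le_eqVlt; apply/orP; left; apply/eqP; ring.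
Qed.
(** The outermost letter is estimated by Koebe's 160 instead of [kap]. This loses one power of [kap]
    but removes the real part of [wmap s x], which has no upper bound. *)
Lemma wder_log s x : s != [::] -> H x -> complex.Re x * cabs (wder s x) <= 160 * kap ^+ (size s).-1.
Proof.
case/lastP: s => // s i _ Hx; have Hy := wmap_H s Hx.
have y0 : 0 < complex.Re (wmap s x) by exact: Hy.
rewrite wder_rcons size_rcons /= cabsM -(ler_pM2l y0).
apply: (@le_trans _ _ (kap ^+ size s * complex.Re (wmap s x) * 160)); last first.
  by rewrite le_eqVlt; apply/orP; left; apply/eqP; ring.
have -> : complex.Re (wmap s x) * (complex.Re x * (cabs (dgm i (wmap s x)) * cabs (wder s x))) =
   (complex.Re x * cabs (wder s x)) * (complex.Re (wmap s x) * cabs (dgm i (wmap s x))) by ring.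
have Hx' : 0 <= complex.Re x by exact: ltW.
apply: ler_pM; rewrite ?mulr_ge0 ?cabs_ge0 ?(ltW y0) //; [exact: wder_contr|exact: dgm_log].
Qed.
Lemma wder_distortion s (b : R) x y : 0 < b -> b < complex.Re x -> b < complex.Re y ->
  cabs (wder s x) <= expR (15000 / b * cabs (x - y)) * cabs (wder s y).
Proof.
move=> b0 bx by_; have := distortion (@hol_wmap s) (@wmap_inj s) b0 bx by_.
have Hx : H x by exact: lt_trans bx.
have Hy : H y by exact: lt_trans by_.
by rewrite (cder_val (cder_wmap s Hx)) (cder_val (cder_wmap s Hy)).
Qed.

(** Letters are peeled off from the outermost inwards. Each step recovers the tract and leaves an
    equality modulo 2 pi i, so the integers are determined only once the base points agree. *)
Lemma word_unique s s' x x' : size s = size s' -> H x -> H x' ->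
  cexp (wmap s x) = cexp (wmap s' x') -> cexp x = cexp x' /\ (x = x' -> s = s').
Proof.
move=> + Hx Hx'; elim/last_ind: s s' => [|s i IH] s'.
  by case: s' => // _ /= ->.
case/lastP: s' => [|s' i']; rewrite !size_rcons // => -[ss].
rewrite !wmap_rcons => /(uE (shift_H _ (wmap_H s Hx)) (shift_H _ (wmap_H s' Hx')))[e1 e2].
have [|h1 h2] := IH s' ss; first by rewrite -(cexp_shift i.2 (wmap s x)) e2 cexp_shift.
split=> // xx; have E := h2 xx; move: e2; rewrite E xx => /addrI /(mulIf (tpi_neq0 R)).
move=> /intr_inj e2; congr rcons.
by case: i i' e1 e2 => [? ?] [? ?] /= -> ->.
Qed.
Lemma word_unique_strip s s' x x' : size s = size s' -> H x -> H x' ->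
  `|complex.Im x - complex.Im x'| < 2 * pi ->
  cexp (wmap s x) = cexp (wmap s' x') -> s = s' /\ x = x'.
Proof.
move=> ss Hx Hx' d /(word_unique ss Hx Hx')[/cexp_inj_period[k xk] h].
suff k0 : x = x' by split => //; exact: h.
move: d; rewrite xk ImD Im_int_tpi addrAC subrr add0r normrM.
have p0 := pi_gt0 R; have p2 : 0 < 2 * pi :> R by rewrite mulr_gt0.
rewrite (ger0_norm (ltW p2)) -[X in _ < X]mul1r ltr_pM2r // -intr_norm -[1]/(1%:~R) ltr_int.
move=> hk; have k0 : k = 0 by lia.
by rewrite k0 mulr0z mul0r addr0.
Qed.
End LogarithmicBranches.

(** * Logarithms of the inverse tract maps *)

Section TractCoordinates.
Variable R : realType.
Local Notation C := R[i].
Local Notation H := (@Hright R).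

Lemma closureP (A : set C) (p : C) : closure A p <->
  forall r : R, 0 < r -> exists2 w, A w & cabs (w - p) < r.
Proof.
split=> [h r r0|h B /nbhsP[r r0 hr]].
  have [|w [Aw wr]] := h [set w | cabs (w - p) < r]; last by exists w.
  by apply/nbhsP; exists r.
by have [w Aw wr] := h r r0; exists w; split => //; exact: hr.
Qed.

Lemma closure_Dunit (p : C) : cabs p <= 1 -> closure (@Dunit R) p.
Proof.
move=> p1; apply/closureP => r r0; set e : R := Num.min (r / 2) 2^-1.
have e0 : 0 < e by rewrite lt_min; apply/andP; split; lra.
have [e1 e2] : e <= r / 2 /\ e <= 2^-1.
  by split; rewrite /e ge_min lexx ?orbT.
have p0 := cabs_ge0 p.
exists ((1 - e)%:C * p).
  rewrite /Dunit /= cabsM cabs_real ger0_norm; last by lra.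
  by apply: (@le_lt_trans _ _ (1 - e)); [apply: ler_piMr; lra|lra].
have -> : (1 - e)%:C * p - p = - (e%:C * p) by rewrite rmorphB rmorph1; ring.
rewrite cabsN cabsM cabs_real ger0_norm; last by lra.
by apply: (@le_lt_trans _ _ e); [apply: ler_piMr; lra|lra].
Qed.

(** [Om] may be unbounded, so compactness is used on the unit circle: the distance to [Om] has a
    positive minimum there, and a point of [Om] lies at distance |z| - 1 from its radial
    projection. *)
Lemma far_from_disc (Om : set C) : closure Om `&` closure (@Dunit R) = set0 ->
  exists2 rho : R, 1 < rho & forall z, Om z -> rho <= cabs z.
Proof.
move=> dis; have [[w0 Ow0]|/forallNP nO] := pselect (exists w, Om w); last first.
  by exists 2; [lra|move=> z /nO].
have nc p : cabs p <= 1 -> exists2 r : R, 0 < r & forall w, Om w -> r <= cabs (p - w).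
  move=> /closure_Dunit hp; apply: contrapT => /forall2NP h.
  suff : (closure Om `&` closure (@Dunit R)) p by rewrite dis.
  split => //; apply/closureP => r r0; have [//|/existsNP[w /not_implyP[Ow hw]]] := h r.
  by exists w => //; rewrite cabsC; move/negP: hw; rewrite -ltNge.
pose D p := [set cabs (p - w) | w in Om].
have Dlb p : has_inf (D p).
  by split; [exists (cabs (p - w0)); exists w0|exists 0 => _ [w _ <-]; exact: cabs_ge0].
pose d p := inf (D p).
have dle p w : Om w -> d p <= cabs (p - w).
  by move=> Ow; apply: ge_inf; [exact: (Dlb p).2|exists w].
have dge p (r : R) : (forall w, Om w -> r <= cabs (p - w)) -> r <= d p.
  by move=> h; apply: lb_le_inf; [exact: (Dlb p).1|move=> _ [w Ow <-]; exact: h].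
have dlip p q : d p <= d q + cabs (p - q).
  rewrite -lerBlDr; apply: dge => w Ow; rewrite lerBlDr.
  by have := dle p w Ow; have := cabsB_tri p q w; lra.
have [|c _ hc] := @EVT_min R (fun t => d (circ 0 1 t)) 0 1 ler01.
  apply: continuous_subspaceT => t; apply/continuous_eps => e e0.
  have [r r0 hr] := gder_cont (pder_circ 0 1 t) e0; exists r => // s.
  rewrite -cabs_rB => /hr h; have := dlip (circ 0 1 t) (circ 0 1 s).
  have := dlip (circ 0 1 s) (circ 0 1 t); rewrite [cabs (circ 0 1 t - _)]cabsC.
  by rewrite ltr_norml; lra.
have ci t : cabs (circ (0 : C) 1 t) = 1.
  by rewrite -[circ _ _ _]subr0 cabs_circ.
have [r r0 hr] := nc (circ 0 1 c) ltac:(by rewrite ci).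
have dc : 0 < d (circ 0 1 c) by apply: lt_le_trans (dge _ _ hr).
exists (1 + d (circ 0 1 c)); first by rewrite ltrDl.
move=> z Oz; rewrite leNgt; apply/negP => hz.
have z1 : 1 < cabs z.
  rewrite ltNge; apply/negP => h; have [k k0 /(_ z Oz)] := nc z h.
  by rewrite subrr cabs0; lra.
have zp : 0 < cabs z by lra.
have [|t t01 qE] := @circ_param R 0 1 (z / (cabs z)%:C) ltr01.
  by rewrite subr0 cabsM cabsV cabs_real gtr0_norm // divff // gt_eqF.
have := hc t; rewrite in_itv /= => /(_ t01); rewrite -qE.
have := dle (z / (cabs z)%:C) z Oz.
have -> : z / (cabs z)%:C - z = (z / (cabs z)%:C) * (1 - cabs z)%:C.
  rewrite rmorphB rmorph1 mulrBr mulr1 divfK // -cabs_gt0 cabs_real gtr0_norm //.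
rewrite cabsM cabsM cabsV !cabs_real [`|cabs z|]gtr0_norm // divff ?gt_eqF // mul1r.
by rewrite ltr0_norm; lra.
Qed.

Variables (f : C -> C) (entire : bool) (N : nat).
Variables (Om : 'I_N -> set C) (tau phi : 'I_N -> C -> C).
Hypothesis hD : classD f entire Om tau phi.

Lemma tau_hol j : eopen (Om j) /\ hol (Om j) (tau j).
Proof.
case: hD => ho _ ht _ _; have [/openP oj _] := ho j; split; first exact: oj.
by have [[_ dt] _] := ht j; move=> z /dt /cder_derivable; exists ('D_1 (tau j) z).
Qed.
Lemma tau_inj j : inj_on (Om j) (tau j).
Proof.
case: hD => _ _ ht _ _; have [_ [[_ ti _] _]] := ht j.
by move=> z w Oz Ow; apply: ti; rewrite inE.
Qed.
Lemma phi_right j x : H x -> Om j (phi j x) /\ tau j (phi j x) = x.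
Proof. by case: hD => _ _ ht _ _; have [_ [_ h]] := ht j; exact: h. Qed.
Lemma tau_image j z : Om j z -> H (tau j z).
Proof. by case: hD => _ _ ht _ _; have [_ [[h _ _] _]] := ht j; exact: h. Qed.
Lemma phi_tau j z : Om j z -> phi j (tau j z) = z.
Proof.
by move=> Oz; have [h1 h2] := phi_right j (tau_image Oz); exact: tau_inj h1 Oz h2.
Qed.
Lemma fE j z : Om j z -> f z = cexp (tau j z).
Proof. by case: hD => _ _ _ [h _] _; exact: h. Qed.
Lemma Om_disj j j' z : Om j z -> Om j' z -> j = j'.
Proof.
case: hD => _ hd _ _ _ h1 h2; apply/eqP; apply: contraT => /hd E.
by suff : (Om j `&` Om j') z; [rewrite E|].
Qed.
Lemma cder_phi j z : Om j z -> cder (phi j) (tau j z) ('D_1 (tau j) z)^-1.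
Proof.
move=> Oz; have [oj hj] := tau_hol j.
apply: (inverse_hol oj hj (@tau_inj j) _ Oz) => _ [w Ow <-].
exact: phi_right (tau_image Ow).
Qed.
Lemma dtau_neq0 j z : Om j z -> 'D_1 (tau j) z != 0.
Proof.
by move=> Oz; have [oj hj] := tau_hol j; exact: (univalent_deriv_neq0 oj hj (@tau_inj j) Oz).
Qed.
Lemma hol_phi j : hol H (phi j).
Proof.
by move=> x Hx; have [h1 h2] := phi_right j Hx; have := cder_phi h1; rewrite h2; eexists; eassumption.
Qed.

Lemma log_coordinates : exists a, exists u : 'I_N -> C -> C,
  [/\ log_branches u a, forall j x, H x -> phi j x = cexp (u j x) &
   forall j z, Om j z -> expR a <= cabs z].
Proof.
have [rho r1 hrho] : exists2 rho : R, 1 < rho & forall j z, Om j z -> rho <= cabs z.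
  case: hD => _ _ _ [_ /far_from_disc[rho r1 h]] _; exists rho => // j z Oz.
  by apply: h; exists j.
have r0 : 0 < rho by lra.
have phi_lb j x : H x -> rho <= cabs (phi j x).
  by move=> Hx; apply: hrho; exact: (phi_right j Hx).1.
have ex j : exists l, forall x, H x -> phi j x = cexp (l x) /\ cder l x ('D_1 (phi j) x / phi j x).
  apply: hol_log; [exact: hull_Hright|exact: hol_phi|].
  by move=> x /(phi_lb j) h; rewrite -cabs_gt0; lra.
have [u hu] := choice ex.
have lr : 0 < ln rho by rewrite ln_gt0.
(* Half of [ln rho], because [log_branches] wants a strict inequality for the real parts. *)
exists (ln rho / 2), u; split; last 2 first.
- by move=> j x /(hu j)[].
- move=> j z /hrho; apply: le_trans; rewrite -[leRHS]lnK ?posrE // ler_expR; lra.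
split.
- by rewrite divr_gt0.
- by move=> j x /(hu j)[_ h]; eexists; exact: h.
- move=> j x Hx; have := phi_lb j x Hx; rewrite (hu j x Hx).1 cabs_cexp.
  by rewrite -{1}[rho]lnK ?posrE // ler_expR; lra.
- move=> j j' x x' Hx Hx'; rewrite -(hu j x Hx).1 -(hu j' x' Hx').1 => E.
  have [h1 h2] := phi_right j Hx; have [h3 h4] := phi_right j' Hx'.
  have jj : j = j' by apply: (@Om_disj _ _ (phi j x)) => //; rewrite E.
  by split => //; rewrite -h2 -h4 E jj.
Qed.
End TractCoordinates.

(** * The iterated transfer operator as a sum over words *)

Section TransferSums.
Variable R : realType.
Local Notation C := R[i].
Local Notation H := (@Hright R).
Variables (f : C -> C) (entire : bool) (N : nat).
Variables (Om : 'I_N -> set C) (tau phi : 'I_N -> C -> C).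
Variables (a : R) (u : 'I_N -> C -> C).
Hypotheses (hD : classD f entire Om tau phi) (hL : log_branches u a).
Hypothesis phiE : forall j x, H x -> phi j x = cexp (u j x).

Lemma esumZl (T : choiceType) (S : set T) (b : T -> \bar R) (r : R) : 0 <= r ->
  (forall i, 0%E <= b i)%E ->
  (\esum_(i in S) (r%:E * b i) = r%:E * \esum_(i in S) b i)%E.
Proof.
move=> r0 b0; rewrite le_eqVlt in r0; case/orP: r0 => [/eqP <-|r0].
  by rewrite mul0e esum1 // => i _; rewrite mul0e.
rewrite /esum -ereal_sup_pZl //; congr ereal_sup; apply/seteqP; split.
- move=> _ [X hX <-]; exists (\sum_(x \in X) b x)%E; first by exists X.
  by rewrite ge0_mule_fsumr.
- by move=> _ [_ [X hX <-] <-]; exists X => //; rewrite ge0_mule_fsumr.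
Qed.

Lemma gm_phi (i : letter N) x : H x -> cexp (gm u i x) = phi i.1 (shift i.2 x).
Proof. by move=> Hx; rewrite phiE //; exact: shift_H. Qed.

Lemma tract_letter j z x : Om j z -> f z = cexp x -> exists i : letter N, z = cexp (gm u i x) /\ H x.
Proof.
move=> Oz; rewrite (fE hD Oz) => /cexp_inj_period[k kE].
have Ht := tau_image hD Oz.
have Hx : H x by move: Ht; rewrite /Hright /= kE ReD Re_int_tpi addr0.
by exists (j, k); rewrite gm_phi //= /shift -kE (phi_tau hD Oz).
Qed.
Lemma gm_tract (i : letter N) x : H x -> Om i.1 (cexp (gm u i x)) /\ f (cexp (gm u i x)) = cexp x.
Proof.
move=> Hx; rewrite gm_phi //; have [h1 h2] := phi_right hD i.1 (shift_H i.2 Hx).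
by rewrite (fE hD h1) h2 cexp_shift.
Qed.

Lemma abs1_arith (F A B T : R) : F != 0 -> 0 < T -> A * B = T^-1 -> F * T * B / F = A^-1.
Proof.
move=> F0 t0 E; have T0 : T != 0 by rewrite gt_eqF.
have A0 : A != 0.
  by apply/eqP => A0; move: E; rewrite A0 mul0r => /esym/eqP; rewrite invr_eq0 gt_eqF.
apply: (mulfI A0); rewrite divff //.
by have -> : A * (F * T * B / F) = A * B * T; [field|rewrite E mulVf].
Qed.

(** In the coordinate z = exp x the quantity |f'| |z| / |f| is the modulus of the derivative of the
    lifted map, hence the inverse of that of the branch. *)
Lemma abs1_gm (i : letter N) x : H x -> abs1_deriv f (cexp (gm u i x)) = (cabs (dgm u i x))^-1.
Proof.
move=> Hx; have [Oz fz] := gm_tract i Hx; have Hs := shift_H i.2 Hx.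
have tE : tau i.1 (cexp (gm u i x)) = shift i.2 x.
  by rewrite gm_phi //; exact: (phi_right hD i.1 Hs).2.
set z := cexp _ in Oz fz tE *.
have [oj hj] := tau_hol hD i.1.
have df : 'D_1 f z = f z * 'D_1 (tau i.1) z.
  apply: cder_val; have [r r0 hr] := oj _ Oz.
  have := gder_cexp (hol_cder hj Oz); rewrite -(fE hD Oz).
  by apply: gder_ext r0 _ => w /hr /(fE hD) ->.
have f0 : f z != 0 by rewrite fz cexp_neq0.
have du : cabs (dgm u i x) * cabs z = (cabs ('D_1 (tau i.1) z))^-1.
  have d1 := cder_phi hD Oz; rewrite tE in d1.
  have hu : hol H (u i.1) by case: hL.
  have d2 := gder_cexp (hol_cder hu Hs).
  have [r r0 hr] := @eopen_Hright R _ Hs.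
  have d3 : cder (phi i.1) (shift i.2 x) (cexp (u i.1 (shift i.2 x)) * 'D_1 (u i.1) (shift i.2 x)).
    by apply: gder_ext r0 _ d2 => w /hr /phiE ->.
  by rewrite -cabsV (cder_uniq d1 d3) cabsM mulrC.
have t0 : 0 < cabs ('D_1 (tau i.1) z) by rewrite cabs_gt0 (dtau_neq0 hD).
rewrite /abs1_deriv df cabsM; apply: abs1_arith t0 du.
by rewrite cabs_eq0.
Qed.

Lemma fiber_bij x : H x ->
  set_bij [set: letter N] [set z | fdom entire Om z /\ f z = cexp x] (fun i => cexp (gm u i x)).
Proof.
move=> Hx; split.
- move=> i _ /=; have [h1 h2] := gm_tract i Hx; split => //.
  by rewrite /fdom; case: (entire) => //; exists i.1.
- move=> i i' _ _ E; have [_ _ _ uE] := hL.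
  have [e1 e2] := uE _ _ _ _ (shift_H i.2 Hx) (shift_H i'.2 Hx) E.
  move: e2 => /addrI /(mulIf (tpi_neq0 R)) /intr_inj e2.
  by case: i i' e1 e2 {E} => [? ?] [? ?] /= -> ->.
(* For an entire [f] the fibre is taken in the whole plane, but its points satisfy |f z| > 1 and
   therefore lie in tracts. *)
- move=> z [dz fz]; have [j Oz] : exists j, Om j z.
    case: hD => _ _ _ _ [_]; move: dz; rewrite /fdom; case: (entire) => [_ [_ _ _ h]|[j _ Oz] _].
      apply: h; rewrite /preimage /Dext /= fz cabs_cexp.
      by rewrite -expR0 ltr_expR; exact: Hx.
    by exists j.
  by have [i [iE _]] := tract_letter Oz fz; exists i.
Qed.

Definition words n : set (seq (letter N)) := [set s | size s = n].
Lemma transfer_words (t : R) (G : C -> \bar R) n x : (forall z, 0 <= G z)%E -> H x ->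
  iter n (transfer f (fdom entire Om) t) G (cexp x) =
  (\esum_(s in words n) ((cabs (wder u s x) `^ t)%:E * G (cexp (wmap u s x))))%E.
Proof.
move=> G0; elim: n x => [|n IH] x Hx.
  have -> : words 0 = [set [::]] by apply/seteqP; split => [[]|_ ->].
  by rewrite esum_set1 /= cabs1 powR1 mul1e.
rewrite iterS /transfer (reindex_esum _ _ _ _ (fiber_bij Hx)).
have E1 i : ((abs1_deriv f (cexp (gm u i x)) `^ (- t))%:E *
    iter n (transfer f (fdom entire Om) t) G (cexp (gm u i x)) =
    \esum_(s in words n) ((cabs (dgm u i x) `^ t)%:E * ((cabs (wder u s (gm u i x)) `^ t)%:E * G (cexp (wmap u s (gm u i x))))))%E.
  rewrite abs1_gm // -powR_inv1 ?cabs_ge0 // -powRrM mulrNN mul1r.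
  rewrite esumZl ?powR_ge0 //; last by move=> s; rewrite mule_ge0 ?lee_fin ?powR_ge0.
  by rewrite -IH //; exact: (gm_H hL).
rewrite (eq_esum (fun i _ => E1 i)) esum_esum; last first.
  by move=> i s _ _; rewrite !mule_ge0 ?lee_fin ?powR_ge0.
have B : set_bij ([set: letter N] `*`` (fun=> words n)) (words n.+1)
    (fun k : letter N * seq (letter N) => k.1 :: k.2).
  split.
  - by move=> [i s] /= [_ h]; rewrite /words /= h.
  - by move=> [i s] [i' s'] _ _ /= [-> ->].
  - by move=> [|i s] //= [h]; exists (i, s).
rewrite (reindex_esum _ _ _ _ B); apply: eq_esum => -[i s] _ /=.
by rewrite cabsM powRM ?cabs_ge0 // muleA -EFinM mulrC.
Qed.
End TransferSums.

(** * Sums over one tract *)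

Section PeriodicSums.
Variable R : realType.
Local Notation C := R[i].
Local Notation H := (@Hright R).

Lemma hol_sum (I : Type) (r : seq I) (U : set C) (G : I -> C -> C) :
  (forall i, hol U (G i)) -> hol U (fun z => \sum_(i <- r) G i z).
Proof.
move=> hG; elim: r => [|i r IH] z Uz.
  by exists 0; apply: (@gder_ext _ _ _ (fun=> 0) _ _ _ _ ltr01) (gder_cst _ 0 z) => y _; rewrite big_nil.
have [d hd] := hG i _ Uz; have [e he] := IH _ Uz; exists (d + e).
by apply: (@gder_ext _ _ _ (fun y => G i y + \sum_(i <- r) G i y) _ _ _ _ ltr01) (gderD hd he) => y _; rewrite big_cons.
Qed.
Lemma cabs_sum (I : Type) (r : seq I) (G : I -> C) :
  cabs (\sum_(i <- r) G i) <= \sum_(i <- r) cabs (G i).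
Proof.
elim: r => [|i r IH]; first by rewrite !big_nil cabs0.
by rewrite !big_cons; apply: le_trans (cabsD _ _) _; rewrite lerD2l.
Qed.

(** On the circle of radius [rho] tangent at [a] to the line Re = a one has Re z - a = |z - a|^2 /
    (2 rho). *)
Lemma circle_tangent (L rho a : R) (z : C) : 0 < rho -> a <= complex.Re z ->
  cabs (z - (a + rho)%:C) = rho -> cabs (z - a%:C) <= L -> L ^+ 2 <= rho ->
  a <= complex.Re z <= a + 1.
Proof.
move=> r0 az hz hL Lr; rewrite az /=.
have := sqr_cabs (z - (a + rho)%:C); have := sqr_cabs (z - a%:C).
rewrite hz !(ReD, ReN, ImD, ImN) /= !subr0.
have : cabs (z - a%:C) ^+ 2 <= L ^+ 2 by rewrite lerXn2r // ?nnegrE ?cabs_ge0 // (le_trans (cabs_ge0 _) hL).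
set x := complex.Re z; set y := complex.Im z => h1 h2 h3.
have : (x - a) * (2 * rho) = cabs (z - a%:C) ^+ 2 by rewrite h2; lra.
have h4 : (x - a) * rho <= 1 * rho -> x - a <= 1 by rewrite ler_pM2r.
by move=> h5; have := h4; lra.
Qed.

(* The sum is the modulus of a holomorphic function at one chosen point and
   dominates it elsewhere; the maximum principle is applied on discs tangent
   to the line [Re = a], after division by [1 + eps xi] to force decay. *)
Lemma periodic_sum_bound (U : C -> C) (a p K : R) (r : seq int) :
  hol H U -> inj_on H U -> (forall x, H x -> complex.Re x * cabs ('D_1 U x) <= 160) ->
  0 < a -> 0 < p -> 0 < K ->
  (forall x, a <= complex.Re x <= a + 1 ->
    \sum_(k <- r) cabs ('D_1 U (shift k x)) `^ p <= K) ->
  forall x, a <= complex.Re x -> \sum_(k <- r) cabs ('D_1 U (shift k x)) `^ p <= K.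
Proof.
move=> hU iU bU a0 p0 K0 strip x ax.
have nU z : H z -> 'D_1 U z != 0 by exact: (univalent_deriv_neq0 (@eopen_Hright R) hU iU).
have [l hl] := hol_log (hull_Hright R) (hol_deriv (@eopen_Hright R) hU) nU.
have aH z : a <= complex.Re z -> H z by exact: lt_le_trans.
have Hx := aH _ ax.
pose G k z := cexp (p%:C * l (shift k z)).
have Gabs k z : H z -> cabs (G k z) = cabs ('D_1 U (shift k z)) `^ p.
  move=> Hz; rewrite (hl _ (shift_H k Hz)).1 !cabs_cexp ReM /= mul0r subr0.
  by rewrite -expRM mulrC.
have hG k : hol H (G k).
  apply: hol_cexp; apply: holZ; apply: hol_comp (fun z => @shift_H R k z).
    by move=> z /hl[_ h]; eexists; exact: h.
  by move=> z _; exists 1; exact: cder_shift.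
pose V := \sum_(k <- r) (160 / a) `^ p.
have V0 : 0 <= V by apply: sumr_ge0 => k _; exact: powR_ge0.
have vV z : a <= complex.Re z -> \sum_(k <- r) cabs (G k z) <= V.
  move=> az; apply: ler_sum => k _; rewrite Gabs; last exact: aH.
  apply: ge0_ler_powR; rewrite ?nnegrE ?cabs_ge0 ?(ltW p0) //; first by rewrite divr_ge0 // ltW.
  rewrite ler_pdivlMr //; have := bU _ (shift_H k (aH _ az)); rewrite Re_shift; apply: le_trans.
  by rewrite mulrC; apply: ler_wpM2r; rewrite ?cabs_ge0.
suff main eps : 0 < eps -> \sum_(k <- r) cabs (G k x) <= K * cabs (1 + eps%:C * x).
  have -> : \sum_(k <- r) cabs ('D_1 U (shift k x)) `^ p = \sum_(k <- r) cabs (G k x).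
    by apply: eq_bigr => k _; rewrite Gabs.
  apply/ler_addgt0Pr => e e0.
  have X0 : 0 < cabs x + 1 by rewrite ltr_wpDl ?cabs_ge0.
  have E0 : 0 < e / (K * (cabs x + 1)) by rewrite divr_gt0 // mulr_gt0.
  apply: le_trans (main _ E0) _; apply: (@le_trans _ _ (K * (1 + e / (K * (cabs x + 1)) * (cabs x + 1)))).
    apply: ler_wpM2l; first exact: ltW.
    apply: le_trans (cabsD _ _) _; rewrite cabs1 cabsM cabs_real (ger0_norm (ltW E0)).
    by rewrite lerD2l; apply: ler_wpM2l; [exact: ltW|rewrite lerDl].
  by rewrite le_eqVlt; apply/orP; left; apply/eqP; field; rewrite !gt_eqF.
move=> e0.
have n1 z : H z -> 1 <= cabs (1 + eps%:C * z).
  move=> Hz; apply: le_trans (Re_le_cabs _); rewrite ReD ReM /= mul0r subr0.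
  have hz : 0 < eps * complex.Re z by rewrite mulr_gt0.
  by rewrite gtr0_norm; lra.
have n0 z : H z -> 1 + eps%:C * z != 0.
  by move=> /n1 h; rewrite -cabs_gt0; lra.
have ph k : exists c, cabs c = 1 /\ c * G k x = (cabs (G k x))%:C.
  by have [d d1 d2] := unimodular_conj (G k x); exists d.
have [c hc] := choice ph.
pose F z := (\sum_(k <- r) c k * G k z) / (1 + eps%:C * z).
have hF : hol H F.
  apply: holM; first by apply: hol_sum => k; exact: holZ.
  by apply: holV n0 _; apply: holD; [exact: hol_cst|apply: holZ; exact: hol_id].
have Fx : cabs (F x) = (\sum_(k <- r) cabs (G k x)) / cabs (1 + eps%:C * x).
  rewrite /F cabsM cabsV; congr (_ / _).
  rewrite (eq_bigr (fun k => (cabs (G k x))%:C)); last by move=> k _; exact: (hc k).2.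
  by rewrite -(rmorph_sum (real_complex R)) cabs_real ger0_norm // sumr_ge0 // => k _; exact: cabs_ge0.
have FV z : cabs (F z) <= (\sum_(k <- r) cabs (G k z)) / cabs (1 + eps%:C * z).
  rewrite /F cabsM cabsV; apply: ler_wpM2r; first by rewrite invr_ge0 cabs_ge0.
  by apply: le_trans (cabs_sum _ _) _; apply: ler_sum => k _; rewrite cabsM (hc k).1 mul1r.
rewrite -ler_pdivrMr; last by have := n1 _ Hx; lra.
rewrite -Fx; have [x1|x1] := leP (complex.Re x) (a + 1).
  apply: le_trans (FV x) _; rewrite ler_pdivrMr; last by have := n1 _ Hx; lra.
  rewrite (eq_bigr (fun k => cabs ('D_1 U (shift k x)) `^ p)); last by move=> k _; rewrite Gabs.
  apply: le_trans (strip x _) _; first by rewrite ax.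
  by rewrite ler_peMr // ?(ltW K0) // n1.
(* Beyond distance [L] from [a] the factor |1 + eps z| is at least V / K + 1 and beats the crude
   bound [V]. The radius [rho] is so large that the points of the circle within [L] of [a] lie in
   the strip and that [x] lies inside. *)
set L := (V / K + 2) / eps + a.
have VK : 0 <= V / K by rewrite divr_ge0 // ltW.
have L0 : 0 < L by rewrite /L addr_gt0 // divr_gt0 // ltr_wpDl.
set rho := L ^+ 2 + cabs (x - a%:C) ^+ 2 + 1.
have [r0 r1 r2] : [/\ 0 < rho, L ^+ 2 <= rho & cabs (x - a%:C) ^+ 2 < rho].
  by rewrite /rho; have := sqr_ge0 L; have := sqr_ge0 (cabs (x - a%:C)); split; lra.
have cD : disc (a + rho)%:C (rho + a) `<=` H.
  by apply: disc_sub_H; rewrite /= addrC.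
apply: (max_principle (hol_sub cD hF) (r := rho)); first by apply/andP; split; lra.
- move=> z hz; have az : a <= complex.Re z.
    by have := Re_le_cabs (z - (a + rho)%:C); rewrite hz ReD ReN /= ler_norml; lra.
  have Hz := aH _ az; apply: le_trans (FV z) _; rewrite ler_pdivrMr; last by have := n1 _ Hz; lra.
  have [zL|zL] := leP (cabs (z - a%:C)) L.
    have st := circle_tangent r0 az hz zL r1.
    rewrite (eq_bigr (fun k => cabs ('D_1 U (shift k z)) `^ p)); last by move=> k _; rewrite Gabs.
    by apply: le_trans (strip z st) _; rewrite ler_peMr // ?(ltW K0) // n1.
  apply: le_trans (vV _ az) _.
  have z1 : L - a <= cabs z.
    by have := cabsD z (- a%:C); rewrite cabsN cabs_real gtr0_norm //; lra.
  have z2 : V / K + 2 <= eps * cabs z.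
    apply: (@le_trans _ _ (eps * (L - a))); last by apply: ler_wpM2l => //; exact: ltW.
    by rewrite /L addrK mulrCA divff ?mulr1 ?gt_eqF.
  have z3 : eps * cabs z - 1 <= cabs (1 + eps%:C * z).
    have := cabs_lb (eps%:C * z) (-1); rewrite cabsN cabs1 cabsM cabs_real gtr0_norm // opprK addrC.
    by rewrite [eps%:C * z + 1]addrC.
  apply: (@le_trans _ _ (K * (V / K))); first by rewrite mulrCA divff ?mulr1 ?gt_eqF.
  by apply: ler_wpM2l; [exact: ltW|lra].
- rewrite -(ltr_sqr (x := cabs _)) ?nnegrE ?cabs_ge0 ?(ltW r0) //.
  have h1 := sqr_cabs (x - a%:C); rewrite sqr_cabs.
  move: h1 r2; rewrite !(ReD, ReN, ImD, ImN) /= !subr0 => -> r2.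
  have : 1 * rho <= (complex.Re x - a) * rho by apply: ler_wpM2r; [exact: ltW|lra].
  set X := complex.Re x in r2 *; set Y := complex.Im x in r2 *.
  have -> : (X - (a + rho)) ^+ 2 + Y ^+ 2 = ((X - a) ^+ 2 + Y ^+ 2) - 2 * ((X - a) * rho) + rho ^+ 2 by ring.
  by lra.
Qed.
End PeriodicSums.

(** * From integral means to sums over translates *)

Section IntervalSums.
Variable R : realType.
Local Notation mu := (@lebesgue_measure R).

Lemma Iset_measurable : measurable (@Iset R).
Proof. by apply: measurableU; exact: measurable_itv. Qed.

(** The alternative in the separation hypothesis covers both orders of the intervals: on the
    negative half of [Iset] they move left as [k] grows. *)
Lemma sum_le_Rintegral (f : R -> R) (eta : R) (l m : nat -> R) (s : seq nat) :
  continuous f -> (forall y, 0 <= f y) -> 0 < eta -> uniq s ->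
  (forall k k', k \in s -> k' \in s -> (k < k')%N ->
    l k + eta < l k' \/ l k' + eta < l k) ->
  (forall k, k \in s -> `[l k, l k + eta] `<=` @Iset R) ->
  (forall k, 0 <= m k) ->
  (forall k y, k \in s -> l k <= y <= l k + eta -> m k <= f y) ->
  eta * (\sum_(k <- s) m k) <= Rintegral mu (@Iset R) f.
Proof.
move=> cf f0 e0 us dis sub m0 hm.
have mf (A : set R) : @measurable _ (measurableTypeR R) A -> measurable_fun A f.
  move=> mA; apply: subspace_continuous_measurable_fun => //.
  by apply: continuous_subspaceT => y; exact: cf.
have fin : (\int[mu]_(x in @Iset R) (f x)%:E)%E \is a fin_num.
  have h : mu.-integrable `[(-2 : R), 2] (EFin \o f).
    apply: continuous_compact_integrable; first exact: segment_compact.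
    by apply: continuous_subspaceT => y; exact: cf.
  have h2 : mu.-integrable (@Iset R) (EFin \o f).
    apply: integrableS h => //; first exact: Iset_measurable.
    by move=> y; rewrite /Iset /= !in_itv /=; case=> ?; lra.
  by apply: integrable_fin_num => //; exact: Iset_measurable.
rewrite -lee_fin /Rintegral fineK //.
set J := fun k => `[l k, l k + eta]%classic.
have triv : trivIset [set` s] J.
  move=> k k' /= ks ks' [y []]; rewrite /J /= !in_itv /= => h1 h2.
  have [kk|kk|//] := ltngtP k k'.
    by exfalso; have [] := dis _ _ ks ks' kk; lra.
  by exfalso; have [] := dis _ _ ks' ks kk; lra.
pose D := \big[setU/set0]_(i <- s) J i.
have mD : measurable D by apply: bigsetU_measurable => k _; exact: measurable_itv.
have DI : D `<=` @Iset R.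
  rewrite /D => y; rewrite -bigcup_seq => -[k /= ks]; exact: sub.
apply: (@le_trans _ _ (\int[mu]_(x in D) (f x)%:E)%E); last first.
  apply: ge0_subset_integral => //.
  - exact: Iset_measurable.
  - by apply/measurable_EFinP; apply: mf; exact: Iset_measurable.
  - by move=> y _; rewrite lee_fin.
rewrite (@ge0_integral_bigsetU _ _ _ mu _ J (EFin \o f) s) //; last 3 first.
- by move=> k; exact: measurable_itv.
- by apply/measurable_EFinP; exact: mf.
- by move=> y _; rewrite lee_fin.
rewrite mulr_sumr -sumEFin big_seq [leRHS]big_seq; apply: lee_sum => k ks.
apply: (@le_trans _ _ (\int[mu]_(x in J k) cst (m k)%:E x)%E).
  rewrite integral_cst; last exact: measurable_itv.
  rewrite /J /= lebesgue_measure_itv /= lte_fin ltrDl e0 -EFinD -EFinM lee_fin.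
  by rewrite addrAC subrr add0r mulrC.
apply: ge0_le_integral; first exact: measurable_itv.
- by move=> y _; rewrite /cst lee_fin.
- exact: measurable_cst.
- by apply/measurable_EFinP; apply: mf; exact: measurable_itv.
- by move=> y; rewrite /J /= in_itv /= => h; rewrite lee_fin; exact: hm.
Qed.
End IntervalSums.

Section IntegralMeans.
Variable R : realType.
Local Notation C := R[i].
Local Notation H := (@Hright R).

Lemma sub_uniq_sum (T : eqType) (r L : seq T) (F : T -> R) : uniq r ->
  {subset r <= L} -> (forall x, 0 <= F x) -> \sum_(x <- r) F x <= \sum_(x <- L) F x.
Proof.
move=> + + F0; elim: r L => [|x r IH] L /=; first by rewrite big_nil => _ _; apply: sumr_ge0.
move=> /andP[xr ur] sub; have xL : x \in L by apply: sub; rewrite inE eqxx.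
rewrite (perm_big _ (perm_to_rem xL)) !big_cons lerD2l; apply: IH => // y yr.
apply: rem_mem; last by apply: sub; rewrite inE yr orbT.
by apply: contraNneq xr => <-.
Qed.

Lemma two_pi_gt1 : 1 < 2 * pi :> R.
Proof. by have := pi_ge2 R; lra. Qed.

(** The indices are cut into blocks T <= 2 pi k <= 3T/2 with T in geometric progression; the block
    sums decay like T^-dl, and the finitely many initial terms are bounded by [B0]. *)
Lemma geometric_blocks (b : nat -> R) (C0 dl B0 T1 : R) : 0 < dl -> 2 <= T1 -> 0 <= C0 ->
  (forall k, 0 <= b k <= B0) ->
  (forall T n, T1 <= T -> \sum_(k <- iota 0 n | T <= 2 * pi * k%:R <= 3 / 2 * T) b k <= C0 * T `^ (- dl)) ->
  exists K : R, forall n, \sum_(k <- iota 0 n) b k <= K.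
Proof.
move=> d0 T2 C00 b0 hb; set q : R := (3 / 2) `^ (- dl).
have q01 : 0 <= q < 1.
  rewrite powR_ge0 /= /q /powR gt_eqF; last by lra.
  by rewrite -[ltRHS]expR0 ltr_expR mulNr oppr_lt0 mulr_gt0 // ln_gt0 //; lra.
have p1 := two_pi_gt1.
have B00 : 0 <= B0 by have := b0 0%N; lra.
have qn m : (T1 * (3 / 2) ^+ m) `^ (- dl) = T1 `^ (- dl) * q ^+ m.
  elim: m => [|m IH]; first by rewrite !expr0 !mulr1.
  rewrite exprS mulrCA powRM; [|by lra|by rewrite mulr_ge0 ?exprn_ge0 //; lra].
  by rewrite IH exprS mulrCA.
have [m1 hm1] : exists m1 : nat, T1 < m1%:R.
  by exists (Num.truncn T1).+1; exact: truncnS_gt.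
pose A := \sum_(k <- iota 0 m1) B0.
have hA n : \sum_(k <- iota 0 n | 2 * pi * k%:R < T1) b k <= A.
  rewrite -big_filter; apply: (@le_trans _ _ (\sum_(k <- [seq k <- iota 0 n | 2 * pi * k%:R < T1]) B0)).
    by apply: ler_sum => k _; have := b0 k; lra.
  apply: sub_uniq_sum => //; first by rewrite filter_uniq // iota_uniq.
  move=> k; rewrite mem_filter !mem_iota !add0n leq0n /= => /andP[h _].
  rewrite -(ltr_nat R); apply: lt_trans hm1; apply: le_lt_trans h.
  by rewrite ler_peMl // ltW.
have hM n M : \sum_(k <- iota 0 n | 2 * pi * k%:R < T1 * (3 / 2) ^+ M) b k <=
    A + C0 * T1 `^ (- dl) * \sum_(m <- iota 0 M) q ^+ m.
  elim: M => [|M IH].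
    by rewrite expr0 mulr1 big_nil mulr0 addr0.
  rewrite -[M.+1]addn1 iotaD big_cat /= big_seq1 add0n [C0 * _ * (_ + _)]mulrDr addrA.
  set TM := T1 * (3 / 2) ^+ M in IH *.
  have T1M : T1 <= TM.
    by rewrite /TM ler_peMr //; [lra|rewrite exprn_ege1 //; lra].
  have TS : T1 * (3 / 2) ^+ (M + 1) = 3 / 2 * TM by rewrite addn1 exprS /TM; ring.
  rewrite TS (bigID (fun k => 2 * pi * k%:R < TM)) /=; apply: lerD.
    apply: le_trans IH; rewrite le_eqVlt; apply/orP; left; apply/eqP; apply: eq_bigl => k.
    by apply/andP/idP => [[]//|h]; split => //; lra.
  have := hb TM n T1M; rewrite /TM qn mulrA -/TM; apply: le_trans.
  rewrite big_mkcond [leRHS]big_mkcond; apply: ler_sum => k _.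
  case: ifP => [/andP[h1]|_]; last by case: ifP => // _; have := b0 k; lra.
  by rewrite -leNgt => h2; rewrite h2 (ltW h1).
have geo M : \sum_(m <- iota 0 M) q ^+ m <= (1 - q)^-1.
  have : (1 - q) * \sum_(m <- iota 0 M) q ^+ m = 1 - q ^+ M.
    elim: M => [|M IH]; first by rewrite big_nil mulr0 expr0 subrr.
    by rewrite -[M.+1]addn1 iotaD big_cat /= big_seq1 add0n mulrDr IH exprD expr1; ring.
  have h0 : 0 < 1 - q by lra.
  move=> E; rewrite -(ler_pM2l h0) E divff ?gt_eqF //.
  by have /andP[q0 _] := q01; have := exprn_ge0 M q0; lra.
exists (A + C0 * T1 `^ (- dl) * (1 - q)^-1) => n.
have [M hMn] : exists M : nat, forall k, (k < n)%N -> 2 * pi * k%:R < T1 * (3 / 2) ^+ M.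
  have k01 : (0 : R) <= (2 / 3 : R) < 1 by apply/andP; split; lra.
  have n0 : 0 < 2 * pi * n%:R + 1 :> R by rewrite ltr_wpDl // !mulr_ge0 // pi_ge0.
  have [M hM'] := expr_lt_eps k01 (e := (2 * pi * n%:R + 1)^-1) ltac:(by rewrite invr_gt0).
  exists M => k kn; have h1 : 2 * pi * k%:R <= 2 * pi * n%:R :> R.
    by rewrite ler_wpM2l ?mulr_ge0 ?pi_ge0 // ler_nat ltnW.
  have e1 : (2 / 3 : R) = (3 / 2)^-1 by lra.
  move: hM'; rewrite e1 exprVn ltf_pV2 ?posrE ?exprn_gt0 // => hM'.
  have h2 : 1 * (3 / 2) ^+ M <= T1 * (3 / 2) ^+ M.
    by apply: ler_wpM2r; [rewrite exprn_ge0 //; lra|lra].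
  lra.
have -> : \sum_(k <- iota 0 n) b k = \sum_(k <- iota 0 n | 2 * pi * k%:R < T1 * (3 / 2) ^+ M) b k.
  rewrite big_seq_cond [RHS]big_seq_cond; apply: eq_bigl => k.
  by rewrite mem_iota /= add0n andbT; case: (ltnP k n) => // /hMn ->.
apply: le_trans (hM n M) _; rewrite lerD2l; apply: ler_wpM2l (geo M).
by rewrite mulr_ge0 // powR_ge0.
Qed.
End IntegralMeans.

Section SpectrumSums.
Variable R : realType.
Local Notation C := R[i].
Local Notation H := (@Hright R).
Variables (phi u : C -> C).
Hypotheses (hu : hol H u) (iu : inj_on H u).
Hypothesis bu : forall x, H x -> complex.Re x * cabs ('D_1 u x) <= 160.
Hypothesis phiE : forall x, H x -> phi x = cexp (u x).

Lemma cder_phi_log x : H x -> cder phi x (phi x * 'D_1 u x).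
Proof.
move=> Hx; have [r r0 hr] := @eopen_Hright R _ Hx.
have := gder_cexp (hol_cder hu Hx); rewrite -phiE //.
by apply: gder_ext r0 _ => w /hr /phiE ->.
Qed.

Lemma H_line (v : R) : H (Complex 1 v).
Proof. by rewrite /Hright /= ltr01. Qed.

Lemma scaled_line (T y : R) : 0 < T -> T%:C * Complex (1 / T) y = Complex 1 (T * y).
Proof.
move=> T0; apply/eqP; rewrite eq_complex /=; apply/andP; split; apply/eqP.
  by field; rewrite gt_eqF.
by ring.
Qed.

(** Scaling by [T] carries the line Re = 1/T to Re = 1, where the points 1 + 2 pi i k are sampled;
    phi' = phi u' separates the size of [phi] from the derivative of its logarithm. *)
Lemma abs_phiT_deriv (T y : R) : 0 < T ->
  cabs ('D_1 (phiT phi T) (Complex (1 / T) y)) =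
  T * cabs (phi (Complex 1 (T * y))) * cabs ('D_1 u (Complex 1 (T * y))) / cabs (phi (Complex T 0)).
Proof.
move=> T0; have HT : H (T%:C * Complex (1 / T) y) by rewrite scaled_line //; exact: H_line.
have d1 := @gder_comp R C id phi (fun z => T%:C * z) (Complex (1 / T) y) _ _ (cder_phi_log HT) (gderZ T%:C (gder_id id _)).
have d2 := gderM d1 (gder_cst id (Complex (cabs (phi (Complex T 0))) 0)^-1 (Complex (1 / T) y)).
rewrite (cder_val d2) mulr0 addr0 scaled_line // mulr1 !cabsM cabsV !cabs_real.
rewrite (gtr0_norm T0) (ger0_norm (cabs_ge0 _)).
move: (cabs (phi _)) (cabs (phi _)) (cabs ('D_1 u _)) => x y' z.
by ring.
Qed.

Lemma cabs_phi_gt0 x : H x -> 0 < cabs (phi x).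
Proof. by move=> Hx; rewrite phiE // cabs_gt0 cexp_neq0. Qed.
Lemma du_neq0 x : H x -> 'D_1 u x != 0.
Proof. exact: (univalent_deriv_neq0 (@eopen_Hright R) hu iu). Qed.

Definition lineW (v : R) : R := cabs ('D_1 u (Complex 1 v)).
Lemma lineW_gt0 v : 0 < lineW v.
Proof. by rewrite cabs_gt0 du_neq0 //; exact: H_line. Qed.
Definition Dst : R := expR (15000 / 2^-1 * 1).
Lemma lineW_dist v w : `|v - w| <= 1 -> lineW v <= Dst * lineW w.
Proof.
move=> vw; have h2 : 0 < 2^-1 :> R by rewrite invr_gt0.
have h1 (x : R) : 2^-1 < complex.Re (Complex 1 x : C) by rewrite /=; lra.
apply: le_trans (distortion hu iu h2 (h1 v) (h1 w)) _.
rewrite /Dst; apply: ler_wpM2r; first exact: ltW (lineW_gt0 w).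
rewrite ler_expR; apply: ler_wpM2l; first by apply: divr_ge0; [exact: ler0n|exact: ltW].
have -> : Complex 1 v - Complex 1 w = Complex 0 (v - w) :> C.
  by apply/eqP; rewrite eq_complex /= subrr !eqxx.
by rewrite /cabs /= expr0n /= add0r sqrtr_sqr.
Qed.

(** The integrand is the exponential of the real part of a holomorphic function, so the real
    exponent [p] causes no difficulty. *)
Lemma phiT_continuous (T p : R) : 0 < T ->
  continuous (fun y => cabs ('D_1 (phiT phi T) (Complex (1 / T) y)) `^ p).
Proof.
move=> T0; have [l hl] := hol_log (hull_Hright R) (hol_deriv (@eopen_Hright R) hu) du_neq0.
pose g y := p * (ln (T / cabs (phi (Complex T 0))) + complex.Re (u (Complex 1 (T * y)) + l (Complex 1 (T * y)))).
have HT : H (Complex T 0) by [].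
have pT := cabs_phi_gt0 HT.
have -> : (fun y => cabs ('D_1 (phiT phi T) (Complex (1 / T) y)) `^ p) = (fun y => expR (g y)).
  apply/funext => y; rewrite abs_phiT_deriv // phiE; last exact: H_line.
  rewrite (hl _ (H_line _)).1 !cabs_cexp /g ReD.
  have -> : T * expR (complex.Re (u (Complex 1 (T * y)))) * expR (complex.Re (l (Complex 1 (T * y)))) / cabs (phi (Complex T 0)) =
     expR (ln (T / cabs (phi (Complex T 0))) + (complex.Re (u (Complex 1 (T * y))) + complex.Re (l (Complex 1 (T * y))))).
    by rewrite !expRD lnK ?posrE ?divr_gt0 //; ring.
  by rewrite -expRM mulrC.
suff cg : continuous g.
  by move=> y; apply: continuous_comp; [exact: cg|exact: continuous_expR].
suff cg : continuous (fun y => complex.Re (u (Complex 1 (T * y)) + l (Complex 1 (T * y)))).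
  by move=> y; apply: cvgM; [exact: cvg_cst|apply: cvgD; [exact: cvg_cst|exact: cg]].
move=> y; apply/continuous_eps => e e0.
have Hy := H_line (T * y).
have d1 := gderD (hol_cder hu Hy) (hl _ Hy).2.
have [r r0 hr] := gder_cont d1 e0.
exists (r / T); first by rewrite divr_gt0.
move=> w; rewrite ltr_pdivlMr // => hw; rewrite -ReN -ReD.
apply: le_lt_trans (Re_le_cabs _) _; apply: hr => /=.
have -> : Complex 1 (T * w) - Complex 1 (T * y) = Complex 0 ((w - y) * T) :> C.
  by apply/eqP; rewrite eq_complex /= subrr eqxx /=; apply/eqP; ring.
by rewrite /cabs /= expr0n /= add0r sqrtr_sqr normrM (gtr0_norm T0).
Qed.

Lemma block_arith (T M D A B W W' : R) : 0 < T -> 0 < M -> 0 < D ->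
  A <= M * B -> W' <= D * W -> 0 < A -> 0 < B -> 0 < W -> 0 < W' ->
  T / (M * D) * W' <= T * B * W / A.
Proof.
move=> T0 M0 D0 h1 h2 A0 B0 W0 W'0.
rewrite ler_pdivlMr // (_ : T / (M * D) * W' * A = T * (A * W') / (M * D)); last by ring.
rewrite ler_pdivrMr ?mulr_gt0 // (_ : T * B * W * (M * D) = T * ((M * B) * (D * W))); last by ring.
rewrite ler_pM2l //.
by apply: ler_pM => //; exact: ltW.
Qed.

(** Each [k] owns an interval of length 1/T in [y], on which T y stays within 1 of the sampling
    point. Distortion and the comparison of [phi] with its value at [T] bound the integrand below by
    a constant times T^p |u'|^p. The ratio 3/2 and T >= 2 keep |T y| in [T, 2T]. *)
Lemma block_bound (p c M T sg : R) n : 0 < p -> 2 <= T -> 0 < M -> sg = 1 \/ sg = -1 ->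
  (forall v, T <= `|v| <= 2 * T -> cabs (phi (Complex T 0)) <= M * cabs (phi (Complex 1 v))) ->
  Rintegral lebesgue_measure (@Iset R)
        (fun y => cabs ('D_1 (phiT phi T) (Complex (1 / T) y)) `^ p) <= T `^ c ->
  \sum_(k <- iota 0 n | T <= 2 * pi * k%:R <= 3 / 2 * T) lineW (sg * (2 * pi * k%:R)) `^ p <=
    (M * Dst) `^ p * T `^ (1 - p + c).
Proof.
move=> p0 T2 M0 hsg hM hI; have T0 : 0 < T by lra.
have D0 : 0 < Dst by exact: expR_gt0.
have p1 := two_pi_gt1 R.
pose f (y : R) : R := cabs ('D_1 (phiT phi T) (Complex (1 / T) y)) `^ p.
pose l k : R := if sg == 1 then 2 * pi * k%:R / T else - ((2 * pi * k%:R + 1) / T).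
pose m (k : nat) : R := (T / (M * Dst)) `^ p * lineW (sg * (2 * pi * k%:R)) `^ p.
set s := [seq k <- iota 0 n | T <= 2 * pi * k%:R <= 3 / 2 * T].
have l_r k y : l k <= y <= l k + 1 / T -> exists2 v, T * y = sg * v & 2 * pi * k%:R <= v <= 2 * pi * k%:R + 1.
  move=> /andP[y1 y2]; exists (sg * (T * y)); first by case: hsg => ->; ring.
  have z1 : T * l k <= T * y by apply: ler_wpM2l => //; exact: ltW.
  have z2 : T * y <= T * (l k + 1 / T) by apply: ler_wpM2l => //; exact: ltW.
  move: z1 z2; rewrite /l; case: hsg => ->; rewrite ?eqxx.
    have -> : T * (2 * pi * k%:R / T) = 2 * pi * k%:R by field; rewrite gt_eqF.
    have -> : T * (2 * pi * k%:R / T + 1 / T) = 2 * pi * k%:R + 1 by field; rewrite gt_eqF.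
    by lra.
  have -> : (-1 == 1 :> R) = false by apply/negbTE; rewrite lt_eqF //; lra.
  have -> : T * - ((2 * pi * k%:R + 1) / T) = - (2 * pi * k%:R + 1) by field; rewrite gt_eqF.
  have -> : T * (- ((2 * pi * k%:R + 1) / T) + 1 / T) = - (2 * pi * k%:R) by field; rewrite gt_eqF.
  by lra.
have sg1 : `|sg| = 1 by case: hsg => ->; rewrite ?normrN normr1.
have sgsg v : `|sg * v| = `|v| by rewrite normrM sg1 mul1r.
have ks k : k \in s -> T <= 2 * pi * k%:R <= 3 / 2 * T.
  by rewrite mem_filter => /andP[].
have i0 : 0 < 1 / T by rewrite divr_gt0.
have h : 1 / T * (\sum_(k <- s) m k) <= T `^ c.
  have hI' : Rintegral (@lebesgue_measure R) (@Iset R) f <= T `^ c := hI.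
  suff hh : 1 / T * (\sum_(k <- s) m k) <= Rintegral (@lebesgue_measure R) (@Iset R) f by exact: le_trans hh hI'.
  apply: (@sum_le_Rintegral R f (1 / T) l m s (@phiT_continuous T p T0)) => //.
  - by move=> y; exact: powR_ge0.
  - by rewrite filter_uniq // iota_uniq.
  - move=> k k' _ _ kk; have k1 : k%:R + 1 <= k'%:R :> R by rewrite natr1 ler_nat.
    have k2 : 2 * pi * (k%:R + 1) <= 2 * pi * k'%:R :> R by rewrite ler_pM2l //; lra.
    rewrite /l; case: hsg => ->; rewrite ?eqxx.
      left; rewrite -mulrDl ltr_pM2r ?invr_gt0 //; lra.
    have -> : (-1 == 1 :> R) = false by apply/negbTE; rewrite lt_eqF //; lra.
    right; rewrite -!mulNr -mulrDl ltr_pM2r ?invr_gt0 //; lra.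
  - move=> k kS y; rewrite /= in_itv /= => hy; have [v vE hv] := l_r k y hy.
    have hk := ks k kS.
    have Ty : T <= T * `|y| <= T * 2.
      have v0 : 0 <= v by lra.
      have -> : T * `|y| = v.
        by rewrite -[X in X * _](gtr0_norm T0) -normrM vE sgsg ger0_norm.
      lra.
    have y12 : 1 <= `|y| <= 2.
      by move: Ty; rewrite -{1}[T]mulr1 !ler_pM2l.
    rewrite /Iset /=; have [y0|y0] := leP 0 y.
      by right; rewrite in_itv /=; rewrite ger0_norm in y12.
    by left; rewrite in_itv /=; rewrite ltr0_norm // in y12; lra.
  - by move=> k; rewrite mulr_ge0 // powR_ge0.
  - move=> k y kS hy; have [v vE hv] := l_r k y hy; have hk := ks k kS.
    have v0 : 0 <= v by lra.
    have hv2 : T <= `|T * y| <= 2 * T by rewrite vE sgsg ger0_norm //; lra.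
    have hMv := hM _ hv2.
    rewrite /m /f -powRM ?divr_ge0 ?(ltW T0) ?mulr_ge0 ?(ltW M0) ?(ltW D0) ?(ltW (lineW_gt0 _)) //.
    apply: ge0_ler_powR; rewrite ?nnegrE ?cabs_ge0 ?(ltW p0) //.
      by rewrite !mulr_ge0 ?invr_ge0 ?mulr_ge0 ?(ltW T0) ?(ltW M0) ?(ltW D0) ?(ltW (lineW_gt0 _)).
    rewrite abs_phiT_deriv // -/(lineW (T * y)).
    have dist : lineW (sg * (2 * pi * k%:R)) <= Dst * lineW (T * y).
      by apply: lineW_dist; rewrite vE -mulrBr sgsg distrC ger0_norm; lra.
    have HT : H (Complex T 0) by [].
    have pT := cabs_phi_gt0 HT; have py := cabs_phi_gt0 (H_line (T * y)).
    exact: (block_arith T0 M0 D0 hMv dist pT py (lineW_gt0 (T * y)) (lineW_gt0 (sg * (2 * pi * k%:R)))).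
move: h; rewrite /m -mulr_sumr big_filter; set S := \sum_(k <- _ | _) _ => h.
have MD0 : 0 < M * Dst by rewrite mulr_gt0.
have A0 : 0 < (T / (M * Dst)) `^ p by rewrite powR_gt0 // divr_gt0.
rewrite -(ler_pM2l A0) -(ler_pM2l i0); apply: le_trans h _.
rewrite [(T / _) `^ p]powRM ?(ltW T0) ?invr_ge0 ?(ltW MD0) //.
have -> : 1 / T * (T `^ p * (M * Dst)^-1 `^ p * ((M * Dst) `^ p * T `^ (1 - p + c))) =
  (M * Dst)^-1 `^ p * (M * Dst) `^ p * (1 / T * (T `^ p * T `^ (1 - p + c))) by ring.
rewrite -powRM ?invr_ge0 ?(ltW MD0) // mulVf ?gt_eqF // powR1 mul1r.
rewrite -powRD; last by apply/implyP => _; rewrite gt_eqF.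
have -> : p + (1 - p + c) = 1 + c by ring.
rewrite powRD; last by apply/implyP => _; rewrite gt_eqF.
by rewrite powRr1 ?(ltW T0) // mulrA div1r mulVf ?gt_eqF // mul1r.
Qed.

(** [c < p - 1] is negativity of the spectrum at [p]: it makes the block sums decay like T^(c - (p -
    1)). Positive and negative [k] are treated as two series over the naturals. *)
Lemma line_sums (p c M T0 : R) : 0 < p -> c < p - 1 -> 0 < M ->
  (forall T v, T0 <= T -> T <= `|v| <= 2 * T -> cabs (phi (Complex T 0)) <= M * cabs (phi (Complex 1 v))) ->
  (forall T, T0 <= T -> Rintegral lebesgue_measure (@Iset R)
        (fun y => cabs ('D_1 (phiT phi T) (Complex (1 / T) y)) `^ p) <= T `^ c) ->
  exists2 K : R, 0 < K & forall r : seq int, uniq r ->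
    \sum_(k <- r) cabs ('D_1 u (shift k 1)) `^ p <= K.
Proof.
move=> p0 cp M0 hM hI.
have shiftE (k : int) : shift k (1 : C) = Complex 1 (2 * pi * k%:~R).
  apply/eqP; rewrite eq_complex Re_shift /= eqxx /= /shift ImD Im_int_tpi /= add0r.
  by apply/eqP; ring.
have W160 v : lineW v <= 160.
  by have := bu (H_line v); rewrite /= mul1r.
have half sg : sg = 1 \/ sg = -1 -> exists K : R, forall n,
    \sum_(k <- iota 0 n) lineW (sg * (2 * pi * k%:R)) `^ p <= K.
  move=> hsg; apply: (@geometric_blocks R _ ((M * Dst) `^ p) (p - 1 - c) (160 `^ p) (Num.max T0 2)).
  - by lra.
  - by rewrite le_max lexx orbT.
  - exact: powR_ge0.
  - move=> k; rewrite powR_ge0 /=; apply: ge0_ler_powR; rewrite ?nnegrE ?(ltW p0) ?(ltW (lineW_gt0 _)) //.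
  - move=> T n; rewrite ge_max => /andP[T1 T2].
    have -> : - (p - 1 - c) = 1 - p + c by ring.
    apply: (block_bound n p0 T2 M0 hsg); first by move=> v hv; exact: hM.
    exact: hI.
have [Kp hKp] := half 1 (or_introl erefl); have [Km hKm] := half (-1) (or_intror erefl).
have W0 k : 0 <= cabs ('D_1 u (shift k 1)) `^ p by exact: powR_ge0.
have Kp0 : 0 <= Kp by have := hKp 0%N; rewrite big_nil.
have Km0 : 0 <= Km by have := hKm 0%N; rewrite big_nil.
exists (Kp + Km + 1); first by lra.
move=> r ur.
pose n := (\max_(k <- r) `|k|%N).+1.
pose L : seq int := [seq Posz k | k <- iota 0 n] ++ [seq - Posz k | k <- iota 0 n].
have sub : {subset r <= L}.
  move=> k kr; have kn : (`|k| < n)%N.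
    by rewrite /n ltnS; exact: (@leq_bigmax_seq _ _ _ (fun k : int => `|k|%N) _ kr isT).
  rewrite mem_cat; case: k kr kn => [k|k] _ kn; apply/orP.
    by left; apply/mapP; exists k => //; rewrite mem_iota.
  by right; apply/mapP; exists k.+1; rewrite ?mem_iota // NegzE.
apply: le_trans (sub_uniq_sum ur sub W0) _.
rewrite /L big_cat !big_map.
have e1 : \sum_(k <- iota 0 n) cabs ('D_1 u (shift (Posz k) 1)) `^ p <= Kp.
  apply: le_trans (hKp n); apply: ler_sum => k _.
  by rewrite shiftE /lineW mul1r.
have e2 : \sum_(k <- iota 0 n) cabs ('D_1 u (shift (- Posz k) 1)) `^ p <= Km.
  apply: le_trans (hKm n); apply: ler_sum => k _.
  by rewrite shiftE /lineW mulN1r mulrNz mulrN.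
by apply: le_trans (lerD e1 e2) _; rewrite lerDl.
Qed.

(** Distortion carries the bound from the line Re = 1 to the strip a <= Re <= a + 1, after a
    translation into |Im| <= pi that only relabels the translates; [periodic_sum_bound] then extends
    it to the half-plane without loss. *)
Lemma half_plane_sums (a p K1 : R) : 0 < a -> 0 < p -> 0 < K1 ->
  (forall r : seq int, uniq r -> \sum_(k <- r) cabs ('D_1 u (shift k 1)) `^ p <= K1) ->
  exists2 K : R, 0 < K & forall (r : seq int) x, uniq r -> a <= complex.Re x ->
    \sum_(k <- r) cabs ('D_1 u (shift k x)) `^ p <= K.
Proof.
move=> a0 p0 K10 h1; have pp := pi_gt0 R.
set b := Num.min a 1 / 2.
have [b0 ba b1] : [/\ 0 < b, b < a & b < 1].
  have m0 : 0 < Num.min a 1 by rewrite lt_min a0 ltr01.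
  have m1 : Num.min a 1 <= a by rewrite ge_min lexx.
  have m2 : Num.min a 1 <= 1 by rewrite ge_min lexx orbT.
  by rewrite /b; split; lra.
have [D D0 hD] : exists2 D : R, 0 < D & forall y z, b < complex.Re y -> b < complex.Re z ->
    cabs (y - z) <= a + 2 + pi -> cabs ('D_1 u y) <= D * cabs ('D_1 u z).
  exists (expR (15000 / b * (a + 2 + pi))); first exact: expR_gt0.
  move=> y z yb zb yz; apply: le_trans (distortion hu iu b0 yb zb) _.
  apply: ler_wpM2r; first exact: cabs_ge0.
  by rewrite ler_expR; apply: ler_wpM2l yz; apply: divr_ge0; [exact: ler0n|exact: ltW].
have K0 : 0 < D `^ p * K1 by rewrite mulr_gt0 // powR_gt0.
exists (D `^ p * K1) => // r x ur ax.
apply: (periodic_sum_bound hu iu bu a0 p0 K0) ax => {}x /andP[x1 x2].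
have [m hm] := floor_reduce (complex.Im x).
set x0 := shift (- m) x.
have xE k : shift k x = shift (k + m) x0.
  by rewrite /x0 /shift -addrA -mulrDl -intrD; congr (_ + _%:~R * _); ring.
have R0 : complex.Re x0 = complex.Re x by exact: Re_shift.
have I0 : complex.Im x0 = complex.Im x - m%:~R * (2 * pi).
  by rewrite /x0 /shift ImD Im_int_tpi mulrNz mulNr.
have d0 : cabs (x0 - 1) <= a + 2 + pi.
  apply: le_trans (cabs_le_ReIm _) _; rewrite ReD ReN ImD ImN R0 I0 /= subr0.
  have i1 : `|complex.Im x - m%:~R * (2 * pi)| <= pi by rewrite ler_norml; lra.
  have i2 : `|complex.Re x - 1| <= a + 2 by rewrite ler_norml; lra.
  lra.
have key k : cabs ('D_1 u (shift k x)) `^ p <= D `^ p * cabs ('D_1 u (shift (k + m) 1)) `^ p.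
  rewrite -powRM ?cabs_ge0 ?(ltW D0) //; apply: ge0_ler_powR; rewrite ?nnegrE ?cabs_ge0 ?(ltW p0) //.
    by rewrite mulr_ge0 ?cabs_ge0 // ltW.
  rewrite xE; apply: hD.
  - by rewrite Re_shift R0; lra.
  - by rewrite Re_shift /=; lra.
  by have -> : shift (k + m) x0 - shift (k + m) 1 = x0 - 1 by rewrite /shift; ring.
apply: (@le_trans _ _ (\sum_(k <- r) D `^ p * cabs ('D_1 u (shift (k + m) 1)) `^ p)).
  by apply: ler_sum => k _; exact: key.
rewrite -mulr_sumr; apply: ler_wpM2l; first exact: powR_ge0.
rewrite -(big_map (fun k => k + m) xpredT (fun k => cabs ('D_1 u (shift k 1)) `^ p)); apply: h1.
by rewrite map_inj_uniq // => i j /addIr.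
Qed.
End SpectrumSums.

Section NegativeSpectrum.
Variable R : realType.
Local Notation C := R[i].
Local Notation H := (@Hright R).

Lemma b_inf_lt0 (g : C -> C) (p : R) : (b_inf g p < 0)%E ->
  exists2 c : R, c < p - 1 & exists T0 : R, forall T, T0 < T ->
    beta_h (phiT g T) (1 / T) p <= c.
Proof.
move=> hb; have : (beta_inf g p < (p - 1)%:E)%E.
  move: hb; rewrite /b_inf; case: (beta_inf g p) => [r| |] //=.
    by rewrite -EFinB -EFinD !lte_fin => hr; lra.
  by move=> _; rewrite ltNyr.
rewrite /beta_inf /limf_esup => /ereal_inf_lt[_ [V [M [_ hM]] <-]] hV.
set s := ereal_sup _ in hV.
have le_s T : M < T -> ((beta_h (phiT g T) (1 / T) p)%:E <= s)%E.
  by move=> /hM VT; apply: ereal_sup_ubound; exists T.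
have s_fin : s \is a fin_num.
  have h := le_s (M + 1) ltac:(by rewrite ltrDl).
  by move: hV h; case: s {le_s} => [r| |].
exists (fine s); first by rewrite -lte_fin fineK.
by exists M => T /le_s; rewrite -lee_fin fineK.
Qed.

Lemma integral_beta (h : C -> C) (T p c : R) : 1 < T -> beta_h h (1 / T) p <= c ->
  Rintegral lebesgue_measure (@Iset R) (fun y => cabs ('D_1 h (Complex (1 / T) y)) `^ p) <= T `^ c.
Proof.
move=> T1; rewrite /beta_h; set I := Rintegral _ _ _ => hc.
have T0 : 0 < T by exact: lt_trans T1.
(* [ln] says nothing about a nonpositive argument, but then the bound is trivial. *)
have [I0|I0] := leP I 0; first by apply: le_trans I0 _; exact: powR_ge0.
have lT : 0 < ln T by rewrite ln_gt0.
move: hc; rewrite !div1r invrK ler_pdivrMr // => hc.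
by rewrite -[I]lnK ?posrE // /powR gt_eqF // ler_expR.
Qed.

Variables (f : C -> C) (entire : bool) (N : nat).
Variables (Om : 'I_N -> set C) (tau phi : 'I_N -> C -> C).
Variables (a : R) (u : 'I_N -> C -> C).
Hypotheses (hD : classD f entire Om tau phi) (hL : log_branches u a).
Hypothesis phiE : forall j x, H x -> phi j x = cexp (u j x).
Hypothesis neg : negative_spectrum phi.

(** Both [T] and 1 + i v lie in Q_T outside Q_(T/8), where the definition of class D compares the
    values of [phi j]. *)
Lemma real_line_comparison j : exists2 M : R, 0 < M & exists T0 : R, forall T v, T0 <= T ->
  T <= `|v| <= 2 * T -> cabs (phi j (Complex T 0)) <= M * cabs (phi j (Complex 1 v)).
Proof.
case: hD => _ _ _ _ [hM _]; have [M [T0 h]] := hM j.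
exists (Num.max M 1); first by rewrite lt_max ltr01 orbT.
exists (Num.max T0 2) => T v; rewrite ge_max => /andP[T1 T2] /andP[v1 v2].
apply: (@le_trans _ _ (M * cabs (phi j (Complex 1 v)))); last first.
  by apply: ler_wpM2r; [exact: cabs_ge0|rewrite le_max lexx].
apply: (h T T1); rewrite /Qbox; split => /=.
- by rewrite normr0; split; [apply/andP; split|]; lra.
- by rewrite normr0 => -[/andP[_ h1] _]; lra.
- by split; [apply/andP; split|]; lra.
- by move=> [_ h1]; lra.
Qed.

Lemma tract_sums j (p : R) : (Theta phi < p%:E)%E -> 0 < p ->
  exists2 K : R, 0 < K & forall (r : seq int) x, uniq r -> a <= complex.Re x ->
    \sum_(k <- r) cabs ('D_1 (u j) (shift k x)) `^ p <= K.
Proof.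
move=> hp p0; have hb : (b_inf (phi j) p < 0)%E.
  by apply: le_lt_trans (neg hp); exact: (le_bigmax -oo%E (fun j => b_inf (phi j) p) j).
have [c cp [T1 hc]] := b_inf_lt0 hb.
have [M M0 [T2 hM]] := real_line_comparison j.
have a0 : 0 < a by case: hL.
have huj : hol H (u j) by case: hL.
have iuj := inj_u hL (j := j).
have buj x : H x -> complex.Re x * cabs ('D_1 (u j) x) <= 160.
  by move=> Hx; have := dgm_log hL (j, 0) Hx; rewrite /dgm /= /shift mul0r addr0.
pose T0 := Num.max T2 (Num.max 2 (T1 + 1)).
have [t1 t2 t3] : [/\ T2 <= T0, 2 <= T0 & T1 + 1 <= T0].
  by rewrite /T0 !le_max !lexx ?orbT.
have [||K1 K10 hK1] := @line_sums R (phi j) (u j) huj iuj buj (phiE j) p c M T0 p0 cp M0.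
- by move=> T v T0T; apply: hM; exact: le_trans T0T.
- move=> T T0T; apply: integral_beta; first by lra.
  by apply: hc; lra.
exact: (half_plane_sums huj iuj buj a0 p0 K10 hK1).
Qed.

Lemma Theta_ge0 : (0 < N)%N -> (0 <= Theta phi)%E.
Proof.
case: N phi => // n ph _; apply: le_trans (le_bigmax -oo%E (fun j => first_zero (ph j)) ord0).
by apply: le_ereal_inf_tmp => _ [t [t0 _] <-]; rewrite lee_fin ltW.
Qed.

(** The exponent [p] lies midway between [Theta] and [h]. Koebe's |u'| <= 160 / Re x, applied to the
    surplus h - p, turns bounded sums at [p] into decay at rate q = h - p. *)
Lemma letter_sums (h : R) : (0 < N)%N -> (Theta phi < h%:E)%E -> 0 < h /\
  exists2 K : R, 0 < K & exists2 q : R, 0 < q & forall (L : seq (letter N)) x, uniq L -> a <= complex.Re x ->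
    \sum_(i <- L) cabs (dgm u i x) `^ h <= K * (complex.Re x) `^ (- q).
Proof.
move=> N0 hh; have th0 := Theta_ge0 N0.
have [th thE] : exists th, Theta phi = th%:E.
  by move: th0 hh; case: (Theta phi) => // t _ _; exists t.
rewrite thE in th0 hh; rewrite lee_fin in th0; rewrite lte_fin in hh.
have h0 : 0 < h by exact: le_lt_trans hh.
split => //; pose p := (th + h) / 2.
have [p1 p2 p0] : [/\ th < p, p < h & 0 < p] by rewrite /p; split; lra.
have hp : (Theta phi < p%:E)%E by rewrite thE lte_fin.
have ex j : exists K : R, 0 < K /\ forall (r : seq int) x, uniq r -> a <= complex.Re x ->
    \sum_(k <- r) cabs ('D_1 (u j) (shift k x)) `^ p <= K.
  by have [K K0 hK] := tract_sums j hp p0; exists K.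
have [K hK] := choice ex.
pose K0 := 1 + \sum_j K j.
have KK : 0 < K0 by rewrite ltr_pwDl // sumr_ge0 // => j _; exact: ltW (hK j).1.
exists (K0 * 160 `^ (h - p)); first by rewrite mulr_gt0 // powR_gt0.
exists (h - p); first by rewrite subr_gt0.
move=> L x uL ax; have a0 : 0 < a by case: hL.
have x0 : 0 < complex.Re x by exact: lt_le_trans ax.
have b160 : 0 <= 160 / complex.Re x :> R by apply: divr_ge0; [exact: ler0n|exact: ltW].
have one i : cabs (dgm u i x) `^ h <= (160 / complex.Re x) `^ (h - p) * cabs (dgm u i x) `^ p.
  have d0 : cabs (dgm u i x) != 0 by rewrite cabs_eq0 (dgm_neq0 hL).
  have -> : cabs (dgm u i x) `^ h = cabs (dgm u i x) `^ (h - p) * cabs (dgm u i x) `^ p.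
    by rewrite -powRD ?subrK //; apply/implyP.
  apply: ler_wpM2r; first exact: powR_ge0.
  apply: ge0_ler_powR; rewrite ?nnegrE ?cabs_ge0 //; first by rewrite subr_ge0 ltW.
  by rewrite ler_pdivlMr // mulrC; exact: (dgm_log hL).
apply: le_trans (ler_sum _ (fun i _ => one i)) _.
rewrite -mulr_sumr powRM ?ler0n ?invr_ge0 ?(ltW x0) // -powR_inv1 ?(ltW x0) // -powRrM mulN1r.
rewrite [K0 * _]mulrC -!mulrA; apply: ler_wpM2l; first exact: powR_ge0.
rewrite mulrC; apply: ler_wpM2r; first exact: powR_ge0.
rewrite (partition_big (fun i : letter N => i.1) xpredT) //= /K0.
apply: (@le_trans _ _ (\sum_j K j)); last by rewrite lerDr.
apply: ler_sum => j _; rewrite -big_filter.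
have -> : \sum_(i <- [seq i <- L | i.1 == j]) cabs (dgm u i x) `^ p =
   \sum_(k <- [seq i.2 | i <- [seq i <- L | i.1 == j]]) cabs ('D_1 (u j) (shift k x)) `^ p.
  rewrite [RHS]big_map.
  rewrite [LHS]big_filter [RHS]big_filter.
  apply: eq_bigr => i /eqP ij.
  rewrite /dgm.
  by rewrite ij.
set L' := [seq i.2 | i <- _].
have uL' : uniq L'.
  rewrite map_inj_in_uniq; first exact: filter_uniq.
  by move=> [i1 i2] [k1 k2]; rewrite !mem_filter /= => /andP[/eqP -> _] /andP[/eqP -> _] ->.
have [_ hKj] := hK j.
have hsum := hKj L' x uL' ax.
exact: hsum.
Qed.
End NegativeSpectrum.

(** * Hausdorff measure of covered and of coded sets *)

Lemma powR_exprn (R : realType) (x t : R) n : 0 <= x -> (x ^+ n) `^ t = (x `^ t) ^+ n.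
Proof.
move=> x_ge0; elim: n => [|n IH]; first by rewrite !expr0 powR1.
by rewrite !exprS powRM ?exprn_ge0 // IH.
Qed.

Section Covers.
Variable R : realType.
Local Notation C := R[i].

(** A countable partition handled through finite lists; the keys used are word length, dyadic size
    and box index. *)
Lemma group_sum (I : eqType) (key : I -> nat) (P : pred I) (F : I -> R) (b : nat -> R) (B : R) :
  (forall i, 0 <= F i) ->
  (forall n L, uniq L -> (forall i, i \in L -> P i /\ key i = n) -> \sum_(i <- L) F i <= b n) ->
  (forall m, \sum_(0 <= n < m) b n <= B) ->
  forall L, uniq L -> all P L -> \sum_(i <- L) F i <= B.
Proof.
move=> F0 hb hB L uL PL.
pose m := (\max_(i <- L) key i).+1.
apply: le_trans (hB m).
have km i : i \in L -> (key i < m)%N.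
  by move=> iL; rewrite /m ltnS; exact: (@leq_bigmax_seq _ _ _ key _ iL isT).
rewrite big_mkord; apply: le_trans (_ : _ <= \sum_(n < m) \sum_(i <- L | key i == n) F i) _; last first.
  apply: ler_sum => n _; rewrite -big_filter; apply: hb; first exact: filter_uniq.
  by move=> i; rewrite mem_filter => /andP[/eqP -> iL]; split => //; exact: (allP PL).
rewrite [leRHS](exchange_big_dep xpredT) //=.
rewrite [leLHS]big_seq [leRHS]big_seq; apply: ler_sum => i iL.
by rewrite (big_pred1 (Ordinal (km i iL))).
Qed.

Lemma diamC_set0 : diamC (set0 : set C) = 0.
Proof.
rewrite /diamC (_ : [set _ | _ in _ & _ in _] = set0) ?sup0 //.
by apply/seteqP; split => // z [x []].
Qed.

Lemma diamC_ge0 (U : set C) : 0 <= diamC U.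
Proof.
rewrite /diamC; set D := [set _ | _ in _ & _ in _].
have [hs|hs] := pselect (has_sup D); last by rewrite sup_out.
have [[d [x Ux [y Uy xy]]] hub] := hs.
by apply: (le_trans (cabs_ge0 (x - y))); apply: (ub_le_sup hub); exists x => //; exists y.
Qed.

Lemma diamC_le (U : set C) (d : R) : 0 <= d ->
  (forall x y, U x -> U y -> cabs (x - y) <= d) -> diamC U <= d.
Proof.
move=> d0 h; have [->|/set0P[z Uz]] := eqVneq U set0; first by rewrite diamC_set0.
apply: ge_sup; first by exists (cabs (z - z)); exists z => //; exists z.
by move=> _ [x Ux [y Uy <-]]; exact: h.
Qed.

Lemma le_diamC (U : set C) (d : R) x y : (forall x y, U x -> U y -> cabs (x - y) <= d) ->
  U x -> U y -> cabs (x - y) <= diamC U.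
Proof.
move=> h Ux Uy; apply: ub_le_sup; last by exists x => //; exists y.
by exists d => _ [x' Ux' [y' Uy' <-]]; exact: h.
Qed.

(** Admits covers indexed by a countable type. Numbers that code no index in [P] receive the empty
    set, whose contribution 0^s vanishes because s > 0. *)
Lemma hausdorff_pre_cover (I : countType) (A : set C) (V : I -> set C) (P : pred I) (s d e : R) :
  0 < s -> 0 <= d -> (forall z, A z -> exists2 i, P i & V i z) ->
  (forall i x y, P i -> V i x -> V i y -> cabs (x - y) <= d) ->
  (forall L, uniq L -> all P L -> \sum_(i <- L) diamC (V i) `^ s <= e) ->
  (hausdorff_pre s d A <= e%:E)%E.
Proof.
move=> s0 d0 hA hd hs.
pose U n := if @pickle_inv I n is Some i then (if P i then V i else set0) else set0.
apply: (@le_trans _ _ (\sum_(0 <= n <oo) ((diamC (U n)) `^ s)%:E)%E).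
  apply: ereal_inf_lbound; exists U => //; split.
    move=> z /hA[i Pi Vi]; exists (pickle i) => //.
    by rewrite /U pickleK_inv Pi.
  move=> n x y; rewrite /U; case: pickle_inv => // i; case: ifP => // Pi.
  exact: hd.
apply: lime_le.
  by apply: is_cvg_nneseries => n _ _; rewrite lee_fin powR_ge0.
apply: nearW => n; rewrite sumEFin lee_fin.
pose L := [seq i <- pmap (@pickle_inv I) (index_iota 0 n) | P i].
have uL : uniq L.
  apply: filter_uniq; apply: (pmap_uniq (@pickle_invK I)); exact: iota_uniq.
apply: le_trans (hs L uL (filter_all _ _)).
rewrite /L big_filter [leRHS]big_mkcond [leRHS]big_pmap; apply: ler_sum => k _.
rewrite /U; case: pickle_inv => [i|] /=; last by rewrite diamC_set0 powR0 // gt_eqF.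
by case: ifP => //; rewrite diamC_set0 powR0 // gt_eqF.
Qed.

Lemma hausdorff_measure0 (s : R) (A : set C) :
  (forall d e : R, 0 < d -> 0 < e -> (hausdorff_pre s d A <= e%:E)%E) ->
  hausdorff_measure s A = 0%E.
Proof.
move=> h; apply/eqP; rewrite eq_le; apply/andP; split.
  apply: ge_ereal_sup => _ [d d0 <-]; apply/lee_addgt0Pr => e e0.
  by rewrite add0e; exact: h.
apply: le_trans (_ : _ <= hausdorff_pre s 1 A)%E _.
  apply: le_ereal_inf_tmp => _ [U _ <-]; apply: nneseries_ge0 => n _ _.
  by rewrite lee_fin powR_ge0.
by apply: ereal_sup_ubound; exists 1 => //; exact: ltr01.
Qed.

Lemma small_covers (s d e : R) (A : set C) : hausdorff_measure s A = 0%E -> 0 < d -> 0 < e ->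
  exists U : nat -> set C, [/\ A `<=` \bigcup_i U i,
    forall i x y, U i x -> U i y -> cabs (x - y) <= d &
    forall n, \sum_(i < n) diamC (U i) `^ s <= e].
Proof.
move=> hA d0 e0; have : (hausdorff_pre s d A < e%:E)%E.
  apply: (@le_lt_trans _ _ 0%E); last by rewrite lte_fin.
  by rewrite -hA; apply: ereal_sup_ubound; exists d.
move=> /ereal_inf_lt[_ [U [UA Ud] <-] hU]; exists U; split => // n.
rewrite -lee_fin; apply: le_trans (ltW hU).
rewrite -sumEFin -(big_mkord xpredT (fun i => (diamC (U i) `^ s)%:E)).
by apply: nneseries_lim_ge => k _ _; rewrite lee_fin powR_ge0.
Qed.

Lemma unit_interval_cover (x w : nat -> R) (E : R) : (forall i, 0 <= w i) ->
  (forall t, 0 <= t < 1 -> exists i, `|t - x i| <= w i) ->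
  (forall n, \sum_(i < n) w i <= E) -> 1 <= 2 * E.
Proof.
move=> w0 cov hE.
pose J i : set R := [set` `[x i - w i, x i + w i]].
have mJ i : measurable (J i) by exact: measurable_itv.
have h1 : ((@lebesgue_measure R) [set` `[0%R, 1%R[] <= \sum_(0 <= i <oo) (@lebesgue_measure R) (J i))%E.
  apply: measure_sigma_subadditive => //.
  move=> t; rewrite /= in_itv /= => ht.
  have [i hi] := cov t ht; exists i => //; move: hi; rewrite ler_distl => hi.
  by rewrite /J /= in_itv.
rewrite -lee_fin; apply: le_trans (_ : _ <= (@lebesgue_measure R) [set` `[0%R, 1%R[])%E _.
  by rewrite lebesgue_measure_itv /= lte_fin ltr01 -EFinB subr0.
apply: le_trans h1 _; apply: lime_le.
  by apply: is_cvg_nneseries => n _ _; exact: measure_ge0.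
apply: nearW => n.
have -> : (\sum_(0 <= i < n) (@lebesgue_measure R) (J i) = (\sum_(0 <= i < n) 2 * w i)%:E)%E.
  rewrite -sumEFin; apply: eq_bigr => i _.
  rewrite lebesgue_measure_itv /= lte_fin; case: ifP => hi.
    by rewrite -EFinB; congr (_%:E); ring.
  have := w0 i; rewrite le_eqVlt => /orP[/eqP <-|wi]; first by rewrite mulr0.
  by move: hi; rewrite ltrBlDr -addrA ltrDl addr_gt0.
rewrite lee_fin -mulr_sumr ler_pM2l // big_mkord; exact: hE.
Qed.
End Covers.

(** * Coding by digits and limit sets *)

Section DigitCodes.
Variables (R : realType) (n : nat).
Local Notation C := R[i].
Local Notation q := (fun (t : R) k => Num.truncn (n.+1%:R ^+ k * t)).
Definition digits (t : R) (k : nat) : 'I_n.+1 := inord (q t k.+1 %% n.+1).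

Lemma truncn_digit (t : R) k : 0 <= t -> q t k.+1 = (n.+1 * q t k + digits t k)%N.
Proof.
move=> t0; have x0 : 0 <= n.+1%:R ^+ k * t by rewrite mulr_ge0 ?exprn_ge0.
have y0 : 0 <= n.+1%:R ^+ k.+1 * t by rewrite mulr_ge0 ?exprn_ge0.
have n0 : 0 < n.+1%:R :> R by rewrite ltr0n.
rewrite /digits inordK ?ltn_pmod // {1}(divn_eq (q t k.+1) n.+1) mulnC; congr (n.+1 * _ + _)%N.
apply/esym/eqP; rewrite /= truncn_eq //.
have /andP[h1 h2] := truncn_itv y0; rewrite exprS -mulrA in h1 h2 *.
set Q := Num.truncn _ in h1 h2 *; set x := n.+1%:R ^+ k * t in x0 h1 h2 *.
apply/andP; split.
  rewrite -(ler_pM2l n0) -natrM; apply: le_trans h1.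
  by rewrite ler_nat mulnC leq_divM.
rewrite -(ltr_pM2l n0) -natrM; apply: lt_le_trans h2 _.
by rewrite ler_nat mulnC ltn_ceil.
Qed.

Lemma digits_close (t t' : R) K : 0 <= t < 1 -> 0 <= t' < 1 ->
  (forall j, (j < K)%N -> digits t j = digits t' j) -> n.+1%:R ^+ K * `|t - t'| <= 1.
Proof.
move=> /andP[t0 t1] /andP[t'0 t'1] E.
have qE : q t K = q t' K.
  elim: K E => [|K IH] E.
    by rewrite /= !expr0 !mul1r; apply/eqP; rewrite truncn_eq // (_ : Num.truncn t' = 0%N);
      [apply/andP; split|apply: truncn_def; apply/andP; split].
  by rewrite !truncn_digit // (IH (fun j jK => E j (ltnW jK))) (E K).
have N0 : 0 <= n.+1%:R ^+ K :> R by rewrite exprn_ge0.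
have /andP[h1 h2] := truncn_itv (mulr_ge0 N0 t0).
have /andP[h3 h4] := truncn_itv (mulr_ge0 N0 t'0).
rewrite /= in qE; rewrite qE in h1 h2.
rewrite -[X in X * _](ger0_norm N0) -normrM mulrBr ler_norml.
set X := _ * t in h1 h2 *; set Y := _ * t' in h1 h2 h3 h4 *.
by rewrite -natr1 in h2; rewrite -natr1 in h4; lra.
Qed.

(* The inverse of the coding is Hoelder of exponent [s], so a cover of the coded
   set yields a cover of [[0, 1)] by intervals of comparable total length. *)
Lemma coded_set_measure (z : (nat -> 'I_n.+1) -> C) (A : set C) (s r rho : R) :
  0 < s -> 0 < r < 1 -> 0 < rho -> 1 <= n.+1%:R * r `^ s ->
  (forall c, A (z c)) ->
  (forall c c' K, (exists2 j, (j <= K)%N & c j != c' j) -> rho * r ^+ K <= cabs (z c - z c')) ->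
  hausdorff_measure s A <> 0%E.
Proof.
move=> s0 /andP[r0 r1] rho0 nr Az sep h0.
have rs0 : 0 < rho `^ s by rewrite powR_gt0.
(* The cover is so economical that the induced intervals have radii of sum at most 1/4, hence total
   length at most 1/2, too little for [0, 1). *)
have [||U [UA Ud Us]] := @small_covers R s 1 (rho `^ s / 4) A h0.
- exact: ltr01.
- by rewrite divr_gt0.
pose zt t := z (digits t).
pose V i := [set t : R | 0 <= t < 1 /\ U i (zt t)].
pose x i := xget 0 (V i).
pose w i := (diamC (U i) / rho) `^ s.
have rs1 : r `^ s < 1.
  by have := gt0_ltr_powR s0 (x := r) (y := 1); rewrite powR1; apply; rewrite ?nnegrE ?ler01 ?(ltW r0).
have n1 : 1 < n.+1%:R :> R.
  apply: le_lt_trans nr _; rewrite -[X in _ < X]mulr1 ltr_pM2l //.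
(* Parameters with equal digits coincide. Otherwise the first differing digit [K1] gives |t - t'| <=
   (n + 1)^-K1 <= r^(s K1), and the separation hypothesis bounds r^K1 by the diameter over [rho]. *)
have close i t t' : V i t -> V i t' -> `|t - t'| <= w i.
  move=> [t01 Ut] [t'01 Ut'].
  have [[K]|/forallNP same] := pselect (exists K, digits t K != digits t' K); last first.
    suff -> : `|t - t'| = 0 by exact: powR_ge0.
    apply/eqP; apply: contraT => tt; have e0 : 0 < `|t - t'| by rewrite lt_neqAle eq_sym tt normr_ge0.
    have [k hk] := @expr_lt_eps R (n.+1%:R)^-1 `|t - t'| ltac:(by rewrite invr_ge0 ler0n invf_lt1) e0.
    have := @digits_close t t' k t01 t'01 (fun j _ => ltac:(by apply/eqP; apply: contraT => /same)).
    move: hk; rewrite exprVn -[X in X < _]mul1r ltr_pdivrMr ?exprn_gt0 // mulrC.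
    by move=> h1 h2; have := lt_le_trans h1 h2; rewrite ltxx.
  move=> exK; pose K1 := ex_minn (ex_intro (fun k => digits t k != digits t' k) K exK).
  have [dK minK] : digits t K1 != digits t' K1 /\ forall j, (j < K1)%N -> digits t j = digits t' j.
    rewrite /K1; case: ex_minnP => m hm mmin; split => // j jm.
    by apply/eqP; apply: contraT => /mmin; rewrite leqNgt jm.
  have h1 := digits_close t01 t'01 minK.
  have h2 : rho * r ^+ K1 <= cabs (zt t - zt t') by apply: sep; exists K1.
  have h3 := le_trans h2 (le_diamC (Ud i) Ut Ut').
  apply: (@le_trans _ _ ((r ^+ K1) `^ s)); last first.
    apply: ge0_ler_powR; rewrite ?nnegrE ?(ltW s0) ?exprn_ge0 ?(ltW r0) ?divr_ge0 ?diamC_ge0 ?(ltW rho0) //.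
    by rewrite ler_pdivlMr // mulrC.
  rewrite powR_exprn ?(ltW r0) //.
  have N0 : 0 < n.+1%:R ^+ K1 :> R by rewrite exprn_gt0.
  rewrite -(ler_pM2l N0); apply: le_trans h1 _.
  by rewrite -exprMn exprn_ege1.
have := @unit_interval_cover R x w 4^-1 _ _ _ => hcov.
have : 1 <= 2 * 4^-1 :> R.
  apply: hcov => [i|t t01|m]; first exact: powR_ge0.
    have [i _ Ui] := UA _ (Az (digits t)); exists i; apply: close => //.
    by rewrite /x; case: xgetP => [y _ //|/(_ t)[]].
  apply: (@le_trans _ _ (\sum_(i < m) (rho `^ s)^-1 * diamC (U i) `^ s)).
    apply: ler_sum => i _; rewrite /w powRM ?diamC_ge0 ?invr_ge0 ?(ltW rho0) //.
    by rewrite -powR_inv1 ?(ltW rho0) // -powRrM mulN1r powRN mulrC.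
  by rewrite -mulr_sumr mulrC ler_pdivrMr // mulrC; exact: Us.
lra.
Qed.
End DigitCodes.

Section LimitSet.
Variables (R : realType) (n : nat) (G : 'I_n -> R[i] -> R[i]) (B : set R[i]).
Local Notation C := R[i].
Local Notation H := (@Hright R).
Variables (a r dl Delta : R) (b0 : C).
Hypotheses (a0 : 0 < a) (r01 : 0 < r < 1) (dl0 : 0 < dl) (dla : dl <= a).
Hypotheses (hG : forall i, hol H (G i)) (iG : forall i, inj_on H (G i)) (GH : forall i x, H x -> H (G i x)).
Hypotheses (Ba : forall x, B x -> a <= complex.Re x) (kB : kconvex B) (GB : forall i x, B x -> B (G i x)).
Hypothesis contr : forall i x y, B x -> B y -> cabs (G i x - G i y) <= 2^-1 * cabs (x - y).
Hypothesis derG : forall i x, B x -> r <= cabs ('D_1 (G i) x).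
Hypothesis diamB : forall x y, B x -> B y -> cabs (x - y) <= Delta.
Hypothesis Bb0 : B b0.
Hypothesis sepG : forall i j x y, i != j -> B x -> B y -> dl <= cabs (G i x - G j y).
Implicit Types (c : nat -> 'I_n).

(** [c 0] is the outermost map, so dropping the first digit of a code amounts to one forward step of
    the dynamics. *)
Fixpoint Gam c k x := if k is k'.+1 then G (c 0%N) (Gam (c \o succn) k' x) else x.

Lemma BH x : B x -> H x. Proof. by move=> /Ba; exact: lt_le_trans. Qed.
Lemma Gam_H c k x : H x -> H (Gam c k x).
Proof. by elim: k c => //= k IH c Hx; apply: GH; exact: IH. Qed.
Lemma Gam_B c k x : B x -> B (Gam c k x).
Proof. by elim: k c => //= k IH c Bx; apply: GB; exact: IH. Qed.
Lemma Gam_hol c k : hol H (Gam c k).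
Proof.
elim: k c => [|k IH] c; first exact: hol_id.
by apply: (@hol_comp R H H (G (c 0%N))) => // z; exact: Gam_H.
Qed.
Lemma Gam_inj c k : inj_on H (Gam c k).
Proof.
elim: k c => [|k IH] c x y Hx Hy //= E.
by apply: (IH (c \o succn)) => //; apply: iG E; exact: Gam_H.
Qed.
Lemma Gam_contr c k x y : B x -> B y -> cabs (Gam c k x - Gam c k y) <= 2^-1 ^+ k * cabs (x - y).
Proof.
elim: k c => [|k IH] c Bx By; first by rewrite mul1r.
apply: le_trans (contr _ (Gam_B _ _ Bx) (Gam_B _ _ By)) _.
by rewrite exprS -mulrA ler_pM2l ?invr_gt0 //; exact: IH.
Qed.
Lemma Gam_der c k x : B x -> r ^+ k <= cabs ('D_1 (Gam c k) x).
Proof.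
have /andP[r0 _] := r01.
move=> Bx; elim: k c => [|k IH] c.
  by rewrite (cder_val (gder_id id x)) cabs1.
have d1 := hol_cder (@Gam_hol (c \o succn) k) (BH Bx).
have d2 := hol_cder (hG (c 0%N)) (Gam_H (c \o succn) k (BH Bx)).
have d3 := gder_comp d2 d1.
rewrite (cder_val d3) cabsM exprS; apply: ler_pM; rewrite ?exprn_ge0 ?(ltW r0) //.
by apply: derG; exact: Gam_B.
Qed.
Lemma Gam_congr c c' k x : (forall j, (j < k)%N -> c j = c' j) -> Gam c k x = Gam c' k x.
Proof.
elim: k c c' => //= k IH c c' E; rewrite (E 0%N) //; congr (G _ _).
by apply: IH => j jk; exact: E.
Qed.
Lemma Gam_rcons c k x : Gam c k.+1 x = Gam c k (G (c k) x).
Proof. by elim: k c x => //= k IH c x; rewrite -IH. Qed.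

Lemma limit_ex c : exists p, forall k, cabs (Gam c k b0 - p) <= 4 * Delta * 2^-1 ^+ k.
Proof.
have [||p hp] := @geometric_limit R (fun k => Gam c k b0) Delta 2^-1.
- by lra.
- move=> k; rewrite Gam_rcons; have := @Gam_contr c k (G (c k) b0) b0 (GB _ Bb0) Bb0.
  move=> /le_trans; apply; rewrite mulrC; apply: ler_wpM2r; first by rewrite exprn_ge0.
  by apply: diamB => //; exact: GB.
- exists p => k; apply: le_trans (hp k) _; rewrite le_eqVlt; apply/orP; left; apply/eqP.
  by field.
Qed.
Definition limit_pt c : C := xget 0 [set p | forall k, cabs (Gam c k b0 - p) <= 4 * Delta * 2^-1 ^+ k].
Lemma limit_ptP c k : cabs (Gam c k b0 - limit_pt c) <= 4 * Delta * 2^-1 ^+ k.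
Proof.
by rewrite /limit_pt; case: xgetP => [p _ /(_ k) //|no]; have [p /no] := limit_ex c.
Qed.
Lemma Delta_ge0 : 0 <= Delta.
Proof. by have := diamB Bb0 Bb0; rewrite subrr cabs0. Qed.
Lemma limit_small (e : R) : 0 < e -> exists k, 4 * Delta * 2^-1 ^+ k < e.
Proof.
move=> e0; have D0 := Delta_ge0; have D1 : 0 < 4 * Delta + 1 by lra.
have [k hk] := @expr_lt_eps R 2^-1 (e / (4 * Delta + 1)) ltac:(lra) (divr_gt0 e0 D1).
exists k; move: hk; rewrite ltr_pdivlMr // mulrC; apply: le_lt_trans.
by apply: ler_wpM2r; [rewrite exprn_ge0|lra].
Qed.
Lemma limit_B c : B (limit_pt c).
Proof.
apply: kB.2 => e e0; have [k hk] := limit_small e0.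
exists (Gam c k b0); first exact: Gam_B.
by rewrite cabsC; apply: le_lt_trans (limit_ptP c k) hk.
Qed.
Lemma limit_shift c : limit_pt c = G (c 0%N) (limit_pt (c \o succn)).
Proof.
apply: cabs_eq_limit => e e0; have [k hk] := @limit_small (e / 2) ltac:(lra).
have D0 := Delta_ge0.
have h1 := limit_ptP c k.+1; rewrite cabsC in h1.
have h2 : cabs (Gam c k.+1 b0 - G (c 0%N) (limit_pt (c \o succn))) <= 4 * Delta * 2^-1 ^+ k.
  apply: le_trans (contr _ (Gam_B _ _ Bb0) (limit_B _)) _.
  apply: le_trans (limit_ptP (c \o succn) k); apply: ler_piMl; [exact: cabs_ge0|lra].
have h3 : 4 * Delta * 2^-1 ^+ k.+1 <= 4 * Delta * 2^-1 ^+ k.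
  by apply: ler_wpM2l; [lra|rewrite exprS; apply: ler_piMl; [rewrite exprn_ge0|lra]].
by have := cabsB_tri (limit_pt c) (Gam c k.+1 b0) (G (c 0%N) (limit_pt (c \o succn))); lra.
Qed.
Lemma limit_Gam c k : limit_pt c = Gam c k (limit_pt (fun j => c (k + j)%N)).
Proof.
elim: k c => [|k IH] c //=.
by rewrite limit_shift (IH (c \o succn)).
Qed.

(** The common prefix, of length m <= K, is one univalent composition, and [sepG] separates the
    tails. Koebe's covering carries this over to the images at scale |G'| >= r^m >= r^K; contraction
    alone would give only upper bounds. *)
Lemma limit_sep c c' K : (exists2 j, (j <= K)%N & c j != c' j) ->
  dl / 160 * r ^+ K <= cabs (limit_pt c - limit_pt c').
Proof.
have /andP[r0 r1] := r01.
move=> [j jK hj]; have ex : exists k, c k != c' k by exists j.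
case: (ex_minnP ex) => m hm mmin.
have mK : (m <= K)%N by apply: leq_trans (mmin _ hj) jK.
have E : forall i, (i < m)%N -> c i = c' i.
  by move=> i im; apply/eqP; apply: contraT => /mmin; rewrite leqNgt im.
rewrite (limit_Gam c m) (limit_Gam c' m) (Gam_congr (c := c') (c' := c)); last by move=> i /E.
set x := limit_pt _; set y := limit_pt _.
have Bx : B x by exact: limit_B.
have By : B y by exact: limit_B.
have xy : dl <= cabs (x - y).
  rewrite /x /y limit_shift [X in _ - X]limit_shift /=; apply: sepG; rewrite ?addn0 //; exact: limit_B.
have := univalent_sep (@Gam_hol c m) (@Gam_inj c m) dl0 (le_trans dla (Ba Bx)) (BH By).
rewrite cabsC => /(_ xy); rewrite cabsC; apply: le_trans.
rewrite mulrAC; apply: ler_wpM2r; first by rewrite invr_ge0 ler0n.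
apply: ler_wpM2l; first exact: ltW.
apply: le_trans (@Gam_der c m x Bx).
by apply: ler_wiXn2l; rewrite ?(ltW r0) ?(ltW r1).
Qed.
End LimitSet.

(** * Sums over words *)

Section WordSums.
Variables (R : realType) (N : nat) (u : 'I_N -> R[i] -> R[i]) (a : R).
Local Notation C := R[i].
Local Notation H := (@Hright R).
Local Notation wder := (wder u).
Local Notation wmap := (wmap u).
Local Notation kap := (kap a).
Variables (h K q : R) (x0 : C) (S : nat -> R).
Hypotheses (hL : log_branches u a) (h0 : 0 < h) (K0 : 0 < K) (q0 : 0 < q).
Hypothesis hK : forall (L : seq (letter N)) x, uniq L -> a <= complex.Re x ->
    \sum_(i <- L) cabs (dgm u i x) `^ h <= K * (complex.Re x) `^ (- q).
Hypothesis ax0 : a <= complex.Re x0.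
Definition nwords n (W : seq (seq (letter N))) := uniq W /\ forall s, s \in W -> size s = n.
Hypotheses (S0 : forall n, 0 < S n)
  (S_ub : forall n W, nwords n W -> \sum_(s <- W) cabs (wder s x0) `^ h <= S n)
  (S_lb : forall n, exists2 W, nwords n W & S n / 2 <= \sum_(s <- W) cabs (wder s x0) `^ h)
  (S_lim : ln (S n) / n%:R @[n --> \oo] --> (0 : R)).

Lemma a_gt0 : 0 < a. Proof. by case: hL. Qed.
Lemma Hx0 : H x0. Proof. exact: lt_le_trans a_gt0 ax0. Qed.

(** Vanishing pressure enters the estimates in this form: [S] neither grows nor decays
    exponentially. *)
Lemma S_growth (th : R) : 0 < th < 1 -> exists n0, forall n, (n0 <= n)%N ->
  th ^+ n <= S n <= th ^- n.
Proof.
move=> /andP[t0 t1]; have l0 : 0 < - ln th by rewrite oppr_gt0 ln_lt0 // t0.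
have /cvgrPdist_lt /(_ _ l0) [n0 _ hn] := S_lim.
exists n0.+1 => n n0n; have nn : (0 < n)%N by apply: leq_trans n0n.
have := hn n (ltnW n0n); rewrite /= sub0r normrN normrM normfV.
have n1 : 0 < n%:R :> R by rewrite ltr0n.
rewrite [X in _ / X]gtr0_norm // ltr_pdivrMr // => /ltW; rewrite ler_norml.
have tn : th ^+ n = expR (ln th * n%:R) by rewrite -[in LHS](lnK (x := th)) ?posrE // -expRM_natr.
rewrite tn -expRN -[S n in X in _ -> X](lnK (x := S n)) ?posrE ?S0 // !ler_expR.
by rewrite mulNr opprK.
Qed.

Lemma one_letter_sums (T : seq (seq (letter N))) y : uniq T -> (forall t, t \in T -> size t = 1%N) ->
  a <= complex.Re y -> \sum_(t <- T) cabs (wder t y) `^ h <= K * (complex.Re y) `^ (- q).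
Proof.
move=> uT hT ay.
have TE : T = [seq [:: i] | i <- pmap ohead T].
  elim: T hT {uT} => //= t T IH hT; have := hT t (mem_head _ _).
  case: t hT => [|i []] //= hT _; congr cons; apply: IH => t tT.
  by apply: hT; rewrite inE tT orbT.
have uP : uniq (pmap ohead T) by move: uT; rewrite {1}TE => /map_uniq.
rewrite TE big_map; apply: le_trans (hK uP ay).
by apply: ler_sum => i _; rewrite /= mul1r.
Qed.

(** The outermost letter is split off and summed at the endpoint [wmap s x0] of the remaining word,
    where the decay of the one-letter sums in the real part takes effect. *)
Lemma prefix_sums n W : nwords n.+1 W -> exists2 V, nwords n V &
  \sum_(w <- W) cabs (wder w x0) `^ h <=
  \sum_(s <- V) cabs (wder s x0) `^ h * (K * (complex.Re (wmap s x0)) `^ (- q)).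
Proof.
move=> [uW hW]; exists (undup [seq take n w | w <- W]).
  split; first exact: undup_uniq.
  by move=> s; rewrite mem_undup => /mapP[w /hW wn ->]; rewrite size_takel // wn.
set V := undup _.
apply: le_trans (_ : _ <= \sum_(s <- V) \sum_(w <- W | take n w == s) cabs (wder w x0) `^ h) _.
  rewrite [leRHS](exchange_big_dep xpredT) //=.
  rewrite [leLHS]big_seq [leRHS]big_seq; apply: ler_sum => w wW.
  have tV : take n w \in V by rewrite mem_undup; apply/mapP; exists w.
  rewrite big_mkcond (bigD1_seq (take n w)) ?undup_uniq //= eqxx lerDl.
  by apply: sumr_ge0 => s _; case: ifP => // _; exact: powR_ge0.
apply: ler_sum => s _; have [sV|/negP sV] := boolP (a <= complex.Re (wmap s x0)); last first.
  exfalso; apply: sV; case: s => // i s; apply/ltW; apply: (wmap_gt hL) => //; exact: Hx0.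
pose T := [seq drop n w | w <- W & take n w == s].
have uT : uniq T.
  rewrite map_inj_in_uniq ?filter_uniq // => w w'; rewrite !mem_filter => /andP[/eqP e _] /andP[/eqP e' _] E.
  by rewrite -[w](cat_take_drop n) e E -e' cat_take_drop.
have hT t : t \in T -> size t = 1%N.
  by move=> /mapP[w]; rewrite mem_filter => /andP[_ /hW wn] ->; rewrite size_drop wn subSnn.
have := one_letter_sums uT hT sV; rewrite /T big_map big_filter => hs.
rewrite (eq_bigr (fun w => cabs (wder s x0) `^ h * cabs (wder (drop n w) (wmap s x0)) `^ h)); last first.
  move=> w /eqP e; rewrite -powRM ?cabs_ge0 // -cabsM; congr (cabs _ `^ h).
  by rewrite -{1}[w](cat_take_drop n) e wder_cat mulrC.
by rewrite -mulr_sumr; apply: ler_wpM2l => //; exact: powR_ge0.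
Qed.

Lemma powRN_le (x y : R) : 0 < x -> x <= y -> y `^ (- q) <= x `^ (- q).
Proof.
move=> x_gt0 xy; have y_gt0 : 0 < y by exact: lt_le_trans xy.
rewrite !powRN lef_pV2 ?posrE ?powR_gt0 //.
by apply: ge0_ler_powR; rewrite ?nnegrE ?(ltW q0) ?(ltW x_gt0) ?(ltW y_gt0).
Qed.

(* Words ending far to the right have few continuations: if they carried
   nearly all of [S n] for all large [n], then [S] would halve at each step. *)
Lemma recurrent_words : exists R0 dl : R, 0 < dl /\ forall n0, exists2 n, (n0 <= n)%N &
  exists2 V, nwords n V & (forall s, s \in V -> complex.Re (wmap s x0) <= R0) /\
    dl * S n <= \sum_(s <- V) cabs (wder s x0) `^ h.
Proof.
have a0 := a_gt0; pose A := K * a `^ (- q).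
have A0 : 0 < A by rewrite mulr_gt0 // powR_gt0.
(* Right of [R0] the one-step factor is at most 1/8, and elsewhere at most [A]. Two contributions of
   S n / 8 and the factor 2 lost in [S_lb] give S n.+1 <= S n / 2, against the lower growth bound
   for 3/4. *)
pose R0 := (8 * K) `^ q^-1.
have K8 : 0 < 8 * K by rewrite mulr_gt0.
have R00 : 0 < R0 by rewrite powR_gt0.
have hR0 : K * R0 `^ (- q) = 8^-1.
  by rewrite /R0 -powRrM mulrN mulVf ?gt_eqF // powR_inv1 ?ltW //; field; rewrite gt_eqF.
exists R0, (8 * A)^-1; split; first by rewrite invr_gt0 mulr_gt0.
apply: contrapT => /existsNP[n0 hn0].
have half n : (n0 <= n)%N -> S n.+1 <= S n / 2.
  move=> n0n; have [W hW SW] := S_lb n.+1.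
  have [V hV WV] := prefix_sums hW.
  pose V1 := [seq s <- V | complex.Re (wmap s x0) <= R0].
  have hV1 : nwords n V1.
    by case: hV => uV hV; split; [exact: filter_uniq|move=> s; rewrite mem_filter => /andP[_ /hV]].
  have small : \sum_(s <- V1) cabs (wder s x0) `^ h < (8 * A)^-1 * S n.
    rewrite ltNge; apply/negP => hh; apply: hn0; exists n => //; exists V1 => //; split => //.
    by move=> s; rewrite mem_filter => /andP[].
  have b1 : \sum_(s <- V) cabs (wder s x0) `^ h * (K * (complex.Re (wmap s x0)) `^ (- q)) <=
     A * (\sum_(s <- V1) cabs (wder s x0) `^ h) + 8^-1 * \sum_(s <- V) cabs (wder s x0) `^ h.
    rewrite /V1 big_filter [X in A * X]big_mkcond !mulr_sumr -big_split /=.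
    apply: ler_sum => s _; have p0 := powR_ge0 (cabs (wder s x0)) h.
    have as0 : a <= complex.Re (wmap s x0).
      case: s {p0} => // i s; apply/ltW; apply: (wmap_gt hL) => //; exact: Hx0.
    case: ifP => [_|/negbT].
      rewrite mulrC -[leLHS]addr0; apply: lerD; last by rewrite mulr_ge0 // invr_ge0.
      by apply: ler_wpM2r => //; apply: ler_wpM2l; [exact: ltW|exact: powRN_le].
    rewrite -ltNge => /ltW Rs; rewrite mulr0 add0r mulrC -hR0.
    by apply: ler_wpM2r => //; apply: ler_wpM2l; [exact: ltW|exact: powRN_le].
  have b2 := S_ub hV.
  have b3 : A * (\sum_(s <- V1) cabs (wder s x0) `^ h) <= 8^-1 * S n.
    apply: le_trans (_ : _ <= A * ((8 * A)^-1 * S n)) _.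
      by apply: ler_wpM2l; exact: ltW.
    by rewrite le_eqVlt; apply/orP; left; apply/eqP; field; rewrite gt_eqF.
  lra.
have geo k : S (n0 + k) <= S n0 * 2^-1 ^+ k.
  elim: k => [|k IH]; first by rewrite addn0 expr0 mulr1.
  rewrite addnS; apply: le_trans (half _ (leq_addr _ _)) _.
  by rewrite exprSr mulrA ler_pM2r.
have [n1 hn1] := @S_growth (3 / 4) ltac:(lra).
have th0 : 0 < (3 / 4 : R) by lra.
pose e : R := (3 / 4) ^+ n0 / S n0.
have e0 : 0 < e by rewrite divr_gt0 // exprn_gt0.
have [k hk] := @expr_lt_eps_all R (2 / 3) e ltac:(lra) e0.
have := hk (k + n1)%N (leq_addr _ _).
have h2 := geo (k + n1)%N.
have /andP[h3 _] := hn1 (n0 + (k + n1))%N ltac:(by rewrite !addnA leq_addl).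
apply/negP; rewrite -leNgt /e ler_pdivrMr //.
have t0 : 0 < (3 / 4) ^+ (k + n1) :> R by rewrite exprn_gt0.
rewrite -(ler_pM2r t0) -exprD; apply: le_trans (le_trans h3 h2) _.
rewrite mulrAC -exprMn mulrC (_ : 2 / 3 * (3 / 4) = 2^-1 :> R) //.
by field.
Qed.

(* [|wder s| <= Q * kap ^ size s], so raising the exponent from [h] to [t]
   gains a factor exponentially small in the length. *)
Lemma large_word_sums (t e : R) : h < t -> 0 < e -> exists n0, forall L, uniq L ->
  all (fun s => n0 <= size s)%N L -> \sum_(s <- L) cabs (wder s x0) `^ t <= e.
Proof.
move=> ht e0; have /andP[k0 k1] := kap01 hL.
have r0 : 0 < complex.Re x0 by exact: Hx0.
pose ka := kap `^ (t - h).
have ka0 : 0 < ka by rewrite powR_gt0.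
have ka1 : ka < 1.
  have th0 : 0 < t - h by rewrite subr_gt0.
  have := gt0_ltr_powR th0 (x := kap) (y := 1); rewrite powR1; apply => //.
    by rewrite nnegrE ltW.
  by rewrite nnegrE ler01.
(* Strictly between [ka] and 1, so that the bound [th ^- n] for [S n] loses less than [ka ^+ n]
   gains. *)
pose th := (1 + ka) / 2; have [th0 th1 kth] : [/\ 0 < th, th < 1 & ka < th] by rewrite /th; split; lra.
pose rho := ka / th.
have rho0 : 0 < rho by rewrite divr_gt0.
have rho1 : rho < 1 by rewrite ltr_pdivrMr // mul1r.
pose B := (160 / complex.Re x0 / kap) `^ (t - h).
have B00 : 0 < 160 / complex.Re x0 / kap.
  have c160 : 0 < 160 :> R by rewrite ltr0n.
  exact: divr_gt0 (divr_gt0 c160 r0) k0.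
have B0 : 0 < B by rewrite powR_gt0.
have [n1 hn1] := @S_growth th ltac:(by rewrite th0 th1).
have r1 : 0 < 1 - rho by rewrite subr_gt0.
have e1 : 0 < e * (1 - rho) / B by rewrite divr_gt0 // mulr_gt0.
have [n2 hn2] := @expr_lt_eps_all R rho _ ltac:(by rewrite ltW) e1.
pose n0 := (maxn n1 n2).+1.
have n01 n : (n0 <= n)%N -> [/\ (n1 <= n)%N, (n2 <= n)%N & (0 < n)%N].
  by rewrite /n0 => hn; split; [apply: leq_trans (leq_maxl n1 n2) (ltnW hn)|
    apply: leq_trans (leq_maxr n1 n2) (ltnW hn)|exact: leq_trans hn].
exists n0; pose b n := if (n < n0)%N then 0 else B * rho ^+ n.
apply: (@group_sum _ _ size _ _ b) => [s|n L uL hL'|m].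
- exact: powR_ge0.
- rewrite /b; case: ltnP => hn.
    rewrite big_seq big1 // => s /hL' [hs sn]; move: hs; rewrite /= sn leqNgt hn //.
  have [h1 h2 h3] := n01 n hn.
  have one s : s \in L -> cabs (wder s x0) `^ t <= B * ka ^+ n * cabs (wder s x0) `^ h.
    move=> /hL' [_ sn]; have d0 := wder_gt0 hL s Hx0.
    have -> : cabs (wder s x0) `^ t = cabs (wder s x0) `^ (t - h) * cabs (wder s x0) `^ h.
      by rewrite -powRD ?subrK //; apply/implyP => _; rewrite gt_eqF.
    apply: ler_wpM2r; first exact: powR_ge0.
    rewrite /ka -powR_exprn ?(ltW k0) //.
    have b1 : 0 <= kap ^+ n by exact: exprn_ge0 (ltW k0).
    have b2 := mulr_ge0 (ltW B00) b1.
    rewrite -powRM //; last exact: ltW.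
    apply: ge0_ler_powR; rewrite ?nnegrE ?cabs_ge0 //; first by rewrite subr_ge0 ltW.
    have s0 : s != [::] by case: (s) sn h3 => // <-.
    have := wder_log hL s0 Hx0; rewrite sn => hw.
    rewrite -(ler_pM2l r0); apply: le_trans hw _.
    rewrite -{2}(prednK h3) exprS le_eqVlt; apply/orP; left; apply/eqP; field.
    by rewrite !gt_eqF.
  rewrite big_seq; apply: le_trans (ler_sum _ one) _; rewrite -big_seq -mulr_sumr.
  have nL : nwords n L by split => // s /hL' [].
  apply: le_trans (_ : _ <= B * ka ^+ n * th ^- n) _.
    apply: ler_wpM2l; first by rewrite mulr_ge0 ?exprn_ge0 ?ltW.
    by apply: le_trans (S_ub nL) _; have /andP[] := hn1 n h1.
  by rewrite /rho (expr_div_n ka th n) mulrA.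
(* The remaining geometric tail is kept on the left-hand side as the slack of the induction. *)
- have claim : \sum_(0 <= n < m) b n + B * rho ^+ (maxn m n0) / (1 - rho) <= B * rho ^+ n0 / (1 - rho).
    elim: m => [|m IH]; first by rewrite big_geq // add0r max0n.
    rewrite big_nat_recr //= {2}/b; case: ltnP => hm.
      by rewrite (maxn_idPr hm) addr0; move: IH; rewrite (maxn_idPr (ltnW hm)).
    move: IH; rewrite (maxn_idPl hm) (maxn_idPl (leqW hm)); apply: le_trans.
    rewrite -addrA lerD2l exprSr le_eqVlt; apply/orP; left; apply/eqP; field.
    by rewrite gt_eqF.
  have p0 : 0 <= B * rho ^+ (maxn m n0) / (1 - rho).
    by rewrite divr_ge0 ?mulr_ge0 ?exprn_ge0 ?ltW.
  apply: le_trans (_ : _ <= B * rho ^+ n0 / (1 - rho)) _.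
    by apply: le_trans claim; rewrite lerDl.
  have [_ h2 _] := n01 n0 (leqnn _).
  have := hn2 n0 h2; rewrite ltr_pdivlMr // => /ltW hh.
  by rewrite ler_pdivrMr // mulrC.
Qed.
End WordSums.

Lemma hull_cap (R : realType) (U V : set R[i]) : hull_dom U -> hull_dom V -> hull_dom (U `&` V).
Proof.
move=> [oU hU] [oV hV]; split=> [z [/oU[r r0 hr] /oV[s s0 hs]]|x y z [Ux Vx] [Uy Vy] [Uz Vz]].
  exists (Num.min r s); first by rewrite lt_min r0 s0.
  by move=> w; rewrite lt_min => /andP[/hr ? /hs].
have [K [cK KU [Kx Ky Kz]]] := hU _ _ _ Ux Uy Uz.
have [L [cL LV [Lx Ly Lz]]] := hV _ _ _ Vx Vy Vz.
exists (K `&` L); split; [exact: kconvexI| |by split].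
by move=> w [/KU ? /LV].
Qed.

(** * Covers of the radial Julia set *)

Section UpperBound.
Variables (R : realType) (N : nat) (u : 'I_N -> R[i] -> R[i]) (a : R).
Local Notation C := R[i].
Local Notation H := (@Hright R).
Local Notation wder := (wder u).
Local Notation wmap := (wmap u).
Variables (t : R) (x0 : C).
Hypotheses (hL : log_branches u a) (t0 : 0 < t) (ax0 : a <= complex.Re x0).
Hypothesis small_sums : forall e : R, 0 < e -> exists n0, forall L, uniq L ->
  all (fun s : seq (letter N) => n0 <= size s)%N L -> \sum_(s <- L) cabs (wder s x0) `^ t <= e.

(** A closed fundamental domain of exp over the annulus exp a <= |z| <= M. *)
Definition box (M : R) : set C :=
  [set x | [/\ a <= complex.Re x, expR (complex.Re x) <= M & `|complex.Im x| <= pi]].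

Lemma wder_bounded s : cabs (wder s x0) <= 1 + 160 / complex.Re x0.
Proof.
have a0 : 0 < a by case: hL.
have r0 : 0 < complex.Re x0 by exact: lt_le_trans ax0.
have c0 : 0 <= 160 / complex.Re x0 by apply: divr_ge0; [exact: ler0n|exact: ltW].
case: s => [|i s]; first by rewrite /= cabs1 lerDl.
apply: (@le_trans _ _ (160 / complex.Re x0)); last by rewrite lerDr ler01.
have := @wder_log R N u a hL (i :: s) x0 isT r0.
rewrite ler_pdivlMr // mulrC => h1; apply: le_trans h1 _.
have /andP[k0 k1] := kap01 hL.
by apply: ler_piMr; [exact: ler0n|apply: exprn_ile1; exact: ltW].
Qed.

(** The constant must not depend on the word. Distortion on one convex set [U] containing the box
    and [x0] compares all derivatives with [wder s x0]; as these are bounded, the size of exp of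
    [wmap s] on [U] is controlled by its value at a single point. *)
Lemma piece_lipschitz (M : R) : 0 <= M -> exists2 K : R, 0 < K & forall s x y,
  box M x -> box M y -> cabs (cexp (wmap s x)) <= M ->
  cabs (cexp (wmap s x) - cexp (wmap s y)) <= K * cabs (wder s x0).
Proof.
move=> M0; have a0 : 0 < a by case: hL.
have pp := pi_gt0 R.
have r0 : 0 < complex.Re x0 by exact: lt_le_trans ax0.
pose b := a / 2; have b0 : 0 < b by rewrite divr_gt0.
have ba : b < a by rewrite /b; lra.
pose r := M + complex.Re x0 + `|complex.Im x0| + pi + 1.
have rp : 0 < r by rewrite /r; have := normr_ge0 (complex.Im x0); lra.
pose U := [set x : C | b < complex.Re x] `&` disc x0 r.
have hU : hull_dom U by apply: hull_cap; [exact: hull_halfplane|exact: hull_disc].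
have Re_lt (x : R) : expR x <= M -> x <= M.
  by have := expR_ge1Dx x; lra.
have UB x : box M x -> U x.
  move=> [x1 /Re_lt x2 x3]; split; first by rewrite /=; lra.
  rewrite /disc /=; apply: le_lt_trans (cabs_le_ReIm _) _; rewrite ReD ReN ImD ImN.
  have h1 : `|complex.Im x - complex.Im x0| <= `|complex.Im x| + `|complex.Im x0| by exact: ler_normB.
  have h2 : `|complex.Re x - complex.Re x0| <= M + complex.Re x0 by rewrite ler_norml; lra.
  by rewrite /r; lra.
have UH x : U x -> H x by move=> [h1 _]; exact: lt_trans b0 h1.
have [D D0 dU] : exists2 D : R, 0 < D &
    forall s y, U y -> cabs (wder s y) <= D * cabs (wder s x0).
  exists (expR (15000 / b * r)) => [|s y [y1 y2]]; first exact: expR_gt0.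
  apply: le_trans (wder_distortion hL s b0 y1 (lt_le_trans ba ax0)) _.
  apply: ler_wpM2r; first exact: cabs_ge0.
  rewrite ler_expR; apply: ler_wpM2l; last exact: ltW.
  by apply: divr_ge0; [exact: ler0n|exact: ltW].
have dist x y : U x -> U y -> cabs (x - y) <= 2 * r.
  by move=> [_ x1] [_ y1]; have := cabsB_tri x x0 y; rewrite (cabsC x0); rewrite /disc /= in x1 y1; lra.
have [W hW] : exists W : R, forall s, cabs (wder s x0) <= W.
  by exists (1 + 160 / complex.Re x0); exact: wder_bounded.
pose E := M + D * W * (2 * r).
exists (expR E * D * (2 * r)); first by rewrite !mulr_gt0 ?expR_gt0.
move=> s x y Bx By zM; have Ux := UB _ Bx; have Uy := UB _ By.
have w0 : 0 <= D * cabs (wder s x0) by rewrite mulr_ge0 ?cabs_ge0 ?ltW.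
have ReU y' : U y' -> complex.Re (wmap s y') <= E.
  move=> Uy'.
  have h1 : cabs (wmap s y' - wmap s x) <= D * cabs (wder s x0) * cabs (y' - x).
    apply: (mean_value_ineq hU) => // v Uv; exists (wder s v); last exact: dU.
    exact: (cder_wmap hL s (UH _ Uv)).
  have h2 := Re_le_cabs (wmap s y' - wmap s x); rewrite ReD ReN in h2.
  have h3 : complex.Re (wmap s x) <= M by apply: Re_lt; rewrite -cabs_cexp.
  have h4 : D * cabs (wder s x0) * cabs (y' - x) <= D * W * (2 * r).
    apply: ler_pM => //; [exact: cabs_ge0| |exact: dist].
    by apply: ler_wpM2l; [exact: ltW|exact: hW].
  have := ler_norm (complex.Re (wmap s y') - complex.Re (wmap s x)).
  by rewrite /E; lra.
apply: (@le_trans _ _ (expR E * (D * cabs (wder s x0)) * cabs (x - y))).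
  apply: (@mean_value_ineq R U (fun v => cexp (wmap s v))) => // v Uv.
  exists (cexp (wmap s v) * wder s v); first exact: gder_cexp (cder_wmap hL s (UH _ Uv)).
  rewrite cabsM cabs_cexp; apply: ler_pM; rewrite ?expR_ge0 ?cabs_ge0 //; last exact: dU.
  by rewrite ler_expR; exact: ReU.
rewrite [leRHS](_ : _ = expR E * (D * cabs (wder s x0)) * (2 * r)); last by ring.
by apply: ler_wpM2l; [rewrite mulr_ge0 ?expR_ge0|exact: dist].
Qed.

(** [M] depends on the point, so the cover is indexed by pairs of [M] and a word, and level [M] is
    allotted e / 2^(M + 1). *)
Lemma upper_measure0 (A : set C) :
  (forall z, A z -> exists2 M : nat, cabs z <= M%:R & forall n0, exists s, exists2 x,
     (n0 <= size s)%N & box M%:R x /\ z = cexp (wmap s x)) ->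
  hausdorff_measure t A = 0%E.
Proof.
move=> hA; apply: hausdorff_measure0 => d e d0 e0.
have exK (M : nat) : exists k : R, 0 < k /\ forall s x y,
  box M%:R x -> box M%:R y -> cabs (cexp (wmap s x)) <= M%:R ->
  cabs (cexp (wmap s x) - cexp (wmap s y)) <= k * cabs (wder s x0).
  by have [k k0 h] := piece_lipschitz (ler0n R M); exists k.
have [K hK] := choice exK.
have K0 M := (hK M).1.
(* The first entry makes the sum at level [M] small, the second forces every single piece below the
   mesh [d]. *)
pose e1 M := Num.min (e * 2^-1 ^+ M.+1 / (K M) `^ t) ((d / K M) `^ t).
have e10 M : 0 < e1 M.
  by rewrite lt_min powR_gt0 ?divr_gt0 ?mulr_gt0 ?exprn_gt0 ?powR_gt0.
have [n0 hn0] := choice (fun M => small_sums (e10 M)).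
pose V (i : nat * seq (letter N)) := [set z | cabs z <= i.1%:R /\
  exists2 x, box i.1%:R x & z = cexp (wmap i.2 x)].
pose P (i : nat * seq (letter N)) := (n0 i.1 <= size i.2)%N.
have V_lip i z w : V i z -> V i w -> cabs (z - w) <= K i.1 * cabs (wder i.2 x0).
  by move=> [z1 [x Bx zE]] [w1 [y By wE]]; rewrite zE wE; apply: (hK i.1).2; rewrite -?zE.
have V_d i : P i -> K i.1 * cabs (wder i.2 x0) <= d.
  move=> Pi; have := hn0 i.1 [:: i.2] isT; rewrite /= andbT => /(_ Pi).
  rewrite big_cons big_nil addr0 => h1.
  have h2 : cabs (wder i.2 x0) `^ t <= (d / K i.1) `^ t.
    by apply: le_trans h1 _; rewrite /e1 ge_min lexx orbT.
  rewrite mulrC -ler_pdivlMr //; rewrite leNgt; apply/negP => h3.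
  have := gt0_ltr_powR t0 _ _ h3; rewrite !nnegrE cabs_ge0 ltW ?divr_gt0 // => /(_ isT isT).
  by rewrite ltNge h2.
apply: (@hausdorff_pre_cover R (nat * seq (letter N))%type A V P t d e t0 (ltW d0)).
- move=> z /hA[M zM hz]; have [s [x ns [Bx zE]]] := hz (n0 M).
  by exists (M, s) => //; split => //; exists x.
- by move=> i x y /V_d h Vx Vy; apply: le_trans h; exact: V_lip.
- apply: (@group_sum R _ (fun i : nat * seq (letter N) => i.1) P _ (fun M => e * 2^-1 ^+ M.+1)) => [i|M L uL hL'|m].
  + exact: powR_ge0.
  + pose L2 := [seq i.2 | i <- L].
    have uL2 : uniq L2.
      rewrite map_inj_in_uniq // => -[i1 i2] [k1 k2] /hL'[_ /= ->] /hL'[_ /= ->].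
      by move=> /= ->.
    have hs : \sum_(s <- L2) cabs (wder s x0) `^ t <= e1 M.
      apply: hn0 => //; apply/allP => s /mapP[i /hL'[Pi iM] ->].
      by move: Pi; rewrite /P iM.
    apply: (@le_trans _ _ (K M `^ t * \sum_(s <- L2) cabs (wder s x0) `^ t)).
      rewrite /L2 big_map mulr_sumr big_seq [leRHS]big_seq; apply: ler_sum => i /hL'[Pi iM].
      rewrite -powRM ?cabs_ge0 ?(ltW (K0 M)) //.
      apply: ge0_ler_powR; rewrite ?nnegrE ?diamC_ge0 ?mulr_ge0 ?cabs_ge0 ?(ltW (K0 M)) ?(ltW t0) //.
      apply: diamC_le; first by rewrite mulr_ge0 ?cabs_ge0 ?(ltW (K0 M)).
      by move=> x y; have := @V_lip i x y; rewrite iM.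
    rewrite mulrC -ler_pdivlMr ?powR_gt0 //; apply: le_trans hs _.
    by rewrite /e1 ge_min lexx.
  + have -> : \sum_(0 <= n < m) e * 2^-1 ^+ n.+1 = e * (1 - 2^-1 ^+ m).
      elim: m => [|m IH]; first by rewrite big_geq // expr0 subrr mulr0.
      by rewrite big_nat_recr //= IH exprS; field.
    rewrite -[leRHS]mulr1; apply: ler_wpM2l; first exact: ltW.
    by rewrite gerBl exprn_ge0.
Qed.
End UpperBound.

(** * Finite iterated function systems *)

(* Finitely many inverse branches of a fixed iterate [f ^ n], in logarithmic
   coordinates, normalized by multiples of [2 pi i] so as to map the rectangle
   [B] into itself; [sys_card] makes their limit set of dimension at least [s]. *)
Record inverse_system (R : realType) (N : nat) (u : 'I_N -> R[i] -> R[i]) (a s : R) (n nn : nat)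
  (om : 'I_nn.+1 -> seq (letter N)) (kk : 'I_nn.+1 -> int) (B : set R[i])
  (r dl Delta R1 : R) (b0 : R[i]) : Prop := InverseSystem {
  sys_n : (0 < n)%N;
  sys_size : forall i, size (om i) = n;
  sys_r : 0 < r < 1;
  sys_dl : 0 < dl;
  sys_dla : dl <= a;
  sys_Ba : forall x, B x -> a <= complex.Re x;
  sys_BR : forall x, B x -> complex.Re x <= R1;
  sys_BI : forall x y, B x -> B y -> `|complex.Im x - complex.Im y| <= pi;
  sys_kB : kconvex B;
  sys_GB : forall i x, B x -> B (shift (- kk i) (wmap u (om i) x));
  sys_contr : forall i x y, B x -> B y ->
    cabs (shift (- kk i) (wmap u (om i) x) - shift (- kk i) (wmap u (om i) y)) <= 2^-1 * cabs (x - y);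
  sys_der : forall i x, B x -> r <= cabs (wder u (om i) x);
  sys_diam : forall x y, B x -> B y -> cabs (x - y) <= Delta;
  sys_b0 : B b0;
  sys_b1 : exists2 b1, B b1 & complex.Re b0 < complex.Re b1;
  sys_sep : forall i j x y, i != j -> B x -> B y ->
    dl <= cabs (shift (- kk i) (wmap u (om i) x) - shift (- kk j) (wmap u (om j) y));
  sys_card : 1 <= nn.+1%:R * r `^ s }.

Section Rectangles.
Variable R : realType.
Local Notation C := R[i].
Lemma between (lo hi x y t : R) : lo <= x <= hi -> lo <= y <= hi -> 0 <= t <= 1 ->
  lo <= x + t * (y - x) <= hi.
Proof. by move=> /andP[x1 x2] /andP[y1 y2] /andP[t0 t1]; apply/andP; split; nra. Qed.
Definition rect (x1 x2 y1 y2 : R) : set C :=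
  [set z | x1 <= complex.Re z <= x2 /\ y1 <= complex.Im z <= y2].
Lemma kconvex_rect x1 x2 y1 y2 : kconvex (rect x1 x2 y1 y2).
Proof.
split=> [p q t [p1 p2] [q1 q2] t01|p hp].
  split; rewrite /seg_pt ?ReD ?ImD ?ReM ?ImM ?ReD ?ImD ?ReN ?ImN /= mul0r ?subr0 ?addr0; exact: between.
have Rd x : `|complex.Re p - complex.Re x| <= cabs (p - x).
  by rewrite -ReN -ReD; exact: Re_le_cabs.
have Id x : `|complex.Im p - complex.Im x| <= cabs (p - x).
  by rewrite -ImN -ImD; exact: Im_le_cabs.
have hp' e : 0 < e -> exists x, [/\ rect x1 x2 y1 y2 x, `|complex.Re p - complex.Re x| <= e & `|complex.Im p - complex.Im x| <= e].
  move=> /hp[x Kx /ltW px]; exists x; split => //; [exact: le_trans (Rd x) px|exact: le_trans (Id x) px].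
split; apply/andP; split; apply/ler_addgt0Pr => e /hp'[x [[/andP[a1 a2] /andP[a3 a4]]]]; rewrite !ler_norml; lra.
Qed.
Lemma quarter (y : R) : - pi <= y < pi -> exists c : 'I_4, `|y - (- pi + pi / 4 + c%:R * (pi / 2))| <= pi / 4.
Proof.
have p0 := pi_gt0 R; move=> /andP[y1 y2].
have [h1|h1] := leP y (- pi / 2).
  by exists (Ordinal (isT : (0 < 4)%N)); rewrite /= ler_norml; apply/andP; split; lra.
have [h2|h2] := leP y 0.
  by exists (Ordinal (isT : (1 < 4)%N)); rewrite /= ler_norml; apply/andP; split; lra.
have [h3|h3] := leP y (pi / 2).
  by exists (Ordinal (isT : (2 < 4)%N)); rewrite /= ler_norml; apply/andP; split; lra.
by exists (Ordinal (isT : (3 < 4)%N)); rewrite /= ler_norml; apply/andP; split; lra.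
Qed.
Lemma dyadic_size (w : R) : 0 < w <= 1 -> exists m, 2^-1 ^+ m.+1 < w <= 2^-1 ^+ m.
Proof.
move=> /andP[w0 w1]; have [k hk] := @expr_lt_eps R 2^-1 w ltac:(lra) w0.
have ex : exists m, 2^-1 ^+ m.+1 < w.
  exists k; apply: le_lt_trans hk; rewrite exprS; apply: ler_piMl; [exact: exprn_ge0|lra].
case: (ex_minnP ex) => m hm mmin; exists m; rewrite hm /=.
case: m hm mmin => [|m] hm mmin; first by rewrite expr0.
by rewrite leNgt; apply/negP => /mmin; rewrite ltnn.
Qed.
End Rectangles.

Section SystemExistence.
Variables (R : realType) (N : nat) (u : 'I_N -> R[i] -> R[i]) (a : R).
Local Notation C := R[i].
Local Notation H := (@Hright R).
Local Notation wder := (wder u).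
Local Notation wmap := (wmap u).
Local Notation kap := (kap a).
Variables (h s : R) (x0 : C) (S : nat -> R) (R0 c0 : R).
Hypotheses (hL : log_branches u a) (s0 : 0 < s) (sh : s < h) (ax0 : a <= complex.Re x0) (c00 : 0 < c0).
Hypothesis recu : forall n0, exists2 n, (n0 <= n)%N &
  exists2 V, @nwords N n V & (forall w, w \in V -> complex.Re (wmap w x0) <= R0) /\
    c0 * S n <= \sum_(w <- V) cabs (wder w x0) `^ h.
Hypothesis growth : forall th : R, 0 < th < 1 -> exists n0, forall n, (n0 <= n)%N -> th ^+ n <= S n.

(** Centres of four strips of height pi / 2 that fill one period. *)
Definition mid4 (c : 'I_4) : R := - pi + pi / 4 + c%:R * (pi / 2).

(* Pigeonhole over the dyadic size of [wder w x0] and over four horizontal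
   strips; the surplus [h - s] pays for summing over all dyadic sizes. *)
Lemma dyadic_words (A w1 : R) : 0 < A -> 0 < w1 <= 1 -> exists n c m L,
  [/\ (0 < n)%N, @nwords N n L, forall w, w \in L -> [/\ complex.Re (wmap w x0) <= R0,
     cabs (wder w x0) <= w1, 2^-1 ^+ m.+1 < cabs (wder w x0) <= 2^-1 ^+ m &
     exists k : int, `|complex.Im (wmap w x0) - k%:~R * (2 * pi) - mid4 c| <= pi / 4] &
   A <= \sum_(w <- L) cabs (wder w x0) `^ s].
Proof.
move=> A0 /andP[w10 w11]; have /andP[k0 k1] := kap01 hL.
have a0 : 0 < a by case: hL.
have r0 : 0 < complex.Re x0 by exact: lt_le_trans ax0.
have Hx : H x0 by [].
(* The surplus is spent in two halves: one yields the factor [ka ^+ n], the other makes the sum over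
   dyadic sizes converge. *)
pose s1 := (h - s) / 2; have s10 : 0 < s1 by rewrite divr_gt0 // subr_gt0.
have one_lt (x : R) : 0 < x -> x < 1 -> 0 < x `^ s1 < 1.
  move=> x1 x2; rewrite powR_gt0 //=.
  by have := gt0_ltr_powR s10 (x := x) (y := 1); rewrite powR1; apply; rewrite ?nnegrE ?ler01 ?(ltW x1).
pose ka := kap `^ s1; have /andP[ka0 ka1] : 0 < ka < 1 by exact: one_lt.
pose ga : R := 2^-1 `^ s1; have /andP[ga0 ga1] : 0 < ga < 1 by apply: one_lt; lra.
pose Q := 160 / complex.Re x0 / kap.
have Q0 : 0 < Q.
  have c160 : 0 < 160 :> R by rewrite ltr0n.
  exact: divr_gt0 (divr_gt0 c160 r0) k0.
pose th := (1 + ka) / 2; have [th0 th1 kth] : [/\ 0 < th, th < 1 & ka < th] by rewrite /th; split; lra.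
pose E := Q `^ s1 * (4 * (A / (1 - ga))).
have E0 : 0 < E by rewrite mulr_gt0 ?powR_gt0 // mulr_gt0 // divr_gt0 // subr_gt0.
have [n1 hn1] := @growth th ltac:(by rewrite th0 th1).
have rho0 : 0 <= ka / th by rewrite divr_ge0 ?ltW.
have rho1 : ka / th < 1 by rewrite ltr_pdivrMr // mul1r.
have [n2 hn2] := @expr_lt_eps_all R (ka / th) (c0 / E) ltac:(by rewrite rho0 rho1) (divr_gt0 c00 E0).
have [n3 hn3] := @expr_lt_eps_all R kap (w1 / Q) ltac:(by rewrite k1 ltW) (divr_gt0 w10 Q0).
have [n hn [V nV [VR Vsum]]] := recu (n1 + n2 + n3).+1.
have nn1 : (n1 <= n)%N by clear -hn; lia.
have nn2 : (n2 <= n)%N by clear -hn; lia.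
have nn3 : (n3 <= n)%N by clear -hn; lia.
have n0 : (0 < n)%N by clear -hn; lia.
have WQ w : w \in V -> cabs (wder w x0) <= Q * kap ^+ n.
  move=> wV; have sw := nV.2 w wV; have wn : w != [::] by case: (w) sw n0 => // <-.
  have := wder_log hL wn Hx; rewrite sw => hw.
  rewrite -(ler_pM2l r0); apply: le_trans hw _.
  rewrite -{2}(prednK n0) exprS le_eqVlt /Q; apply/orP; left; apply/eqP; field.
  by rewrite !gt_eqF.
have Ww1 w : w \in V -> cabs (wder w x0) <= w1.
  move=> /WQ /le_trans; apply; rewrite mulrC -ler_pdivlMr //; exact: ltW (hn3 n nn3).
have exd w : exists m, w \in V -> 2^-1 ^+ m.+1 < cabs (wder w x0) <= 2^-1 ^+ m.
  have [wV|wV] := boolP (w \in V); last by exists 0%N.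
  have [|m hm] := @dyadic_size R (cabs (wder w x0)); last by exists m.
  by rewrite (wder_gt0 hL) //=; apply: le_trans (Ww1 _ wV) w11.
have [dy hdy] := choice exd.
have exc w : exists c : 'I_4, exists k : int, `|complex.Im (wmap w x0) - k%:~R * (2 * pi) - mid4 c| <= pi / 4.
  have [k hk] := floor_reduce (complex.Im (wmap w x0)); have [c hc] := quarter hk.
  by exists c, k.
have [cl hcl] := choice exc.
pose L m c := [seq w <- V | (dy w == m) && (cl w == c)].
have uL m c : uniq (L m c) by exact: filter_uniq nV.1.
have [[c [m hm]]|/forallNP none] := pselect (exists c m, A <= \sum_(w <- L m c) cabs (wder w x0) `^ s).
  exists n, c, m, (L m c); split => //.
    by split=> // w; rewrite mem_filter => /andP[_ /nV.2].
  move=> w; rewrite mem_filter => /andP[/andP[/eqP <- /eqP <-] wV]; split; [exact: VR|exact: Ww1|exact: hdy|exact: hcl].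
(* If every class had a sum below [A] at exponent [s], the sum over [V] at exponent [h] would be at
   most E ka^n, which for this [n] is smaller than c0 th^n <= c0 S n. *)
exfalso.
pose F w := cabs (wder w x0) `^ s1 * cabs (wder w x0) `^ s.
have F0 w : 0 <= F w by rewrite mulr_ge0 ?powR_ge0.
have classS c : \sum_(w <- V | cl w == c) F w <= A / (1 - ga).
  rewrite -big_filter.
  apply: (@group_sum R _ dy (fun w => (w \in V) && (cl w == c)) F (fun m => ga ^+ m * A)) => //.
  - move=> m L' uL' hL'.
    have sub : {subset L' <= L m c}.
      by move=> w /hL'[/andP[wV cw] dw]; rewrite mem_filter dw eqxx cw.
    apply: (@le_trans _ _ (ga ^+ m * \sum_(w <- L') cabs (wder w x0) `^ s)).
      rewrite mulr_sumr big_seq [leRHS]big_seq; apply: ler_sum => w /hL'[/andP[wV _] dw].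
      apply: ler_wpM2r; first exact: powR_ge0.
      have /andP[_ hw] := hdy w wV; rewrite /ga -powR_exprn ?invr_ge0 //.
      by apply: ge0_ler_powR; rewrite ?nnegrE ?cabs_ge0 ?exprn_ge0 ?(ltW s10) // -dw.
    apply: ler_wpM2l; first by rewrite exprn_ge0 // ltW.
    apply: le_trans (sub_uniq_sum uL' sub (fun w => powR_ge0 (cabs (wder w x0)) s)) _.
    by rewrite leNgt; apply/negP => /ltW hh; apply: (none c); exists m.
  - move=> m; have g1 : 0 < 1 - ga by rewrite subr_gt0.
    have -> : \sum_(0 <= k < m) ga ^+ k * A = A * (1 - ga ^+ m) / (1 - ga).
      elim: m => [|m IH]; first by rewrite big_geq // expr0 subrr mulr0 mul0r.
      by rewrite big_nat_recr //= IH exprS; field; rewrite gt_eqF.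
    by rewrite ler_pM2r ?invr_gt0 // ler_piMr ?(ltW A0) // gerBl exprn_ge0 // ltW.
  - by rewrite filter_uniq //; exact: nV.1.
  - by apply/allP => w; rewrite mem_filter andbC.
have sumF : \sum_(w <- V) F w <= 4 * (A / (1 - ga)).
  rewrite (partition_big cl xpredT) //=; apply: le_trans (ler_sum _ (fun c _ => classS c)) _.
  by rewrite sumr_const card_ord mulr_natl.
have hW w : w \in V -> cabs (wder w x0) `^ h <= Q `^ s1 * ka ^+ n * F w.
  move=> wV; have d0 := wder_gt0 hL w Hx.
  have -> : cabs (wder w x0) `^ h = cabs (wder w x0) `^ s1 * F w.
    rewrite /F -!powRD; [by congr (_ `^ _); rewrite /s1; field| |]; by apply/implyP => _; rewrite gt_eqF.
  apply: ler_wpM2r; first exact: F0.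
  have b1 : 0 <= kap ^+ n by exact: exprn_ge0 (ltW k0).
  have b2 := mulr_ge0 (ltW Q0) b1.
  rewrite /ka -powR_exprn ?(ltW k0) // -powRM //; last exact: ltW.
  by apply: ge0_ler_powR; rewrite ?nnegrE ?cabs_ge0 ?(ltW s10) //; exact: WQ.
have b3 : c0 * th ^+ n <= E * ka ^+ n.
  apply: le_trans (_ : _ <= c0 * S n) _; first by apply: ler_wpM2l; [exact: ltW|exact: hn1].
  apply: le_trans Vsum _; rewrite big_seq; apply: le_trans (ler_sum _ hW) _.
  rewrite -big_seq -mulr_sumr [leRHS](_ : _ = Q `^ s1 * ka ^+ n * (4 * (A / (1 - ga)))); last by rewrite /E; ring.
  by apply: ler_wpM2l sumF; rewrite mulr_ge0 ?powR_ge0 // exprn_ge0 // ltW.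
have := hn2 n nn2; have t0 : 0 < th ^+ n by rewrite exprn_gt0.
rewrite (expr_div_n ka th n) ltr_pdivrMr // mulrAC ltr_pdivlMr // [ka ^+ n * E]mulrC.
by move=> b4; have := le_lt_trans b3 b4; rewrite ltxx.
Qed.
End SystemExistence.

Section ShiftedWords.
Variables (R : realType) (N : nat) (u : 'I_N -> R[i] -> R[i]) (a : R).
Local Notation C := R[i].
Local Notation H := (@Hright R).
Hypothesis hL : log_branches u a.
Variables (k : int) (w : seq (letter N)).
Local Notation G := (fun x => shift k (wmap u w x)).
Lemma cder_shifted x : H x -> cder G x (wder u w x).
Proof.
move=> Hx; have := gder_comp (cder_shift k (wmap u w x)) (cder_wmap hL w Hx).
by rewrite mul1r.
Qed.
Lemma hol_shifted : hol H G.
Proof. by move=> x /cder_shifted; exists (wder u w x). Qed.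
Lemma inj_shifted : inj_on H G.
Proof. by move=> x y Hx Hy /addIr; exact: (wmap_inj hL). Qed.
Lemma shifted_H x : H x -> H (G x).
Proof. by move=> Hx; apply: shift_H; exact: (wmap_H hL). Qed.
Lemma shiftB x y : shift k x - shift k y = x - y :> C.
Proof. by rewrite /shift; ring. Qed.
Lemma Im_shift x : complex.Im (shift k x) = complex.Im x + k%:~R * (2 * pi) :> R.
Proof. by rewrite /shift ImD Im_int_tpi. Qed.
End ShiftedWords.

Section SystemExistence.
Variables (R : realType) (N : nat) (u : 'I_N -> R[i] -> R[i]) (a : R).
Local Notation C := R[i].
Local Notation H := (@Hright R).
Local Notation wder := (wder u).
Local Notation wmap := (wmap u).
Variables (h s : R) (x0 : C) (S : nat -> R) (R0 c0 : R).
Hypotheses (hL : log_branches u a) (s0 : 0 < s) (sh : s < h) (ax0 : a <= complex.Re x0) (c00 : 0 < c0).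
Hypothesis recu : forall n0, exists2 n, (n0 <= n)%N &
  exists2 V, @nwords N n V & (forall w, w \in V -> complex.Re (wmap w x0) <= R0) /\
    c0 * S n <= \sum_(w <- V) cabs (wder w x0) `^ h.
Hypothesis growth : forall th : R, 0 < th < 1 -> exists n0, forall n, (n0 <= n)%N -> th ^+ n <= S n.

Lemma mid4_bound (c : 'I_4) : `|mid4 R c| <= pi.
Proof.
have p0 := pi_gt0 R; rewrite /mid4 ler_norml.
have c1 : c%:R <= 3 :> R by rewrite ler_nat -ltnS.
have c2 : 0 <= c%:R :> R by rewrite ler0n.
by apply/andP; split; nra.
Qed.

(** One dyadic class of words yields the system. Equal length makes them branches of one iterate, so
    distinct words have separated images; comparable derivatives turn the sum at exponent [s] into a
    count. *)
Lemma system_ex : exists n nn, exists om : 'I_nn.+1 -> seq (letter N), exists kk B r dl Delta R1 b0,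
  inverse_system u a s n om kk B r dl Delta R1 b0.
Proof.
have a0 : 0 < a by case: hL.
have ax := ax0; have pp := pi_gt0 R.
have xr : 0 < complex.Re x0 by exact: lt_le_trans ax0.
pose R1 := Num.max R0 a + 1.
have [RR Ra] : R0 + 1 <= R1 /\ a + 1 <= R1.
  by rewrite /R1 !lerD2r !le_max !lexx orbT.
pose b := a / 2; have b0 : 0 < b by rewrite divr_gt0.
have ba : b < a by rewrite /b; lra.
pose r0 := R1 + complex.Re x0 + `|complex.Im x0| + 2 * pi + 1.
have r00 : 1 < r0 by rewrite /r0; have := normr_ge0 (complex.Im x0); lra.
pose U := [set x : C | b < complex.Re x] `&` disc x0 r0.
have hU : hull_dom U by apply: hull_cap; [exact: hull_halfplane|exact: hull_disc].
have UH x : U x -> H x by move=> [h1 _]; exact: lt_trans b0 h1.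
have Ux0 : U x0 by split; rewrite /disc /= ?subrr ?cabs0; lra.
have aR1 : a <= R1 by lra.
have mid_in (y : R) : y - pi / 2 <= y <= y + pi / 2 by apply/andP; split; lra.
have close (m x y : R) : m - pi / 2 <= x <= m + pi / 2 -> m - pi / 2 <= y <= m + pi / 2 -> `|x - y| <= pi.
  by move=> /andP[? ?] /andP[? ?]; rewrite ler_norml; apply/andP; split; lra.
have strip2 (x y z : R) : `|x - y| < 1 -> `|y - z| <= pi -> `|x - z| < 2 * pi.
  have p2 := pi_ge2 R.
  by rewrite ltr_norml ler_norml ltr_norml => /andP[? ?] /andP[? ?]; apply/andP; split; lra.
have [D D1 hD] : exists2 D : R, 1 <= D & forall w x, U x ->
    cabs (wder w x) <= D * cabs (wder w x0) /\ cabs (wder w x0) <= D * cabs (wder w x).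
  have Z0 : 0 <= 15000 / b by apply: divr_ge0; [exact: ler0n|exact: ltW].
  have r0' : 0 <= r0 by exact: le_trans ler01 (ltW r00).
  exists (expR (15000 / b * r0)); first by rewrite -[X in X <= _]expR0 ler_expR; exact: mulr_ge0.
  move=> w x [x1 x2]; have bx0 := lt_le_trans ba ax0; split.
    apply: le_trans (wder_distortion hL w b0 x1 bx0) _.
    apply: ler_wpM2r; first exact: cabs_ge0.
    by rewrite ler_expR; apply: ler_wpM2l Z0 _ _ _; exact: ltW.
  apply: le_trans (wder_distortion hL w b0 bx0 x1) _.
  apply: ler_wpM2r; first exact: cabs_ge0.
  by rewrite ler_expR cabsC; apply: ler_wpM2l Z0 _ _ _; exact: ltW.
have D0 : 0 < D by exact: lt_le_trans ltr01 D1.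
(* The Lipschitz constant D * w1 on [U] is then at most 1/8, and [wmap w] sends [U] into the
   1/8-neighbourhood of [wmap w x0]: enough for the contraction and for the margins of [B]. *)
pose w1 := (D * (8 * r0 + 2))^-1.
have q0 : 0 < 8 * r0 + 2 by lra.
have w10 : 0 < w1 by rewrite invr_gt0 mulr_gt0.
have Dw1 : D * w1 = (8 * r0 + 2)^-1 by rewrite /w1; field; rewrite !gt_eqF.
have q1 : (8 * r0 + 2)^-1 <= 8^-1 by rewrite lef_pV2 ?posrE //; lra.
have q2 : (8 * r0 + 2)^-1 * r0 <= 8^-1.
  by rewrite mulrC ler_pdivrMr //; lra.
have w11 : w1 <= 1.
  apply: (@le_trans _ _ (D * w1)); last by rewrite Dw1; lra.
  by apply: ler_peMl => //; exact: ltW.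
have D20 : 0 < 2 * D by exact: mulr_gt0.
(* The target (2D)^s is what [sys_card] needs for the lower bound r = 2^-(m+1) / D of the
   derivatives. *)
have [n [c [m [L [n0 nL hLw hA]]]]] := @dyadic_words R N u a h s x0 S R0 c0 hL sh ax0 c00 recu growth
  ((2 * D) `^ s) w1 (powR_gt0 _ D20) ltac:(by rewrite w10 w11).
have m0 := mid4_bound c.
(* Height pi leaves a margin pi / 4 around the quarter strip for the displacement of the images, and
   stays well below the period 2 pi. *)
pose B := rect a R1 (mid4 R c - pi / 2) (mid4 R c + pi / 2).
have BU x : B x -> U x.
  move=> [/andP[x1 x2] /andP[x3 x4]]; split; first by rewrite /=; lra.
  rewrite /disc /=; apply: le_lt_trans (cabs_le_ReIm _) _; rewrite ReD ReN ImD ImN.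
  have h1 : `|complex.Im x - complex.Im x0| <= `|complex.Im x| + `|complex.Im x0| by exact: ler_normB.
  have h2 : `|complex.Re x - complex.Re x0| <= R1 + complex.Re x0 by rewrite ler_norml; lra.
  have h3 : `|complex.Im x| <= 3 / 2 * pi by move: m0; rewrite !ler_norml; lra.
  by rewrite /r0; lra.
have BH x : B x -> H x by move=> /BU /UH.
have dist x y : U x -> U y -> cabs (x - y) <= 2 * r0.
  by move=> [_ x1] [_ y1]; have := cabsB_tri x x0 y; rewrite (cabsC x0); rewrite /disc /= in x1 y1; lra.
have DW w : w \in L -> D * cabs (wder w x0) <= (8 * r0 + 2)^-1.
  by move=> /hLw[_ h1 _ _]; rewrite -Dw1; apply: ler_wpM2l => //; exact: ltW.
have lip w x y : w \in L -> U x -> U y -> cabs (wmap w x - wmap w y) <= (8 * r0 + 2)^-1 * cabs (x - y).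
  move=> wL Ux Uy; apply: (mean_value_ineq hU) => // v Uv; exists (wder w v).
    exact: (cder_wmap hL w (UH _ Uv)).
  by apply: le_trans (DW w wL); have [] := hD w v Uv.
have [nn sL] : exists nn, size L = nn.+1.
  case E : (size L) => [|nn]; last by exists nn.
  move: hA; rewrite (size0nil E) big_nil leNgt powR_gt0 //.
pose om (i : 'I_nn.+1) := nth [::] L i.
have omL i : om i \in L by apply: mem_nth; rewrite sL.
have exk (i : 'I_nn.+1) : exists k : int, `|complex.Im (wmap (om i) x0) - k%:~R * (2 * pi) - mid4 R c| <= pi / 4.
  by have [_ _ _ hk] := hLw _ (omL i).
have [kk hkk] := choice exk.
pose r := 2^-1 ^+ m.+1 / D.
have r_gt0 : 0 < r by rewrite divr_gt0 // exprn_gt0.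
have derB i x : B x -> r <= cabs (wder (om i) x).
  move=> /BU Ux; have [_ h1] := hD (om i) x Ux; have [_ _ /andP[h2 _] _] := hLw _ (omL i).
  by rewrite /r ler_pdivrMr // mulrC; apply: le_trans h1; exact: ltW.
pose s' := Num.min a 1.
have [s'0 s'a s'1] : [/\ 0 < s', s' <= a & s' <= 1].
  by rewrite /s' lt_min !ge_min !lexx a0 ltr01 orbT.
have r1 : r < 1.
  rewrite /r ltr_pdivrMr // mul1r; apply: lt_le_trans D1.
  by rewrite exprn_ilt1 //; lra.
exists n, nn, om, kk, B, r, (s' * r / 160), (2 * r0), R1, (Complex a (mid4 R c)).
split.
- exact: n0.
- by move=> i; exact: nL.2 _ (omL i).
- by rewrite r_gt0 r1.
- apply: divr_gt0; [exact: mulr_gt0|by rewrite ltr0n].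
- apply: le_trans s'a; rewrite -mulrA; apply: ler_piMr; first exact: ltW.
  by rewrite ler_pdivrMr ?ltr0n // mul1r; apply: le_trans (ltW r1) _; rewrite ler1n.
- by move=> x [/andP[]].
- by move=> x [/andP[]].
- by move=> x y [_ hx] [_ hy]; exact: close hx hy.
- exact: kconvex_rect.
- move=> i x Bx; have Ux := BU _ Bx; have wn : om i != [::].
    by rewrite -size_eq0 (nL.2 _ (omL i)) -lt0n.
  have h1 := wmap_gt hL wn (UH _ Ux).
  have h2 : cabs (wmap (om i) x - wmap (om i) x0) <= 4^-1.
    apply: le_trans (lip _ _ _ (omL i) Ux Ux0) _.
    apply: (@le_trans _ _ ((8 * r0 + 2)^-1 * r0)); last by lra.
    apply: ler_wpM2l; first by rewrite invr_ge0 ltW.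
    by case: Ux => _; rewrite /disc /= => /ltW.
  have h3 := le_trans (Re_le_cabs _) h2; have h4 := le_trans (Im_le_cabs _) h2.
  rewrite ReD ReN in h3; rewrite ImD ImN in h4.
  have [h5 _ _ _] := hLw _ (omL i); have h6 := hkk i.
  have p2 := pi_ge2 R.
  rewrite /B /rect /= Re_shift Im_shift mulrNz mulNr.
  move: h1 h3 h4 h5 h6 p2 RR; rewrite !ler_norml; clear.
  move: (complex.Re _) (complex.Im _) (complex.Re _) (complex.Im _) (_%:~R * _) (mid4 _ _) => A1 A2 A3 A4 A5 A6.
  move=> h1 /andP[h3 h3'] /andP[h4 h4'] h5 /andP[h6 h6'] p2 RR.
  by split; apply/andP; split; lra.
- move=> i x y /BU Ux /BU Uy; rewrite shiftB; apply: le_trans (lip _ _ _ (omL i) Ux Uy) _.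
  by apply: ler_wpM2r; [exact: cabs_ge0|lra].
- exact: derB.
- by move=> x y /BU Ux /BU Uy; exact: dist.
- by split; [rewrite /= lexx aR1|exact: mid_in].
- exists (Complex R1 (mid4 R c)); last by apply: lt_le_trans Ra; rewrite ltrDl.
  by split; [rewrite /= lexx aR1|exact: mid_in].
(* If two images came this close, Koebe's covering would give [xi] near [x] whose image under the
   first map is that of [y] under the second, against uniqueness of words in a strip of height below
   2 pi. *)
- move=> i j x y ij Bx By; rewrite leNgt; apply/negP => hlt.
  have Hx := BH _ Bx; have Hy := BH _ By.
  have xa : s' <= complex.Re x by case: Bx => /andP[x1 _] _; exact: le_trans x1.
  have near : disc (shift (- kk i) (wmap (om i) x))
      (s' * cabs ('D_1 (fun x => shift (- kk i) (wmap (om i) x)) x) / 160)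
      (shift (- kk j) (wmap (om j) y)).
    rewrite /disc /= cabsC; apply: lt_le_trans hlt _.
    rewrite (cder_val (@cder_shifted R N u a hL (- kk i) (om i) x Hx)).
    apply: ler_wpM2r; first by rewrite invr_ge0 ler0n.
    by apply: ler_wpM2l; [exact: ltW|exact: derB].
  have [xi xid xiE] := univalent_cover (hol_shifted hL (- kk i) (om i))
    (inj_shifted hL (k := - kk i) (w := om i)) s'0 xa near.
  have Hxi := disc_sub_H xa xid.
  have E : cexp (wmap (om i) xi) = cexp (wmap (om j) y).
    by rewrite -(cexp_shift (- kk i)) xiE cexp_shift.
  have sz : size (om i) = size (om j) by rewrite !(nL.2 _ (omL _)).
  have strip : `|complex.Im xi - complex.Im y| < 2 * pi.
    have h1 : `|complex.Im xi - complex.Im x| < 1.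
      by rewrite -ImN -ImD; apply: le_lt_trans (Im_le_cabs _) _; exact: lt_le_trans xid s'1.
    by apply: strip2 h1 _; case: Bx => _ hx; case: By => _ hy; exact: close hx hy.
  have [oE _] := word_unique_strip hL sz Hxi Hy strip E.
  move: ij; rewrite -val_eqE /= => /negP; apply.
  by move/eqP: oE; rewrite /om nth_uniq ?sL //; exact: nL.1.
- have sr : (2 * D) `^ s * r `^ s = (2^-1 ^+ m) `^ s.
    rewrite -powRM ?(ltW r_gt0) ?(ltW D20) //; congr (_ `^ s).
    by rewrite /r exprS; field; rewrite gt_eqF.
  have A0 : 0 < (2 * D) `^ s by rewrite powR_gt0.
  rewrite -(ler_pM2l A0) mulr1 mulrCA sr; apply: le_trans hA _.
  rewrite big_seq; apply: le_trans (_ : _ <= \sum_(w <- L | w \in L) (2^-1 ^+ m) `^ s) _.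
    apply: ler_sum => w /hLw[_ _ /andP[_ h2] _].
    by apply: ge0_ler_powR; rewrite ?nnegrE ?cabs_ge0 ?exprn_ge0 ?(ltW s0).
  by rewrite -big_seq big_const_seq count_predT iter_addr_0 sL mulr_natl.
Qed.
End SystemExistence.

(** * Normality of iterates *)

Lemma infinitely_often_subseq (P : nat -> Prop) : (forall n, exists2 k, (n < k)%N & P k) ->
  exists s : nat -> nat, {homo s : n m / (n < m)%N} /\ forall k, P (s k).
Proof.
move=> h; have ex n : exists k, (n < k)%N /\ P k by have [k nk Pk] := h n; exists k.
have [g hg] := choice ex.
exists (fun k => iter k.+1 g 0%N); split => [|k]; last exact: (hg _).2.
by apply: homo_ltn => [? ? ?|k]; [exact: ltn_trans|exact: (hg _).1].
Qed.

Section IterateFacts.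
Variable R : realType.
Local Notation C := R[i].
Variable f : C -> C.
Hypothesis df : forall z, cder f z ('D_1 f z).
Lemma cder_iter n z : exists d, cder (iter n f) z d.
Proof.
elim: n => [|n [d IH]]; first by exists 1; exact: gder_id.
by exists ('D_1 f (iter n f z) * d); exact: (gder_comp (df _) IH).
Qed.
Lemma iter_cont n z (e : R) : 0 < e -> exists2 r : R, 0 < r &
  forall x, cabs (x - z) < r -> cabs (iter n f x - iter n f z) < e.
Proof. by have [d hd] := cder_iter n z; exact: (gder_cont hd). Qed.

(* [h] below fixes [f y] and multiplies the derivative of [f] at [y] by
   [1 + dl]; it still maps the large disc into itself. *)
Section Contraction.
Variable tau : R.
Hypothesis tau0 : 0 < tau.
Local Notation rho := (1 + 2 * tau).
Hypothesis fb : forall z, cabs z < rho -> cabs (f z) <= 1.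
Let D : set C := disc 0 rho.
Let DE z : D z = (cabs z < rho) :> Prop. Proof. by rewrite /D /disc /= subr0. Qed.
Let q : R := (1 + tau / 2)^-1.
Lemma iter_disc n x : cabs x <= 1 + tau -> cabs (iter n f x) <= 1 + tau.
Proof.
move=> hx; elim: n => //= n IH; apply: le_trans (fb _) _; first by have := tau0; lra.
by have := tau0; lra.
Qed.
(** The argument of Earle and Hamilton. The induction runs over all [g]: passing from [g] to its
    composition with [h] gains a factor 1 + tau / 2, while the Cauchy estimate of the base case
    stays the same. *)
Lemma composed_derivative n (g : C -> C) x : hol D g -> (forall z, D z -> cabs (g z) <= 1) ->
  cabs x <= 1 + tau -> exists2 d, cder (fun v => g (iter n f v)) x d & cabs d <= 2 / tau * q ^+ n.
Proof.
have t0 := tau0; move=> + + x1; elim: n g => [|n IH] g hg gb.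
  have sub : disc x tau `<=` D.
    move=> w; rewrite /disc /= => hw; rewrite DE.
    by have := cabsD (w - x) x; rewrite subrK; lra.
  exists ('D_1 g x).
    by apply: (hol_cder hg); rewrite DE; lra.
  have := cauchy_estimate t0 (hol_sub sub hg) (fun w hw => gb w (sub w hw)).
  by rewrite expr0 !mulr1.
pose y := iter n f x; have [e he] := cder_iter n x.
have y1 := iter_disc n x1; rewrite -/y in y1.
pose h v := f v + (tau / 2)%:C * (f v - f y).
have dh v : cder h v ('D_1 f v + (tau / 2)%:C * 'D_1 f v).
  have := gderD (df v) (gderZ (tau / 2)%:C (gderB (df v) (gder_cst id (f y) v))).
  by rewrite subr0.
have Dy : D y by rewrite DE; lra.
have hDD v : D v -> D (h v).
  rewrite !DE => hv; apply: le_lt_trans (cabsD _ _) _; rewrite cabsM cabs_real gtr0_norm; last by lra.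
  have := fb hv; have := cabsD (f v) (- f y); rewrite cabsN.
  have := @fb y ltac:(by rewrite -DE) => h1 h2 h3.
  have h4 : tau / 2 * cabs (f v - f y) <= tau / 2 * 2 by apply: ler_wpM2l; lra.
  by lra.
have [] := IH (fun v => g (h v)).
- by apply: (@hol_comp R D D g h) => // v _; exists ('D_1 f v + (tau / 2)%:C * 'D_1 f v).
- by move=> z /hDD; exact: gb.
move=> d hd dle.
have hy : h y = f y by rewrite /h subrr mulr0 addr0.
have Dfy : D (f y) by rewrite DE; have := @fb y ltac:(by rewrite -DE); lra.
have gd := hol_cder hg Dfy.
have c1 := gder_comp gd (gder_comp (df y) he).
exists ('D_1 g (f y) * ('D_1 f y * e)); first exact: c1.
have gd' : cder g (h y) ('D_1 g (f y)) by rewrite hy.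
have gh := @gder_comp R C id g h y _ _ gd' (dh y).
have c2 := @gder_comp R C id (fun v => g (h v)) (iter n f) x _ _ gh he.
have E := cder_uniq hd c2.
have dE : d = (1 + tau / 2)%:C * ('D_1 g (f y) * ('D_1 f y * e)).
  have ar (A B T V : C) : A * (B + T * B) * V = (1 + T) * (A * (B * V)) by ring.
  have eC : (1 + tau / 2)%:C = 1 + (tau / 2)%:C :> C by rewrite rmorphD rmorph1.
  by rewrite eC E; exact: ar.
move: dle; rewrite dE cabsM cabs_real gtr0_norm; last by lra.
set X := cabs _; clear -t0 => h1.
have k0 : 0 < 1 + tau / 2 by lra.
rewrite exprS /q mulrCA -/q mulrC ler_pdivlMr // mulrC.
exact: h1.
Qed.

(** Consecutive iterates of [x] are the images of [f x] and [x] under one iterate, so the derivative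
    bound makes all orbits Cauchy at a uniform rate, without locating the fixed point. *)
Lemma iterates_converge : exists G : C -> C, exists L k : R, 0 <= k < 1 /\
  forall x n, cabs x < 1 + tau -> cabs (iter n.+1 f x - G x) <= L * k ^+ n.
Proof.
have t0 := tau0; have q0 : 0 < q by rewrite invr_gt0; lra.
have q1 : q < 1 by rewrite invf_lt1; lra.
have sub x : cabs x < 1 + tau -> disc 0 (1 + tau) x by rewrite /disc /= subr0.
have lip n x y : cabs x < 1 + tau -> cabs y < 1 + tau ->
    cabs (iter n.+1 f x - iter n.+1 f y) <= 2 / tau * q ^+ n * cabs (x - y).
  move=> x1 y1; apply: (mean_value_ineq (hull_disc 0 (1 + tau))); [|exact: sub|exact: sub].
  move=> v; rewrite /disc /= subr0 => /ltW v1.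
  apply: (composed_derivative n) => //.
    by move=> w _; exists ('D_1 f w).
  by move=> w; rewrite DE; exact: fb.
pose L := 2 / tau * (2 * (1 + tau)).
have step x n : cabs x < 1 + tau -> cabs (iter n.+2 f x - iter n.+1 f x) <= L * q ^+ n.
  move=> x1.
  have f1 : cabs (f x) <= 1 by apply: fb; lra.
  have -> : iter n.+2 f x = iter n.+1 f (f x) by exact: iterSr.
  apply: le_trans (lip n (f x) x _ x1) _; first by lra.
  rewrite /L mulrAC; apply: ler_wpM2r; first by rewrite exprn_ge0 // ltW.
  apply: ler_wpM2l; first by rewrite divr_ge0 // ltW.
  by have := cabsD (f x) (- x); rewrite cabsN; lra.
have ex x : exists p, cabs x < 1 + tau -> forall n, cabs (iter n.+1 f x - p) <= 2 * L / (1 - q) * q ^+ n.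
  have [x1|x1] := ltP (cabs x) (1 + tau); last by exists 0.
  have [||p hp] := @geometric_limit R (fun n => iter n.+1 f x) L q.
  - by rewrite q1 ltW.
  - by move=> n; exact: step.
  - by exists p => _ n; apply: le_trans (hp n) _; rewrite le_eqVlt; apply/orP; left; apply/eqP; ring.
have [G hG] := choice ex.
by exists G, (2 * L / (1 - q)), q; split; [rewrite q1 ltW|move=> x n x1; exact: hG].
Qed.

(* [Defs.fatou]: the unqualified name is Fatou's lemma in measure theory. *)
Lemma fatou_of_escape z m : cabs (iter m f z) <= 1 -> Defs.fatou f z.
Proof.
have t0 := tau0; move=> zm; have [r r0 hr] := iter_cont m z t0.
have hr' x : cabs (x - z) < r -> cabs (iter m f x) < 1 + tau.
  by move=> /hr h; have := cabsD (iter m f x - iter m f z) (iter m f z); rewrite subrK; lra.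
exists r => // s.
have inner w : cabs (w - z) < r -> exists2 d : R, 0 < d & forall x, cabs (x - w) < d -> cabs (x - z) < r.
  move=> hw; exists (r - cabs (w - z)); first by rewrite subr_gt0.
  by move=> x hx; have := cabsB_tri x w z; lra.
(* Normality quantifies over arbitrary sequences of indices: one that takes a value infinitely often
   has a constant subsequence; otherwise it tends to infinity and the iterates converge. *)
have [[v hv]|/forallNP hs] := pselect (exists v, forall n, exists2 k, (n < k)%N & s k = v).
  have [s' [s'_inc s'v]] := infinitely_often_subseq hv.
  exists s'; split => //; left; exists (iter v f) => w /inner[d d0 hd].
  exists d => //; split => // e e0; apply: nearW => k x _.
  by rewrite s'v subrr cabs0.
have [G [L [k [k01 hG]]]] := iterates_converge.
have s_inf b : exists K, forall j, (K < j)%N -> (b <= s j)%N.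
  elim: b => [|b [K hK]]; first by exists 0%N.
  have /existsNP[K' hK'] := hs b; exists (maxn K K') => j; rewrite gtn_max => /andP[j1 j2].
  rewrite ltn_neqAle hK // andbT; apply/eqP => bs; apply: hK'; by exists j.
exists id; split => //; left; exists (fun x => G (iter m f x)) => w /inner[d d0 hd].
exists d => //; split => // e e0.
have L0 : 0 < `|L| + 1 by have := normr_ge0 L; lra.
have [n0 hn0] := expr_lt_eps_all k01 (divr_gt0 e0 L0).
have [K hK] := s_inf (n0 + 1 + m)%N.
exists K.+1 => // j Kj x /hd /hr' xm.
have sj : (n0 + 1 + m <= s j)%N by apply: hK.
have -> : s j = ((s j - 1 - m).+1 + m)%N by clear -sj; lia.
rewrite iterD; apply: le_lt_trans (hG _ _ xm) _.
have hn : (n0 <= s j - 1 - m)%N by clear -sj; lia.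
have := hn0 _ hn; rewrite ltr_pdivlMr //; apply: le_lt_trans.
have /andP[k0 _] := k01; have kk : 0 <= k ^+ (s j - 1 - m) by exact: exprn_ge0.
by rewrite mulrC; apply: ler_wpM2l => //; have := ler_norm L; lra.
Qed.
End Contraction.

(* Arbitrarily close to [z] the iterates [f ^ (n k)] take two fixed distinct
   values, so no subsequence is equicontinuous at [z]. *)
Lemma not_fatou (z y1 y2 : C) (M : R) (n : nat) (z1 z2 : nat -> C) :
  (forall k, cabs (iter (n * k) f z) <= M) -> y1 <> y2 ->
  (forall k, iter (n * k) f (z1 k) = y1) -> (forall k, iter (n * k) f (z2 k) = y2) ->
  (forall e : R, 0 < e -> exists K, forall k, (K <= k)%N -> cabs (z1 k - z) < e /\ cabs (z2 k - z) < e) ->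
  ~ Defs.fatou f z.
Proof.
move=> zM y12 E1 E2 lim [r r0 /(_ (fun k => n * k)%N)[s' [s'_inc nf]]].
have s'_ge k : (k <= s' k)%N.
  by elim: k => // k IH; apply: leq_ltn_trans IH (s'_inc _ _ (ltnSn k)).
have zz : cabs (z - z) < r by rewrite subrr cabs0.
case: nf => [[G /(_ z zz)[d d0 [_ hG]]]|/(_ z zz)[d d0 [_ /(_ M)[K _ hK]]]]; last first.
  have := hK K (leqnn K) z; rewrite subrr cabs0 => /(_ d0).
  by rewrite ltNge zM.
have y0 : 0 < cabs (y1 - y2) by rewrite cabs_gt0 subr_eq0; exact/eqP.
pose e := cabs (y1 - y2) / 10; have e0 : 0 < e by rewrite /e; lra.
have [K _ hK] := hG e e0.
have [r1 r10 hr1] := iter_cont (n * s' K) z e0.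
have m0 : 0 < Num.min d r1 by rewrite lt_min d0 r10.
have [K2 hK2] := lim _ m0.
pose k := maxn K K2.
have [h1 h2] := hK2 (s' k) (leq_trans (leq_maxr K K2) (s'_ge k)).
have key y zz' : iter (n * s' k) f zz' = y -> cabs (zz' - z) < Num.min d r1 ->
    cabs (y - iter (n * s' K) f z) < 3 * e.
  rewrite lt_min => E /andP[zd zr].
  have a1 := hK k (leq_maxl K K2) zz' zd; have a2 := hK K (leqnn K) zz' zd; have a3 := hr1 zz' zr.
  rewrite /= E in a1; rewrite cabsC in a2.
  have t1 := cabsB_tri y (G zz') (iter (n * s' K) f z).
  have t2 := cabsB_tri (G zz') (iter (n * s' K) f zz') (iter (n * s' K) f z).
  lra.
have b1 := key _ _ (E1 (s' k)) h1; have b2 := key _ _ (E2 (s' k)) h2.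
have := cabsB_tri y1 (iter (n * s' K) f z) y2; rewrite [cabs (iter _ _ _ - y2)]cabsC.
by rewrite /e in b1 b2; lra.
Qed.
End IterateFacts.

(** * The radial Julia set *)

Section EsumLists.
Variables (R : realType) (T : choiceType).
(** Exchanges an infinite sum for two statements about finite lists. Reaching half of it is enough,
    since constant factors do not affect exponential growth. *)
Lemma esum_finite_lists (A : set T) (F : T -> R) (S : R) : (forall i, 0 <= F i) -> 0 < S ->
  (\esum_(i in A) (F i)%:E)%E = S%:E ->
  (forall W : seq T, uniq W -> (forall i, i \in W -> A i) -> \sum_(i <- W) F i <= S) /\
  exists2 W : seq T, uniq W /\ (forall i, i \in W -> A i) & S / 2 <= \sum_(i <- W) F i.
Proof.
move=> F0 S0 E; split=> [W uW WA|].
  rewrite -lee_fin -E /esum; apply: ereal_sup_ubound; exists [set` W].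
    by split; [exact: finite_seq|move=> i /= /WA].
  by rewrite -fsbig_seq // sumEFin.
have : ((S / 2)%:E < \esum_(i in A) (F i)%:E)%E by rewrite E lte_fin; lra.
rewrite /esum => /ereal_sup_gt[_ [X [/finite_seqP[r rE] XA] <-] hX].
have rE' : X = [set` undup r].
  by rewrite rE; apply/seteqP; split => i /=; rewrite mem_undup.
exists (undup r).
  split; first exact: undup_uniq.
  by move=> i ir; apply: XA; rewrite rE'.
by move: hX; rewrite rE' -fsbig_seq ?undup_uniq // sumEFin lte_fin => /ltW.
Qed.

Lemma limn_einf_bounded (v : nat -> R) :
  (limn_einf (fun n => (v n)%:E) < +oo)%E <->
  exists M : nat, forall n, exists2 k, (n <= k)%N & v k <= M%:R.
Proof.
rewrite limn_einf_lim; split=> [h|[M hM]]; last first.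
  apply: (@le_lt_trans _ _ M%:R%:E); last exact: ltry.
  apply: lime_le; first exact: is_cvg_einfs.
  apply: nearW => n; have [k nk vk] := hM n.
  apply: ge_ereal_inf; exists (v k)%:E; last by rewrite lee_fin.
  by exists k.
have [L [L0 hL]] : exists L : R, 0 <= L /\ (limn (einfs (fun n => (v n)%:E)) < L%:E)%E.
  move: h; case: (limn _) => [r| |] // _; last by exists 0; split => //; rewrite ltNyr.
  exists (`|r| + 1); split; first by rewrite addr_ge0.
  by rewrite lte_fin; have := ler_norm r; lra.
exists (Num.bound L) => n; have : (einfs (fun n => (v n)%:E) n < L%:E)%E.
  apply: le_lt_trans hL.
  have -> : limn (einfs (fun n => (v n)%:E)) = ereal_sup (range (einfs (fun n => (v n)%:E))).
    by apply/cvg_lim => //; exact: cvg_einfs_sup.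
  by apply: ereal_sup_ubound; exists n.
move=> /ereal_inf_lt[_ [k nk <-]]; rewrite lte_fin => vk; exists k => //.
by apply/ltW/(lt_trans vk)/archi_boundP.
Qed.
End EsumLists.

Section Dynamics.
Variable R : realType.
Local Notation C := R[i].
Local Notation H := (@Hright R).
Variables (f : C -> C) (entire : bool) (N : nat).
Variables (Om : 'I_N -> set C) (tau phi : 'I_N -> C -> C).
Variables (a : R) (u : 'I_N -> C -> C).
Hypotheses (hD : classD f entire Om tau phi) (hL : log_branches u a).
Hypothesis phiE : forall j x, H x -> phi j x = cexp (u j x).
Hypothesis Om_far : forall j z, Om j z -> expR a <= cabs z.
Local Notation tracts := (\bigcup_j Om j).
Let a0 : 0 < a. Proof. by case: hL. Qed.

Lemma entire_cder : entire -> forall z, cder f z ('D_1 f z).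
Proof. by case: hD => _ _ _ _ []; case: entire => // _ [df _ _ _] _ z; exact: cder_derivable. Qed.
Lemma entire_tract z : entire -> 1 < cabs (f z) -> tracts z.
Proof.
case: hD => _ _ _ _ []; case: entire => // _ [_ _ _ h] _ z1.
by have [j Oz] := h z z1; exists j.
Qed.

(** Off its tracts an entire [f] satisfies |f| <= 1, and the tracts lie in |z| >= exp a. So the disc
    of radius exp a is mapped into the closed unit disc, and an orbit that leaves the tracts is
    caught there, which puts its starting point in the Fatou set. *)
Lemma julia_tracts z n : julia f entire Om z -> tracts (iter n f z).
Proof.
have := @entire_tract; have := entire_cder; rewrite /julia; case: entire; last by move=> _ _; exact.
move=> /(_ isT) df /(_ _ isT) ot hz; apply: contrapT => hn; apply: hz.
have ea : 1 < expR a by rewrite -expR0 ltr_expR.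
(* Solves 1 + 2 * tau = expR a, the radius of the disc free of tracts. *)
have t0 : 0 < (expR a - 1) / 2 by lra.
apply: (@fatou_of_escape R f df _ t0 _ z n.+1).
  move=> y; rewrite (_ : 1 + 2 * ((expR a - 1) / 2) = expR a); last by field.
  move=> hy; rewrite leNgt; apply/negP => /ot[j _ /Om_far].
  by rewrite leNgt hy.
by rewrite leNgt; apply/negP => /ot.
Qed.

Lemma log_coordinate z : expR a <= cabs z ->
  exists x, [/\ z = cexp x, a <= complex.Re x & `|complex.Im x| <= pi].
Proof.
move=> hz; have z0 : z != 0.
  by rewrite -cabs_gt0; apply: lt_le_trans hz; exact: expR_gt0.
have [x xE xI] := cexp_surj z0; exists x; split => //.
by move: hz; rewrite -xE cabs_cexp ler_expR.
Qed.

Lemma lift_orbit k z x : (forall m, (m < k)%N -> tracts (iter m f z)) -> H x ->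
  iter k f z = cexp x -> exists2 s, size s = k & z = cexp (wmap u s x).
Proof.
move=> + Hx; elim: k z => [|k IH] z ht; first by exists [::].
rewrite iterSr => E; have [m mk|s sk sE] := IH (f z) _ E.
  by rewrite -iterSr; exact: ht.
have [j _ Oz] := ht 0%N isT.
have [i [iE _]] := tract_letter hD phiE Oz sE.
by exists (rcons s i); rewrite ?size_rcons ?sk // wmap_rcons.
Qed.

Lemma word_orbit s x : H x -> iter (size s) f (cexp (wmap u s x)) = cexp x /\
  forall m, (m < size s)%N -> tracts (iter m f (cexp (wmap u s x))).
Proof.
move=> Hx; elim/last_ind: s => [|s i [IH1 IH2]] //.
have [h1 h2] := gm_tract hD phiE i (wmap_H hL s Hx).
rewrite size_rcons wmap_rcons iterSr h2; split=> // -[_|m ms]; first by exists i.1.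
by rewrite iterSr h2; exact: IH2.
Qed.

(** Koebe for the exponential on a disc of radius at most 1, where it is injective, brings
    separation from logarithmic coordinates back to the plane. *)
Lemma cexp_separation x y (rho : R) : 0 < rho <= 1 -> 0 <= complex.Re x ->
  `|complex.Im x - complex.Im y| <= pi -> rho <= cabs (x - y) ->
  rho / 160 <= cabs (cexp x - cexp y).
Proof.
move=> /andP[r0 r1] x0 xy hr; have p2 := pi_ge2 R.
have hE : hol (disc x rho) (@cexp R) by move=> z _; exists (cexp z); exact: cder_cexp.
have close (z w : C) : cexp z = cexp w -> `|complex.Im z - complex.Im w| < 2 * pi -> z = w.
  move=> /cexp_inj_period[k ->]; rewrite ImD Im_int_tpi addrAC subrr add0r normrM.
  have pp : 0 < 2 * pi :> R by lra.
  rewrite (ger0_norm (ltW pp)) -[X in _ < X]mul1r ltr_pM2r // -intr_norm -[1]/(1%:~R) ltr_int => hk.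
  by rewrite (_ : k = 0) ?mulr0z ?mul0r ?addr0 //; clear -hk; lia.
have iE : inj_on (disc x rho) (@cexp R).
  move=> z w hz hw /close; apply; rewrite /disc /= in hz hw.
  have := le_lt_trans (Im_le_cabs _) hz; have := le_lt_trans (Im_le_cabs _) hw.
  by rewrite !ImD !ImN !ltr_norml => /andP[? ?] /andP[? ?]; apply/andP; split; lra.
have [cov _ _] := koebe (w0 := 0) r0 hE iE (fun z _ => cexp_neq0 z).
rewrite leNgt; apply/negP => hlt.
have hd : disc (cexp x) (rho * cabs ('D_1 (@cexp R) x) / 160) (cexp y).
  rewrite /disc /= cabsC; apply: lt_le_trans hlt _.
  rewrite (cder_val (cder_cexp x)) cabs_cexp; apply: ler_wpM2r; first by rewrite invr_ge0 ler0n.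
  by apply: ler_peMr; [exact: ltW|rewrite -[X in X <= _]expR0 ler_expR].
have [z zd /close zy] := cov _ hd.
have strip : `|complex.Im z - complex.Im y| < 2 * pi.
  have := le_lt_trans (Im_le_cabs _) zd; move: xy.
  by rewrite ImD ImN ltr_norml ler_norml ltr_norml => /andP[? ?] /andP[? ?]; apply/andP; split; lra.
by move: zd; rewrite (zy strip) /disc /= cabsC ltNge hr.
Qed.

Definition radial := [set z | julia f entire Om z /\ (limn_einf (fun n => (cabs (iter n f z))%:E) < +oo)%E].

(** A finite lower limit means infinitely many returns to a fixed annulus; lifting the orbit back
    from the return at time [k] yields a word of length [k]. *)
Lemma radial_boxes z : radial z -> exists2 M : nat, cabs z <= M%:R & forall n0, exists s, exists2 x,
     (n0 <= size s)%N & box a M%:R x /\ z = cexp (wmap u s x).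
Proof.
move=> [Jz /limn_einf_bounded[M hM]].
pose M' := maxn M (Num.bound (cabs z)).
exists M'; first by apply: le_trans (ltW (archi_boundP (cabs_ge0 z))) _; rewrite ler_nat leq_maxr.
move=> n0; have [k nk vk] := hM n0.
have hT m : tracts (iter m f z) by exact: julia_tracts.
have [j _ Oz] := hT k; have [x [xE xa xI]] := log_coordinate (Om_far Oz).
have [s sk sE] := lift_orbit (fun m _ => hT m) (lt_le_trans a0 xa) xE.
exists s; exists x; first by rewrite sk.
split => //; split => //; rewrite -cabs_cexp -xE; apply: le_trans vk _.
by rewrite ler_nat leq_maxl.
Qed.

(** * The limit set inside the radial Julia set *)

Section LimitSetPoints.
Variables (s : R) (n nn : nat) (om : 'I_nn.+1 -> seq (letter N)) (kk : 'I_nn.+1 -> int) (B : set C).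
Variables (r dl Delta R1 : R) (b0 : C).
Hypothesis sys : inverse_system u a s n om kk B r dl Delta R1 b0.
Let G i x := shift (- kk i) (wmap u (om i) x).
Let hG i : hol H (G i). Proof. exact: (hol_shifted hL). Qed.
Let iG i : inj_on H (G i). Proof. exact: (inj_shifted hL). Qed.
Let GH i x : H x -> H (G i x). Proof. exact: (shifted_H hL). Qed.
Let BH x : B x -> H x. Proof. by move=> /(sys_Ba sys); exact: lt_le_trans a0. Qed.
Let derG i x : B x -> r <= cabs ('D_1 (G i) x).
Proof. by move=> Bx; rewrite (cder_val (@cder_shifted R N u a hL (- kk i) (om i) x (BH Bx))); exact: (sys_der sys). Qed.
Local Notation P := (limit_pt G Delta b0).
Let P_B c : B (P c).
Proof. exact: (limit_B (sys_kB sys) (sys_GB sys) (sys_contr sys) (sys_diam sys) (sys_b0 sys)). Qed.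
Let P_shift c : P c = G (c 0%N) (P (c \o succn)).
Proof. exact: (limit_shift (sys_kB sys) (sys_GB sys) (sys_contr sys) (sys_diam sys) (sys_b0 sys)). Qed.
Let P_Gam c k : P c = Gam G c k (P (fun j => c (k + j)%N)).
Proof. exact: (limit_Gam (sys_kB sys) (sys_GB sys) (sys_contr sys) (sys_diam sys) (sys_b0 sys)). Qed.

Let step i x : H x -> iter n f (cexp (G i x)) = cexp x /\
  forall m, (m < n)%N -> tracts (iter m f (cexp (G i x))).
Proof.
by move=> Hx; have := word_orbit (om i) Hx; rewrite (sys_size sys) /G cexp_shift.
Qed.
Lemma iter_Gam c k x : H x -> iter (n * k) f (cexp (Gam G c k x)) = cexp x.
Proof.
move=> Hx; elim: k c => [|k IH] c; first by rewrite muln0.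
have Hy : H (Gam G (c \o succn) k x) by exact: Gam_H.
by rewrite mulnS addnC iterD /= (step (c 0%N) Hy).1 IH.
Qed.
Lemma limit_iter c k : iter (n * k) f (cexp (P c)) = cexp (P (fun j => c (k + j)%N)).
Proof. by rewrite {1}(P_Gam c k) iter_Gam //; exact/BH/P_B. Qed.
Lemma limit_tracts c m : tracts (iter m f (cexp (P c))).
Proof.
have key k : forall c m, (m < n * k)%N -> tracts (iter m f (cexp (P c))).
  elim: k => [|k IH] c' m'; first by rewrite muln0.
  have [h1 h2] := step (c' 0%N) (BH (P_B (c' \o succn))).
  rewrite -P_shift in h1 h2; rewrite mulnS => hm.
  have [mn|nm] := ltnP m' n; first exact: h2.
  by rewrite -(subnK nm) iterD h1; apply: IH; rewrite ltn_subLR.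
apply: (key m.+1); have n0 := sys_n sys.
by apply: leq_trans (leq_pmull _ n0).
Qed.

(** For a model, staying in the tracts suffices. For an entire [f], preimages of [cexp b0] and
    [cexp b1] under f^(n k) accumulate at the point, whose own orbit is bounded along these times;
    the two values differ in modulus because the real parts of [b0] and [b1] differ. *)
Lemma limit_julia c : julia f entire Om (cexp (P c)).
Proof.
have hT := limit_tracts c.
have := entire_cder; rewrite /julia; case: entire => // /(_ isT) df.
have [b1 Bb1 b01] := sys_b1 sys.
apply: (@not_fatou R f df (cexp (P c)) (cexp b0) (cexp b1) (expR R1) n
   (fun k => cexp (Gam G c k b0)) (fun k => cexp (Gam G c k b1))).
- by move=> k; rewrite limit_iter cabs_cexp ler_expR; exact: (sys_BR sys).
- move=> /(congr1 (@cabs R)); rewrite !cabs_cexp => /expR_inj E; move: b01; rewrite E ltxx //.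
- by move=> k; apply: iter_Gam; apply: BH; exact: (sys_b0 sys).
- by move=> k; apply: iter_Gam; exact: BH.
move=> e e0; have [d d0 hd] := gder_cont (cder_cexp (P c)) e0.
have D1 : 0 < `|Delta| + 1 by have := normr_ge0 Delta; lra.
have [K hK] := @expr_lt_eps_all R 2^-1 (d / (`|Delta| + 1)) ltac:(lra) (divr_gt0 d0 D1).
have near b k : B b -> (K <= k)%N -> cabs (cexp (Gam G c k b) - cexp (P c)) < e.
  move=> Bb Kk; apply: hd; rewrite /= (P_Gam c k).
  have h1 := Gam_contr (sys_GB sys) (sys_contr sys) c k Bb (P_B (fun j => c (k + j)%N)).
  apply: le_lt_trans h1 _; have := hK k Kk; rewrite ltr_pdivlMr //; apply: le_lt_trans.
  apply: ler_wpM2l; first by rewrite exprn_ge0.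
  apply: le_trans (sys_diam sys Bb (P_B _)) _; have := ler_norm Delta; lra.
by exists K => k Kk; split; apply: near => //; exact: (sys_b0 sys).
Qed.

Lemma limit_radial c : radial (cexp (P c)).
Proof.
split; first exact: limit_julia.
apply/limn_einf_bounded; exists (Num.bound (expR R1)) => m; exists (n * m)%N.
  by apply: leq_pmull; exact: (sys_n sys).
rewrite limit_iter cabs_cexp; apply: le_trans (ltW (archi_boundP (expR_ge0 R1))).
by rewrite ler_expR; exact: (sys_BR sys).
Qed.

Lemma radial_measure_neq0 : 0 < s -> hausdorff_measure s radial <> 0%E.
Proof.
move=> s0; have d0 := sys_dl sys; have /andP[r0 r1] := sys_r sys.
pose m0 := Num.min (dl / 160) 1.
have c160 : 0 < 160 :> R by rewrite ltr0n.
have dl160 := divr_gt0 d0 c160.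
have [m00 m01 m0d] : [/\ 0 < m0, m0 <= 1 & m0 <= dl / 160].
  by rewrite /m0 lt_min !ge_min dl160 ltr01 !lexx orbT.
apply: (@coded_set_measure R nn (fun c => cexp (P c)) radial s r (m0 / 160)) => //.
- by rewrite r0 r1.
- exact: divr_gt0.
- exact: (sys_card sys).
- exact: limit_radial.
move=> c c' K hK.
have h := limit_sep a0 (sys_r sys) d0 (sys_dla sys) hG iG GH (sys_Ba sys) (sys_kB sys) (sys_GB sys)
   (sys_contr sys) derG (sys_diam sys) (sys_b0 sys) (sys_sep sys) hK.
rewrite mulrAC; apply: cexp_separation.
- rewrite mulr_gt0 ?exprn_gt0 //=; apply: (@le_trans _ _ (1 * 1)); last by rewrite mulr1.
  by apply: ler_pM; rewrite ?exprn_ge0 ?(ltW m00) ?(ltW r0) // exprn_ile1 // ltW.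
- by apply: le_trans (sys_Ba sys (P_B c)); exact: ltW a0.
- exact: (sys_BI sys).
- by apply: le_trans h; apply: ler_wpM2r; rewrite ?exprn_ge0 // ltW.
Qed.
End LimitSetPoints.
End Dynamics.

(* The two inequalities for the hyperbolic dimension *)
Close Scope complex_scope.
Unset Implicit Arguments.

Theorem theorem1p5 (R : realType) (f : R[i] -> R[i]) (entire : bool) (N : nat)
  (Om : 'I_N -> set R[i]) (tau phi : 'I_N -> R[i] -> R[i]) (h : R) :
  classD f entire Om tau phi ->
  negative_spectrum phi ->
  (Theta phi < h%:E)%E ->
  pressure_zero f entire Om h ->
  hyp_dim f entire Om = h%:E.
Proof.
move=> hD neg hTh [w Jw [Tfin Tlim]].
have [a [u [hL phiE far]]] := log_coordinates hD.
have a0 : 0 < a by case: hL.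
(* The base point of the pressure lies in a tract. Hence there is at least one tract, and [w] has a
   logarithm [x0] with real part at least [a]. *)
have [j _ Ow] : (\bigcup_j Om j) w := @julia_tracts R f entire N Om tau phi a u hD hL far w 0%N Jw.
have N0 : (0 < N)%N by exact: leq_trans (ltn_ord j).
have [x0 [wE ax0 _]] := log_coordinate (far j w Ow).
have Hx0 : @Hright R x0 by exact: lt_le_trans a0 ax0.
have [h0 [K K0 [q q0 hK]]] := letter_sums hD hL phiE neg N0 hTh.
pose S n := fine (transfer_iter f (fdom entire Om) h n w).
have S0 n : 0 < S n by rewrite fine_gt0 // Tfin.
have SE n : (\esum_(s in @words N n) (cabs (wder u s x0) `^ h)%:E)%E = (S n)%:E.
  rewrite fineK; last by rewrite ge0_fin_numE; [have /andP[] := Tfin n|apply: ltW; have /andP[] := Tfin n].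
  rewrite /transfer_iter wE (transfer_words hD hL phiE) //.
  by apply: eq_esum => s _; rewrite mule1.
have Sl n := esum_finite_lists (fun s => powR_ge0 (cabs (wder u s x0)) h) (S0 n) (SE n).
have S_ub n W : nwords n W -> \sum_(s <- W) cabs (wder u s x0) `^ h <= S n.
  by move=> [uW hW]; exact: (Sl n).1.
have S_lb n : exists2 W, @nwords N n W & S n / 2 <= \sum_(s <- W) cabs (wder u s x0) `^ h.
  by have [_ [W [uW hW] hS]] := Sl n; exists W.
have growth := S_growth S0 Tlim.
have [R0 [c0 [c00 recu]]] := recurrent_words hL K0 q0 hK ax0 S0 S_ub S_lb Tlim.
have upper t : h < t -> hausdorff_measure t (radial f entire Om) = 0%E.
  move=> ht; have t0 : 0 < t by exact: lt_trans ht.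
  apply: (upper_measure0 hL t0 ax0).
    by move=> e e0; exact: (large_word_sums hL ax0 S0 S_ub Tlim ht e0).
  by move=> z; exact: (radial_boxes hD hL phiE far).
have lower s : 0 < s -> s < h -> hausdorff_measure s (radial f entire Om) <> 0%E.
  move=> s0 sh; have growth' th : 0 < th < 1 -> exists n0, forall n, (n0 <= n)%N -> th ^+ n <= S n.
    by move=> /growth[n0 hn]; exists n0 => n /hn /andP[].
  have [n [nn [om [kk [B [r [dl [Delta [R1 [b0 sys]]]]]]]]]] := system_ex hL s0 sh ax0 c00 recu growth'.
  exact: (radial_measure_neq0 hD hL phiE sys s0).
(* The dimension is the infimum of the exponents of measure zero: [upper] puts every t > h among
   them, [lower] excludes every positive s < h. *)
apply/eqP; rewrite eq_le; apply/andP; split.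
  apply/lee_addgt0Pr => e e0; apply: ereal_inf_lbound; exists (h + e) => //.
  by split; [exact: addr_gt0|apply: upper; rewrite ltrDl].
apply: le_ereal_inf_tmp => _ [s [s0 hs] <-]; rewrite lee_fin leNgt; apply/negP => sh.
exact: lower s0 sh hs.
Qed.
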